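(* Let $\Delta$ be a nice diagram with $n$ nodes, $n\leq5$, let $(\mathcal A,A,D)$ be a nondiagonal triple on $\Delta$ and let $(\{c_I\},\epsilon)$ be a nondiagonal solution for it (so that it gives a solution $(\mathfrak g,\sum_i\epsilon_ie^i\otimes e^i,D)$ of the equation \[\operatorname{Ric}=-\operatorname{tr}((D^s)^2)\operatorname{Id}-\tfrac12[D,D^*]+(\operatorname{tr}D)D^s,\qquad \operatorname{tr}(\operatorname{ad}v\circ D^* )=0\ \text{ for all } v\in\mathfrak g).\] Then this solution is equivalent to exactly one entry of the list of Lie algebras, derivations and signatures written out in the context.
   Context: All Lie algebras are real, finite-dimensional; nice Lie algebras are nilpotent. $\operatorname{Ric}$ is the Ricci operator of the left-invariant pseudo-Riemannian metric determined by a metric (nondegenerate symmetric bilinear form of any signature) on $\mathfrak g$; $D^*$ is the metric adjoint, $D^s=\frac12(D+D^* )$. The endomorphism $e^i\otimes e_j$ maps $v$ to $e^i(v)e_j$. Nice Lie algebras and nice diagrams. A basis $e_1,\dotsc,e_n$ with dual basis $e^1,\dotsc,e^n$ is a nice basis if each $[e_i,e_j]$ is a multiple of a single basis element and each $e_i\lrcorner de^j=de^j(e_i,\cdot)$ is a multiple of a single dual basis element. A nice Lie algebra is a (nilpotent) Lie algebra with a fixed nice basis. Its nice diagram is the labeled directed acyclic graph with nodes $\{1,\dotsc,n\}$ having an arrow $i\to k$ with label $j$, written $i\xrightarrow{j}k$, exactly when $[e_i,e_j]=c_{ijk}e_k$ with $c_{ijk}\neq0$. Nice diagrams here are labeled graphs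 arising in this way; $N(\Delta)$ is the set of nodes. Root matrix. $M_\Delta$ is the matrix with $n$ columns having one row $I$ for each pair of arrows $i\xrightarrow{j}k$, $j\xrightarrow{i}k$, with $-1$ in positions $i,j$, $+1$ in position $k$ and $0$ elsewhere; $c_I$ denotes the structure constant $c_{ijk}$. $M_{\Delta,2}$ is the reduction modulo $2$. For nonzero real $x$, $\operatorname{logsign}x\in\mathbb Z/2$ is $1$ if $x<0$ and $0$ if $x>0$ (entrywise on vectors). $[x]\in\mathbb R^n$ is the vector with all entries $x$; $e_i$ denotes also the $i$-th standard basis vector of $\mathbb R^n$. Nondiagonal triple. $(\mathcal A,A,D)$, with $\emptyset\neq\mathcal A\subset N(\Delta)\times N(\Delta)$, $A\colon\mathcal A\to\mathbb R\setminus\{0\}$, $A^i_j:=A(i,j)$, $D\colon\mathbb R^n\to\mathbb R^n$ linear, is a nondiagonal triple on $\Delta$ if: (N1) $i\neq j$ whenever $(i,j)\in\mathcal A$; (N2) whenever $(i,j),(i',j')$ are distinct elements of $\mathcal A$, the elements $i,j,i',j'$ are pairwise distinct; (N3) if $(i,j)\in\mathcal A$, there is no arrow $i\xrightarrow{k}j$ for any $k$; (N4) denoting by $(\lambda_1,\dotsc,\lambda_n)$ the diagonal elements of $D$, for every $\mu\in\ker M_\Delta$, $\sum_i\lambda_i\mu_i=\bigl(1+\sum_{(i,j)\in\mathcal A}A^i_j\bigr)\sum_i\mu_i+\sum_{(i,j)\in\mathcal A}A^i_j(\mu_j-\mu_i)$; (N5) $\lambda_1+\dotsb+\lambda_n=\lambda_i-\lambda_j$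 whenever $(i,j)\in\mathcal A$; (N6) $D=\sum_i\lambda_ie^i\otimes e_i+\sum_{(i,j)\in\mathcal A}a_{ji}e^i\otimes e_j$, where $a_{ji}^2=|2A^i_j\operatorname{tr}D|\neq0$ and $(\lambda_1,\dotsc,\lambda_n)\in\ker M_\Delta$. Nondiagonal solution. Given a nondiagonal triple on $\Delta$, a nondiagonal solution is a pair $(\{c_I\},\epsilon)$, where $\{c_I\}$ are structure constants of a nice Lie algebra $\mathfrak g$ with nice diagram $\Delta$ for which $D$ is a derivation, and $\epsilon\in\{\pm1\}^n$, such that for some real vector $X=(x_I)$: $\frac1{2\operatorname{tr}D}({}^tM_\Delta X)=[-1-\sum_{(i,j)\in\mathcal A}A^i_j]+\sum_{(i,j)\in\mathcal A}A^i_j(e_i-e_j)+(\lambda_1,\dotsc,\lambda_n)$; $c_I^2=|x_I|$ for all $I$; $M_{\Delta,2}(\operatorname{logsign}\epsilon)=\operatorname{logsign}X$; $\epsilon_i/\epsilon_j=\operatorname{sign}(A^i_j\operatorname{tr}D)$ for all $(i,j)\in\mathcal A$. Equivalence. Two solutions $(\mathfrak g,g,D)$, $(\mathfrak g',g',D')$ on nice Lie algebras are equivalent if there is a Lie algebra isomorphism $\mathfrak g\to\mathfrak g'$ mapping each nice basis element to a multiple of a nice basis element, mapping $g$ to $g'$ and $D$ to $D'$. Notation for the list. Each line has the form: $\mathfrak g$; $D$; $\mathbf S$. The Lie algebra is given by the $n$-tuple $(de^1,\dotsc,de^n)$, with $e^{ij}=e^i\wedge e^j$ and $d\alpha(x,y)=-\alpha([x,y])$.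 The derivation is written $v+\sum a_{ji}e^i\otimes e_j$, where the vector $v$ stands for the diagonal endomorphism with diagonal $v$. Each element of $\mathbf S$ is a string of indices specifying the metric $\sum\epsilon_ie^i\otimes e^i$ with $\epsilon_i=-1$ if $i$ is in the string and $\epsilon_i=1$ otherwise (e.g. $12$ is $\operatorname{diag}(-1,-1,1,\dotsc,1)$). An entry of the list is a line together with the choice of one element of its $\mathbf S$. $n=3$: - $(0,0,\frac47e^{12})$; $(\frac67,-\frac27,\frac47)+\frac87e^1\otimes e_2$; $\{13,23\}$ - $(0,0,0)$; $(1,-\frac15,\frac25)+\frac65e^1\otimes e_2$; $\{1,13,2,23\}$ $n=4$: - $(0,0,\frac{14}{51}\sqrt3e^{12},\frac7{51}\sqrt{34}e^{13})$; $(\frac{28}{51},-\frac7{17},\frac7{51},\frac{35}{51})+\frac7{51}\sqrt{66}e^1\otimes e_2$; $\{13,234\}$ - $(0,0,0,\frac2{17}\sqrt{22}e^{12})$; $(\frac{15}{17},-\frac7{17},\frac6{17},\frac8{17})+\frac{22}{17}e^1\otimes e_2$; $\{134,14,234,24\}$ - $(0,0,0,\frac13\sqrt6e^{12})$; $(0,0,1,0)+\frac23\sqrt3e^3\otimes e_4$; $\{123,14,3\}$ - $(0,0,0,\frac13\sqrt6e^{12})$; $(\frac23,0,-\frac13,\frac23)+\frac23\sqrt3e^1\otimes e_3$; $\{12,14,234,3\}$ - $(0,0,0,\frac29\sqrt6e^{12})$; $(\frac13,-\frac13,\frac23,0)+\frac23e^1\otimes e_2+\frac49\sqrt3e^3\otimes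 e_4$; $\{14,24\}$ - $(0,0,0,0)$; $(1,-\frac13,\frac13,\frac13)+\frac43e^1\otimes e_2$; $\{1,13,134,2,23,234\}$ - $(0,0,0,0)$; $(\frac35,\frac35,-\frac15,-\frac15)+\frac45e^1\otimes e_3+\frac45e^2\otimes e_4$; $\{12,14,34\}$ $n=5$: - $(0,0,\frac3{10}\sqrt5e^{12},\frac3{10}\sqrt2e^{13},\frac3{10}\sqrt5e^{14})$; $(-\frac3{10},\frac34,\frac9{20},\frac3{20},-\frac3{20})+\frac3{10}\sqrt{14}e^2\otimes e_5$; $\{124,135\}$ - $(0,0,\frac{11}{159}\sqrt6e^{12},\frac{11}{159}\sqrt{106}e^{13},\frac{22}{53}\sqrt3e^{14})$; $(\frac{55}{159},-\frac{22}{53},-\frac{11}{159},\frac{44}{159},\frac{33}{53})+\frac{22}{159}\sqrt{57}e^1\otimes e_2$; $\{14,2\}$ - $(0,0,\frac{10}{31}e^{12},\frac5{31}\sqrt3e^{13},\frac5{31}\sqrt3e^{23})$; $(\frac{15}{31},-\frac{10}{31},\frac5{31},\frac{20}{31},-\frac5{31})+\frac{25}{31}e^1\otimes e_2+\frac{25}{31}e^4\otimes e_5$; $\{135,234\}$ - $(0,0,0,\frac4{15}\sqrt{10}e^{12},\frac4{15}\sqrt3e^{14})$; $(-\frac2{15},\frac23,-\frac25,\frac8{15},\frac25)+\frac4{15}\sqrt{21}e^2\otimes e_3$; $\{125,134,245,3\}$ - $(0,0,0,\frac5{51}\sqrt6e^{12},\frac5{51}\sqrt{34}e^{14})$; $(\frac{10}{51},-\frac5{17},\frac{10}{17},-\frac5{51},\frac5{51})+\frac5{51}\sqrt{42}e^1\otimes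 e_2+\frac5{51}\sqrt{42}e^3\otimes e_5$; $\{134,245\}$ - $(0,0,0,\frac4{15}\sqrt3e^{12},\frac4{15}\sqrt{10}e^{14})$; $(-\frac2{15},\frac15,1,\frac1{15},-\frac1{15})+\frac4{15}\sqrt{21}e^3\otimes e_5$; $\{125,134,245,3\}$ - $(0,0,0,\frac4{21}\sqrt{14}e^{12},\frac4{21}\sqrt{14}e^{14})$; $(\frac13,-\frac1{21},-\frac37,\frac27,\frac{13}{21})+\frac4{21}\sqrt{30}e^1\otimes e_3$; $\{125,14,2345,3\}$ - $(0,0,0,\frac4{15}\sqrt3e^{12},\frac4{15}\sqrt{10}e^{14})$; $(\frac{17}{30},-\frac12,\frac3{10},\frac1{15},\frac{19}{30})+\frac4{15}\sqrt{21}e^1\otimes e_2$; $\{134,14,2345,245\}$ - $(0,0,0,\frac6{17}\sqrt6e^{12},\frac6{17}e^{13}+\frac6{17}\sqrt2e^{24})$; $(\frac{12}{17},-\frac3{17},-\frac6{17},\frac9{17},\frac6{17})+\frac{12}{17}\sqrt3e^1\otimes e_3$; $\{234,3\}$ - $(0,0,0,\frac{36}{115}\sqrt3e^{12},\frac9{506}\sqrt{110}e^{13}+\frac9{2530}\sqrt{2090}e^{24})$; $(-\frac9{23},\frac{36}{115},\frac{72}{115},-\frac9{115},\frac{27}{115})+\sqrt{\frac{143127}{290950}}e^2\otimes e_1-\sqrt{\frac{7533}{11638}}e^3\otimes e_4$; $\{145,24\}$ - $(0,0,0,\frac1{19}\sqrt{102}e^{12},\frac6{19}e^{13})$; $(\frac3{19},\frac6{19},-\frac6{19},\frac9{19},-\frac3{19})+\frac2{19}\sqrt{33}e^1\otimes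 e_3+\frac5{19}\sqrt6e^2\otimes e_5$; $\{145,35\}$ - $(0,0,0,\frac3{11}e^{12},\frac3{11}e^{13})$; $(\frac1{11},\frac6{11},-\frac3{11},\frac7{11},-\frac2{11})+\frac9{11}e^2\otimes e_3+\frac9{11}e^4\otimes e_5$; $\{125,134,24,35\}$ - $(0,0,0,\frac16\sqrt6e^{12},\frac16\sqrt6e^{13})$; $(-\frac13,\frac13,\frac13,0,0)+\frac16\sqrt{10}e^2\otimes e_5-\frac16\sqrt{10}e^3\otimes e_4$; $\{123,145,24\}$ - $(0,0,0,\frac16\sqrt6e^{12},\frac16\sqrt6e^{13})$; $(-\frac13,\frac13,\frac13,0,0)+\frac16\sqrt{10}e^2\otimes e_5+\frac16\sqrt{10}e^3\otimes e_4$; $\{123,145,24\}$ - $(0,0,0,\frac1{14}\sqrt{91}e^{12},\frac1{14}\sqrt{91}e^{13})$; $(-\frac3{14},\frac34,\frac1{28},\frac{15}{28},-\frac5{28})+\frac17\sqrt{65}e^2\otimes e_5$; $\{123,145,24,35\}$ - $(0,0,0,\frac2{53}\sqrt{29}e^{12},\frac6{53}\sqrt{58}e^{13})$; $(\frac{36}{53},-\frac{22}{53},-\frac3{53},\frac{14}{53},\frac{33}{53})+\frac2{53}\sqrt{1102}e^1\otimes e_2$; $\{13,15,2,235\}$ - $(0,0,0,0,\frac13\sqrt3e^{12})$; $(\frac14,\frac14,-\frac14,-\frac14,\frac12)+\frac16\sqrt{15}e^1\otimes e_3+\frac16\sqrt{15}e^2\otimes e_4$; $\{12,145,34\}$ -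 $(0,0,0,0,\frac15\sqrt7e^{12})$; $(\frac9{10},-\frac12,\frac3{10},\frac3{10},\frac25)+\frac75e^1\otimes e_2$; $\{1345,135,15,2345,235,25\}$ - $(0,0,0,0,\frac15\sqrt7e^{12})$; $(\frac15,\frac15,1,-\frac25,\frac25)+\frac75e^3\otimes e_4$; $\{123,124,135,145,3,4\}$ - $(0,0,0,0,\frac1{21}\sqrt{322}e^{12})$; $(\frac23,-\frac1{21},-\frac37,\frac27,\frac{13}{21})+\frac1{21}\sqrt{690}e^1\otimes e_3$; $\{12,124,145,15,2345,235,3,34\}$ - $(0,0,0,0,\frac1{21}\sqrt{322}e^{12})$; $(-\frac1{21},-\frac1{21},1,\frac27,-\frac2{21})+\frac1{21}\sqrt{690}e^3\otimes e_5$; $\{123,1234,145,15,3,34\}$ - $(0,0,0,0,\frac2{65}\sqrt{322}e^{12})$; $(\frac{21}{65},-\frac5{13},\frac{42}{65},\frac{12}{65},-\frac4{65})+\frac2{65}\sqrt{690}e^3\otimes e_5+\frac{46}{65}e^1\otimes e_2$; $\{145,15,245,25\}$ - $(0,0,0,0,\frac13\sqrt3e^{12})$; $(\frac14,-\frac16,\frac7{12},-\frac14,\frac1{12})+\frac16\sqrt{15}e^1\otimes e_4+\frac16\sqrt{15}e^3\otimes e_5$; $\{123,15,245,34\}$ - $(0,0,0,0,\frac2{17}\sqrt7e^{12})$; $(\frac9{17},-\frac5{17},\frac{10}{17},-\frac4{17},\frac4{17})+\frac{14}{17}e^1\otimes e_2+\frac{14}{17}e^3\otimes e_4$; $\{135,145,235,245\}$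 - $(0,0,0,0,\frac3{11}e^{12}+\frac3{11}e^{34})$; $(\frac6{11},-\frac3{11},\frac6{11},-\frac3{11},\frac3{11})+\frac9{11}e^1\otimes e_2+\frac9{11}e^3\otimes e_4$; $\{135,145,245\}$ - $(0,0,0,0,\frac3{11}e^{12}+\frac3{11}e^{34})$; $(\frac6{11},-\frac3{11},\frac6{11},-\frac3{11},\frac3{11})+\frac9{11}e^1\otimes e_2-\frac9{11}e^3\otimes e_4$; $\{135,145,245\}$ - $(0,0,0,0,\frac3{11}e^{12}+\frac3{11}e^{34})$; $(\frac6{11},-\frac3{11},\frac6{11},-\frac3{11},\frac3{11})+\frac9{11}e^1\otimes e_4+\frac9{11}e^3\otimes e_2$; $\{12,135,245\}$ - $(0,0,0,0,\frac6{13}e^{12}+\frac6{13}e^{34})$; $(\frac{12}{13},-\frac6{13},\frac3{13},\frac3{13},\frac6{13})+\frac{18}{13}e^1\otimes e_2$; $\{135,235\}$ - $(0,0,0,0,0)$; $(\frac7{12},\frac7{12},-\frac14,-\frac14,\frac16)+\frac56e^1\otimes e_3+\frac56e^2\otimes e_4$; $\{12,125,14,145,34,345\}$ - $(0,0,0,0,0)$; $(1,-\frac37,\frac27,\frac27,\frac27)+\frac{10}7e^1\otimes e_2$; $\{1,13,134,1345,2,23,234,2345\}$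
   Formalization: The case n=2 is excluded: on the abelian R^2 with A={(1,2)}, A^1_2=-1/2, D=diag(1,0)±e^1⊗e_2, ε=(1,-1) or (-1,1), there is a nondiagonal solution, but the list has no entry of dimension 2. *)

(* Defs.v *)
From HB Require Import structures.
From mathcomp Require Import all_boot all_order all_algebra.
From mathcomp Require Import reals.

Set Implicit Arguments.
Unset Strict Implicit.
Unset Printing Implicit Defensive.

Import Order.TTheory GRing.Theory Num.Theory.
Local Open Scope ring_scope.

(* R^n is 'cV[R]_n, and a matrix D : 'M_n stands for the linear map v |-> D *m v;
   hence e^i (x) e_j is the matrix with its only nonzero entry in row j, column i. *)

Definition basis (R : realType) (n : nat) (i : 'I_n) : 'cV[R]_n := delta_mx i 0.

Definition tensor (R : realType) (n : nat) (i j : 'I_n) : 'M[R]_n := delta_mx j i.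

(* A bracket on R^n is given by its structure constants: [e_i, e_j] = sum_k c i j k e_k. *)
Definition structure_constants (R : realType) (n : nat) := 'I_n -> 'I_n -> 'I_n -> R.

Definition bracket (R : realType) (n : nat) (c : structure_constants R n)
    (x y : 'cV[R]_n) : 'cV[R]_n :=
  \col_k \sum_i \sum_j x i 0 * y j 0 * c i j k.

Definition ad (R : realType) (n : nat) (c : structure_constants R n) (x : 'cV[R]_n) :
    'M[R]_n :=
  \matrix_(k, j) bracket c x (basis R j) k 0.

Definition is_lie_algebra (R : realType) (n : nat) (c : structure_constants R n) : Prop :=
  (forall x, bracket c x x = 0) /\
  (forall x y z, bracket c x (bracket c y z) + bracket c y (bracket c z x)
                   + bracket c z (bracket c x y) = 0).

Fixpoint lower_central (R : realType) (n : nat) (c : structure_constants R n) (k : nat) :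
    {vspace 'cV[R]_n} :=
  if k is k'.+1 then
    <<[seq bracket c x y | x <- vbasis (fullv : {vspace 'cV[R]_n}),
                           y <- vbasis (lower_central c k')]>>%VS
  else fullv.

Definition is_nilpotent (R : realType) (n : nat) (c : structure_constants R n) : Prop :=
  exists k, lower_central c k = 0%VS.

(* (d alpha)(x, y) = - alpha([x, y]), for alpha = e^k *)
Definition d_dual (R : realType) (n : nat) (c : structure_constants R n) (k : 'I_n)
    (x y : 'cV[R]_n) : R :=
  - bracket c x y k 0.

Definition is_nice_basis (R : realType) (n : nat) (c : structure_constants R n) : Prop :=
  (forall i j, exists k a, bracket c (basis R i) (basis R j) = a *: basis R k) /\
  (forall i k, exists j a, forall v : 'cV[R]_n, d_dual c k (basis R i) v = a * v j 0).

Definition is_nice_lie_algebra (R : realType) (n : nat) (c : structure_constants R n) : Prop :=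
  [/\ is_lie_algebra c, is_nilpotent c & is_nice_basis c].

Definition is_derivation (R : realType) (n : nat) (c : structure_constants R n)
    (D : 'M[R]_n) : Prop :=
  forall x y, D *m bracket c x y = bracket c (D *m x) y + bracket c x (D *m y).

(* The triple (i, j, k) belongs to the diagram when it has an arrow i --j--> k. *)
Definition diagram (n : nat) := {set 'I_n * 'I_n * 'I_n}.

Definition diagram_of (R : realType) (n : nat) (c : structure_constants R n) : diagram n :=
  [set t | (bracket c (basis R t.1.1) (basis R t.1.2) == c t.1.1 t.1.2 t.2 *: basis R t.2)
           && (c t.1.1 t.1.2 t.2 != 0)].

Definition is_nice_diagram (R : realType) (n : nat) (Delta : diagram n) : Prop :=
  exists c : structure_constants R n, is_nice_lie_algebra c /\ diagram_of c = Delta.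

(* Each pair of arrows i --j--> k, j --i--> k is represented by the one with i < j. *)
Definition root_index (n : nat) (Delta : diagram n) : {set 'I_n * 'I_n * 'I_n} :=
  [set t in Delta | (t.1.1 < t.1.2)%N && ((t.1.2, t.1.1, t.2) \in Delta)].

Definition root_mxZ (n : nat) (Delta : diagram n) : 'M[int]_(#|root_index Delta|, n) :=
  \matrix_(I, l) let: (i, j, k) := enum_val I in
    if l == k then 1 else if (l == i) || (l == j) then - 1 else 0.

Definition root_mx (R : realType) (n : nat) (Delta : diagram n) :
    'M[R]_(#|root_index Delta|, n) :=
  map_mx intr (root_mxZ Delta).

Definition root_mx2 (n : nat) (Delta : diagram n) : 'M['F_2]_(#|root_index Delta|, n) :=
  map_mx intr (root_mxZ Delta).

Definition root_sc (R : realType) (n : nat) (Delta : diagram n) (c : structure_constants R n)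
    (I : 'I_#|root_index Delta|) : R :=
  let: (i, j, k) := enum_val I in c i j k.

Definition logsign (R : realType) (m : nat) (x : 'cV[R]_m) : 'cV['F_2]_m :=
  \col_i (x i 0 < 0)%R%:R.

Definition diag_entries (R : realType) (n : nat) (D : 'M[R]_n) : 'cV[R]_n := \col_i D i i.

Definition nondiagonal_triple (R : realType) (n : nat) (Delta : diagram n)
    (cA : {set 'I_n * 'I_n}) (A : 'I_n -> 'I_n -> R) (D : 'M[R]_n) : Prop :=
  let lambda := diag_entries D in
  let sumA := \sum_(p in cA) A p.1 p.2 in
  (cA != set0 /\ forall i j, (i, j) \in cA -> A i j != 0) /\
  [/\ forall i j, (i, j) \in cA -> i != j,
      forall i j i' j', (i, j) \in cA -> (i', j') \in cA ->
        (i, j) != (i', j') -> uniq [:: i; j; i'; j']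
    & forall i j k, (i, j) \in cA -> (i, k, j) \notin Delta] /\
  [/\ forall mu : 'cV[R]_n, root_mx R Delta *m mu = 0 ->
        \sum_i lambda i 0 * mu i 0 =
          (1 + sumA) * \sum_i mu i 0
          + \sum_(p in cA) A p.1 p.2 * (mu p.2 0 - mu p.1 0),
      forall i j, (i, j) \in cA -> \sum_k lambda k 0 = lambda i 0 - lambda j 0,
      exists a : 'I_n -> 'I_n -> R,
        D = \sum_i lambda i 0 *: tensor R i i
            + \sum_(p in cA) a p.2 p.1 *: tensor R p.1 p.2 /\
        (forall i j, (i, j) \in cA ->
           a j i ^+ 2 = `|2 * A i j * \tr D| /\ `|2 * A i j * \tr D| != 0)
    & root_mx R Delta *m lambda = 0].

Definition nondiagonal_solution (R : realType) (n : nat) (Delta : diagram n)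
    (cA : {set 'I_n * 'I_n}) (A : 'I_n -> 'I_n -> R) (D : 'M[R]_n)
    (c : structure_constants R n) (eps : 'cV[R]_n) : Prop :=
  [/\ is_nice_lie_algebra c, diagram_of c = Delta, is_derivation c D,
      forall i, eps i 0 = 1 \/ eps i 0 = - 1
    & exists X : 'cV[R]_#|root_index Delta|,
        [/\ (2 * \tr D)^-1 *: ((root_mx R Delta)^T *m X) =
              const_mx (- 1 - \sum_(p in cA) A p.1 p.2)
              + \sum_(p in cA) A p.1 p.2 *: (basis R p.1 - basis R p.2)
              + diag_entries D,
            forall I, root_sc c I ^+ 2 = `|X I 0|,
            root_mx2 Delta *m logsign eps = logsign X
          & forall i j, (i, j) \in cA -> eps i 0 / eps j 0 = Num.sg (A i j * \tr D)]].

(* The metric with Gram matrix G is <x, y> = x^T G y. *)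
Definition is_metric (R : realType) (n : nat) (G : 'M[R]_n) : Prop :=
  G^T = G /\ G \in unitmx.

Definition inner (R : realType) (n : nat) (G : 'M[R]_n) (x y : 'cV[R]_n) : R :=
  (x^T *m G *m y) 0 0.

Definition adjoint (R : realType) (n : nat) (G D : 'M[R]_n) : 'M[R]_n :=
  invmx G *m D^T *m G.

Definition sym_part (R : realType) (n : nat) (G D : 'M[R]_n) : 'M[R]_n :=
  2^-1 *: (D + adjoint G D).

(* Koszul's formula 2 <nabla_x y, z> = <[x, y], z> - <[y, z], x> + <[z, x], y> for the
   Levi-Civita connection on left-invariant fields, solved for nabla_x y. *)
Definition levi_civita (R : realType) (n : nat) (c : structure_constants R n) (G : 'M[R]_n)
    (x y : 'cV[R]_n) : 'cV[R]_n :=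
  2^-1 *: (bracket c x y - adjoint G (ad c x) *m y - adjoint G (ad c y) *m x).

Definition curvature (R : realType) (n : nat) (c : structure_constants R n) (G : 'M[R]_n)
    (x y z : 'cV[R]_n) : 'cV[R]_n :=
  levi_civita c G x (levi_civita c G y z) - levi_civita c G y (levi_civita c G x z)
  - levi_civita c G (bracket c x y) z.

(* ric(y, z) = tr (x |-> R(x, y) z) *)
Definition ricci_form (R : realType) (n : nat) (c : structure_constants R n) (G : 'M[R]_n)
    (y z : 'cV[R]_n) : R :=
  \sum_i curvature c G (basis R i) y z i 0.

(* <Ric y, z> = ric(y, z) *)
Definition ricci (R : realType) (n : nat) (c : structure_constants R n) (G : 'M[R]_n) :
    'M[R]_n :=
  invmx G *m \matrix_(i, j) ricci_form c G (basis R j) (basis R i).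

Definition is_metric_solution (R : realType) (n : nat) (c : structure_constants R n)
    (G D : 'M[R]_n) : Prop :=
  [/\ is_metric G, is_derivation c D,
      ricci c G = - (\tr (sym_part G D *m sym_part G D))%:M
                  - 2^-1 *: (D *m adjoint G D - adjoint G D *m D)
                  + \tr D *: sym_part G D
    & forall v, \tr (ad c v *m adjoint G D) = 0].

(* The fixed nice bases are the standard ones. *)
Definition equivalent (R : realType) (n n' : nat)
    (c : structure_constants R n) (G D : 'M[R]_n)
    (c' : structure_constants R n') (G' D' : 'M[R]_n') : Prop :=
  exists f : {linear 'cV[R]_n -> 'cV[R]_n'},
    [/\ bijective f,
        forall x y, f (bracket c x y) = bracket c' (f x) (f y),
        forall i, exists j a, f (basis R i) = a *: basis R j,
        forall x y, inner G x y = inner G' (f x) (f y)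
      & forall x, f (D *m x) = D' *m f x].

(* Indices in the list below start at 1: node p is the ordinal of value p - 1.
   [term a p q] is a e^{pq} in a Lie algebra and a e^p (x) e_q in a derivation. *)
Definition indexed_term (R : realType) : Type := (R * nat * nat)%type.

Definition term (R : realType) (a : R) (p q : nat) : indexed_term R := (a, p, q).

Record line (R : realType) := Line {
  line_dim : nat;
  line_forms : seq (seq (indexed_term R));
  line_diag : seq R;
  line_tensors : seq (indexed_term R);
  line_signs : seq (seq nat)
}.

Definition entry (R : realType) : Type := (line R * seq nat)%type.

Definition entry_dim (R : realType) (e : entry R) : nat := line_dim e.1.

Definition entry_sc (R : realType) (e : entry R) : structure_constants R (entry_dim e) :=
  fun i j k =>
    - \sum_(t <- nth [::] (line_forms e.1) k)
        t.1.1 * (((i.+1 == t.1.2) && (j.+1 == t.2))%:R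
                 - ((j.+1 == t.1.2) && (i.+1 == t.2))%:R).

Arguments entry_sc {R} e _ _ _.

Definition entry_derivation (R : realType) (e : entry R) : 'M[R]_(entry_dim e) :=
  \sum_(i < entry_dim e) nth 0 (line_diag e.1) i *: tensor R i i
  + \sum_(t <- line_tensors e.1) t.1.1 *:
      \sum_(i < entry_dim e) \sum_(j < entry_dim e) ((i.+1 == t.1.2) && (j.+1 == t.2))%:R *: tensor R i j.

Definition entry_eps (R : realType) (e : entry R) : 'cV[R]_(entry_dim e) :=
  \col_i if i.+1 \in e.2 then - 1 else 1.

Definition diag_metric (R : realType) (n : nat) (eps : 'cV[R]_n) : 'M[R]_n :=
  \sum_i eps i 0 *: tensor R i i.

Local Notation sqrt := Num.sqrt.

(* No line has dimension 2, although (1, 0) + e^1 (x) e_2 on the abelian R^2, with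
   eps = (1, -1) or (-1, 1), is a nondiagonal solution: dimension 2 has to be excluded.
   243 * 589 = 143127, 550 * 529 = 290950, 243 * 31 = 7533 and 22 * 529 = 11638: these
   numbers are factored because ring_scope literals are unary. *)
Definition lines (R : realType) : seq (line R) := [::
  Line 3 [:: [::]; [::]; [:: term (4 / 7) 1 2]]
    [:: 6 / 7; - 2 / 7; 4 / 7]
    [:: term (8 / 7) 1 2]
    [:: [:: 1; 3]; [:: 2; 3]]%N;
  Line 3 [:: [::]; [::]; [::]]
    [:: 1; - 1 / 5; 2 / 5]
    [:: term (6 / 5) 1 2]
    [:: [:: 1]; [:: 1; 3]; [:: 2]; [:: 2; 3]]%N;
  Line 4 [:: [::]; [::]; [:: term (14 / 51 * sqrt 3) 1 2]; [:: term (7 / 51 * sqrt 34) 1 3]]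
    [:: 28 / 51; - 7 / 17; 7 / 51; 35 / 51]
    [:: term (7 / 51 * sqrt 66) 1 2]
    [:: [:: 1; 3]; [:: 2; 3; 4]]%N;
  Line 4 [:: [::]; [::]; [::]; [:: term (2 / 17 * sqrt 22) 1 2]]
    [:: 15 / 17; - 7 / 17; 6 / 17; 8 / 17]
    [:: term (22 / 17) 1 2]
    [:: [:: 1; 3; 4]; [:: 1; 4]; [:: 2; 3; 4]; [:: 2; 4]]%N;
  Line 4 [:: [::]; [::]; [::]; [:: term (1 / 3 * sqrt 6) 1 2]]
    [:: 0; 0; 1; 0]
    [:: term (2 / 3 * sqrt 3) 3 4]
    [:: [:: 1; 2; 3]; [:: 1; 4]; [:: 3]]%N;
  Line 4 [:: [::]; [::]; [::]; [:: term (1 / 3 * sqrt 6) 1 2]]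
    [:: 2 / 3; 0; - 1 / 3; 2 / 3]
    [:: term (2 / 3 * sqrt 3) 1 3]
    [:: [:: 1; 2]; [:: 1; 4]; [:: 2; 3; 4]; [:: 3]]%N;
  Line 4 [:: [::]; [::]; [::]; [:: term (2 / 9 * sqrt 6) 1 2]]
    [:: 1 / 3; - 1 / 3; 2 / 3; 0]
    [:: term (2 / 3) 1 2; term (4 / 9 * sqrt 3) 3 4]
    [:: [:: 1; 4]; [:: 2; 4]]%N;
  Line 4 [:: [::]; [::]; [::]; [::]]
    [:: 1; - 1 / 3; 1 / 3; 1 / 3]
    [:: term (4 / 3) 1 2]
    [:: [:: 1]; [:: 1; 3]; [:: 1; 3; 4]; [:: 2]; [:: 2; 3]; [:: 2; 3; 4]]%N;
  Line 4 [:: [::]; [::]; [::]; [::]]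
    [:: 3 / 5; 3 / 5; - 1 / 5; - 1 / 5]
    [:: term (4 / 5) 1 3; term (4 / 5) 2 4]
    [:: [:: 1; 2]; [:: 1; 4]; [:: 3; 4]]%N;
  Line 5 [:: [::]; [::]; [:: term (3 / 10 * sqrt 5) 1 2]; [:: term (3 / 10 * sqrt 2) 1 3]; [:: term (3 / 10 * sqrt 5) 1 4]]
    [:: - 3 / 10; 3 / 4; 9 / 20; 3 / 20; - 3 / 20]
    [:: term (3 / 10 * sqrt 14) 2 5]
    [:: [:: 1; 2; 4]; [:: 1; 3; 5]]%N;
  Line 5 [:: [::]; [::]; [:: term (11 / 159 * sqrt 6) 1 2]; [:: term (11 / 159 * sqrt 106) 1 3]; [:: term (22 / 53 * sqrt 3) 1 4]]
    [:: 55 / 159; - 22 / 53; - 11 / 159; 44 / 159; 33 / 53]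
    [:: term (22 / 159 * sqrt 57) 1 2]
    [:: [:: 1; 4]; [:: 2]]%N;
  Line 5 [:: [::]; [::]; [:: term (10 / 31) 1 2]; [:: term (5 / 31 * sqrt 3) 1 3]; [:: term (5 / 31 * sqrt 3) 2 3]]
    [:: 15 / 31; - 10 / 31; 5 / 31; 20 / 31; - 5 / 31]
    [:: term (25 / 31) 1 2; term (25 / 31) 4 5]
    [:: [:: 1; 3; 5]; [:: 2; 3; 4]]%N;
  Line 5 [:: [::]; [::]; [::]; [:: term (4 / 15 * sqrt 10) 1 2]; [:: term (4 / 15 * sqrt 3) 1 4]]
    [:: - 2 / 15; 2 / 3; - 2 / 5; 8 / 15; 2 / 5]
    [:: term (4 / 15 * sqrt 21) 2 3]
    [:: [:: 1; 2; 5]; [:: 1; 3; 4]; [:: 2; 4; 5]; [:: 3]]%N;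
  Line 5 [:: [::]; [::]; [::]; [:: term (5 / 51 * sqrt 6) 1 2]; [:: term (5 / 51 * sqrt 34) 1 4]]
    [:: 10 / 51; - 5 / 17; 10 / 17; - 5 / 51; 5 / 51]
    [:: term (5 / 51 * sqrt 42) 1 2; term (5 / 51 * sqrt 42) 3 5]
    [:: [:: 1; 3; 4]; [:: 2; 4; 5]]%N;
  Line 5 [:: [::]; [::]; [::]; [:: term (4 / 15 * sqrt 3) 1 2]; [:: term (4 / 15 * sqrt 10) 1 4]]
    [:: - 2 / 15; 1 / 5; 1; 1 / 15; - 1 / 15]
    [:: term (4 / 15 * sqrt 21) 3 5]
    [:: [:: 1; 2; 5]; [:: 1; 3; 4]; [:: 2; 4; 5]; [:: 3]]%N;
  Line 5 [:: [::]; [::]; [::]; [:: term (4 / 21 * sqrt 14) 1 2]; [:: term (4 / 21 * sqrt 14) 1 4]]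
    [:: 1 / 3; - 1 / 21; - 3 / 7; 2 / 7; 13 / 21]
    [:: term (4 / 21 * sqrt 30) 1 3]
    [:: [:: 1; 2; 5]; [:: 1; 4]; [:: 2; 3; 4; 5]; [:: 3]]%N;
  Line 5 [:: [::]; [::]; [::]; [:: term (4 / 15 * sqrt 3) 1 2]; [:: term (4 / 15 * sqrt 10) 1 4]]
    [:: 17 / 30; - 1 / 2; 3 / 10; 1 / 15; 19 / 30]
    [:: term (4 / 15 * sqrt 21) 1 2]
    [:: [:: 1; 3; 4]; [:: 1; 4]; [:: 2; 3; 4; 5]; [:: 2; 4; 5]]%N;
  Line 5 [:: [::]; [::]; [::]; [:: term (6 / 17 * sqrt 6) 1 2]; [:: term (6 / 17) 1 3; term (6 / 17 * sqrt 2) 2 4]]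
    [:: 12 / 17; - 3 / 17; - 6 / 17; 9 / 17; 6 / 17]
    [:: term (12 / 17 * sqrt 3) 1 3]
    [:: [:: 2; 3; 4]; [:: 3]]%N;
  Line 5 [:: [::]; [::]; [::]; [:: term (36 / 115 * sqrt 3) 1 2]; [:: term (9 / 506 * sqrt 110) 1 3; term (9 / 2530 * sqrt 2090) 2 4]]
    [:: - 9 / 23; 36 / 115; 72 / 115; - 9 / 115; 27 / 115]
    [:: term (sqrt (243 * 589 / (550 * 529))) 2 1; term (- sqrt (243 * 31 / (22 * 529))) 3 4]
    [:: [:: 1; 4; 5]; [:: 2; 4]]%N;
  Line 5 [:: [::]; [::]; [::]; [:: term (1 / 19 * sqrt 102) 1 2]; [:: term (6 / 19) 1 3]]
    [:: 3 / 19; 6 / 19; - 6 / 19; 9 / 19; - 3 / 19]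
    [:: term (2 / 19 * sqrt 33) 1 3; term (5 / 19 * sqrt 6) 2 5]
    [:: [:: 1; 4; 5]; [:: 3; 5]]%N;
  Line 5 [:: [::]; [::]; [::]; [:: term (3 / 11) 1 2]; [:: term (3 / 11) 1 3]]
    [:: 1 / 11; 6 / 11; - 3 / 11; 7 / 11; - 2 / 11]
    [:: term (9 / 11) 2 3; term (9 / 11) 4 5]
    [:: [:: 1; 2; 5]; [:: 1; 3; 4]; [:: 2; 4]; [:: 3; 5]]%N;
  Line 5 [:: [::]; [::]; [::]; [:: term (1 / 6 * sqrt 6) 1 2]; [:: term (1 / 6 * sqrt 6) 1 3]]
    [:: - 1 / 3; 1 / 3; 1 / 3; 0; 0]
    [:: term (1 / 6 * sqrt 10) 2 5; term (- 1 / 6 * sqrt 10) 3 4]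
    [:: [:: 1; 2; 3]; [:: 1; 4; 5]; [:: 2; 4]]%N;
  Line 5 [:: [::]; [::]; [::]; [:: term (1 / 6 * sqrt 6) 1 2]; [:: term (1 / 6 * sqrt 6) 1 3]]
    [:: - 1 / 3; 1 / 3; 1 / 3; 0; 0]
    [:: term (1 / 6 * sqrt 10) 2 5; term (1 / 6 * sqrt 10) 3 4]
    [:: [:: 1; 2; 3]; [:: 1; 4; 5]; [:: 2; 4]]%N;
  Line 5 [:: [::]; [::]; [::]; [:: term (1 / 14 * sqrt 91) 1 2]; [:: term (1 / 14 * sqrt 91) 1 3]]
    [:: - 3 / 14; 3 / 4; 1 / 28; 15 / 28; - 5 / 28]
    [:: term (1 / 7 * sqrt 65) 2 5]
    [:: [:: 1; 2; 3]; [:: 1; 4; 5]; [:: 2; 4]; [:: 3; 5]]%N;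
  Line 5 [:: [::]; [::]; [::]; [:: term (2 / 53 * sqrt 29) 1 2]; [:: term (6 / 53 * sqrt 58) 1 3]]
    [:: 36 / 53; - 22 / 53; - 3 / 53; 14 / 53; 33 / 53]
    [:: term (2 / 53 * sqrt 1102) 1 2]
    [:: [:: 1; 3]; [:: 1; 5]; [:: 2]; [:: 2; 3; 5]]%N;
  Line 5 [:: [::]; [::]; [::]; [::]; [:: term (1 / 3 * sqrt 3) 1 2]]
    [:: 1 / 4; 1 / 4; - 1 / 4; - 1 / 4; 1 / 2]
    [:: term (1 / 6 * sqrt 15) 1 3; term (1 / 6 * sqrt 15) 2 4]
    [:: [:: 1; 2]; [:: 1; 4; 5]; [:: 3; 4]]%N;
  Line 5 [:: [::]; [::]; [::]; [::]; [:: term (1 / 5 * sqrt 7) 1 2]]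
    [:: 9 / 10; - 1 / 2; 3 / 10; 3 / 10; 2 / 5]
    [:: term (7 / 5) 1 2]
    [:: [:: 1; 3; 4; 5]; [:: 1; 3; 5]; [:: 1; 5]; [:: 2; 3; 4; 5]; [:: 2; 3; 5]; [:: 2; 5]]%N;
  Line 5 [:: [::]; [::]; [::]; [::]; [:: term (1 / 5 * sqrt 7) 1 2]]
    [:: 1 / 5; 1 / 5; 1; - 2 / 5; 2 / 5]
    [:: term (7 / 5) 3 4]
    [:: [:: 1; 2; 3]; [:: 1; 2; 4]; [:: 1; 3; 5]; [:: 1; 4; 5]; [:: 3]; [:: 4]]%N;
  Line 5 [:: [::]; [::]; [::]; [::]; [:: term (1 / 21 * sqrt 322) 1 2]]
    [:: 2 / 3; - 1 / 21; - 3 / 7; 2 / 7; 13 / 21]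
    [:: term (1 / 21 * sqrt 690) 1 3]
    [:: [:: 1; 2]; [:: 1; 2; 4]; [:: 1; 4; 5]; [:: 1; 5]; [:: 2; 3; 4; 5]; [:: 2; 3; 5]; [:: 3]; [:: 3; 4]]%N;
  Line 5 [:: [::]; [::]; [::]; [::]; [:: term (1 / 21 * sqrt 322) 1 2]]
    [:: - 1 / 21; - 1 / 21; 1; 2 / 7; - 2 / 21]
    [:: term (1 / 21 * sqrt 690) 3 5]
    [:: [:: 1; 2; 3]; [:: 1; 2; 3; 4]; [:: 1; 4; 5]; [:: 1; 5]; [:: 3]; [:: 3; 4]]%N;
  Line 5 [:: [::]; [::]; [::]; [::]; [:: term (2 / 65 * sqrt 322) 1 2]]
    [:: 21 / 65; - 5 / 13; 42 / 65; 12 / 65; - 4 / 65]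
    [:: term (2 / 65 * sqrt 690) 3 5; term (46 / 65) 1 2]
    [:: [:: 1; 4; 5]; [:: 1; 5]; [:: 2; 4; 5]; [:: 2; 5]]%N;
  Line 5 [:: [::]; [::]; [::]; [::]; [:: term (1 / 3 * sqrt 3) 1 2]]
    [:: 1 / 4; - 1 / 6; 7 / 12; - 1 / 4; 1 / 12]
    [:: term (1 / 6 * sqrt 15) 1 4; term (1 / 6 * sqrt 15) 3 5]
    [:: [:: 1; 2; 3]; [:: 1; 5]; [:: 2; 4; 5]; [:: 3; 4]]%N;
  Line 5 [:: [::]; [::]; [::]; [::]; [:: term (2 / 17 * sqrt 7) 1 2]]
    [:: 9 / 17; - 5 / 17; 10 / 17; - 4 / 17; 4 / 17]
    [:: term (14 / 17) 1 2; term (14 / 17) 3 4]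
    [:: [:: 1; 3; 5]; [:: 1; 4; 5]; [:: 2; 3; 5]; [:: 2; 4; 5]]%N;
  Line 5 [:: [::]; [::]; [::]; [::]; [:: term (3 / 11) 1 2; term (3 / 11) 3 4]]
    [:: 6 / 11; - 3 / 11; 6 / 11; - 3 / 11; 3 / 11]
    [:: term (9 / 11) 1 2; term (9 / 11) 3 4]
    [:: [:: 1; 3; 5]; [:: 1; 4; 5]; [:: 2; 4; 5]]%N;
  Line 5 [:: [::]; [::]; [::]; [::]; [:: term (3 / 11) 1 2; term (3 / 11) 3 4]]
    [:: 6 / 11; - 3 / 11; 6 / 11; - 3 / 11; 3 / 11]
    [:: term (9 / 11) 1 2; term (- 9 / 11) 3 4]
    [:: [:: 1; 3; 5]; [:: 1; 4; 5]; [:: 2; 4; 5]]%N;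
  Line 5 [:: [::]; [::]; [::]; [::]; [:: term (3 / 11) 1 2; term (3 / 11) 3 4]]
    [:: 6 / 11; - 3 / 11; 6 / 11; - 3 / 11; 3 / 11]
    [:: term (9 / 11) 1 4; term (9 / 11) 3 2]
    [:: [:: 1; 2]; [:: 1; 3; 5]; [:: 2; 4; 5]]%N;
  Line 5 [:: [::]; [::]; [::]; [::]; [:: term (6 / 13) 1 2; term (6 / 13) 3 4]]
    [:: 12 / 13; - 6 / 13; 3 / 13; 3 / 13; 6 / 13]
    [:: term (18 / 13) 1 2]
    [:: [:: 1; 3; 5]; [:: 2; 3; 5]]%N;
  Line 5 [:: [::]; [::]; [::]; [::]; [::]]
    [:: 7 / 12; 7 / 12; - 1 / 4; - 1 / 4; 1 / 6]
    [:: term (5 / 6) 1 3; term (5 / 6) 2 4]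
    [:: [:: 1; 2]; [:: 1; 2; 5]; [:: 1; 4]; [:: 1; 4; 5]; [:: 3; 4]; [:: 3; 4; 5]]%N;
  Line 5 [:: [::]; [::]; [::]; [::]; [::]]
    [:: 1; - 3 / 7; 2 / 7; 2 / 7; 2 / 7]
    [:: term (10 / 7) 1 2]
    [:: [:: 1]; [:: 1; 3]; [:: 1; 3; 4]; [:: 1; 3; 4; 5]; [:: 2]; [:: 2; 3]; [:: 2; 3; 4]; [:: 2; 3; 4; 5]]%N
  ].

Definition entries (R : realType) : seq (entry R) :=
  [seq (l, s) | l <- lines R, s <- line_signs l].

Definition equivalent_to_entry (R : realType) (n : nat) (c : structure_constants R n)
    (G D : 'M[R]_n) (e : entry R) : Prop :=
  equivalent c G D (entry_sc e) (diag_metric (entry_eps e)) (entry_derivation e).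

(* Main.v *)
(* In coordinates, the vector X, the numbers A and the signs of a nondiagonal solution are
   related by x_I = eps_i eps_j eps_k c_I^2 and 2 A^i_j tr D = eps_i eps_j a_ji^2. As the
   Lie algebra is nilpotent and its basis nice, the Ricci operator of a diagonal metric is
   half the diagonal matrix with entries tM X, and the soliton equation reduces to the
   defining equation of a nondiagonal solution together with sum lam_i^2 = tr D, which is
   (N4) for mu = lam.

   For the classification, nodes are sorted by their depth in the lower central series, so
   that arrows increase; this leaves finitely many diagrams and sets of pairs with n <= 5.
   For each of them lam, A and X / (2 tr D) satisfy a linear system over Q. Its solution is
   unique, except for some one-parameter families; there a relation c_I a_p = +- c_J a_q,
   imposed by D being a derivation, gives A_p X_I = A_q X_J, which is linear in the parameter
   since the quadratic terms cancel. Hence lam, c_I^2 and a_ji^2 are known rational numbers,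
   and it remains to compare finitely many sign patterns with the list, and the entries of
   the list with each other, up to permutations and sign changes of the basis. *)

From Stdlib Require Import BinInt.
From Stdlib Require QArith_base Qreduction.
Require Import Defs.
From HB Require Import structures.
From mathcomp Require Import all_boot all_order all_algebra.
From mathcomp Require Import reals.
From mathcomp Require Import ssrZ ring lra.

Set Implicit Arguments.
Unset Strict Implicit.
Unset Printing Implicit Defensive.

Import Order.TTheory GRing.Theory Num.Theory.
Local Open Scope ring_scope.

(** * Brackets in a nice basis *)

(** The comparison has to run in exact rational arithmetic, whereas the coefficients of the list
    contain square roots. Every coefficient [x] is therefore replaced by its signed square
    [x * |x|]: this map is injective and odd, so it loses nothing and commutes with sign changes of
    the basis, and the linear system determines its absolute value. The signs of the structure
    constants and of the [a_ji] are not determined by the system: all sign vectors are tried, except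
    those that contradict a two-term component of the derivation identity. An equivalence between
    diagonal metrics with entries 1 and -1 maps each [e_i] to some [e_j] or [- e_j], since squared
    lengths are preserved; this makes the search for equivalences finite. Each Boolean test that
    discards a configuration is justified by an identity satisfied by every solution, and a
    configuration whose system is not solved makes the check fail. In particular, the cancellation
    of the quadratic terms is tested on each relation that is used, not proved in general. *)

Lemma sum_delta (R : pzSemiRingType) (I : finType) (i : I) (F : I -> R) :
  \sum_j (j == i)%:R * F j = F i.
Proof.
rewrite (bigD1 i) //= eqxx mul1r big1 ?addr0 // => j /negPf ->.
by rewrite mul0r.
Qed.

Lemma sum_delta_r (R : pzSemiRingType) (I : finType) (i : I) (F : I -> R) :
  \sum_j F j * (j == i)%:R = F i.
Proof.
rewrite (bigD1 i) //= eqxx mulr1 big1 ?addr0 // => j /negPf ->.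
by rewrite mulr0.
Qed.

Section Bracket.
Variables (R : realType) (n : nat) (c : structure_constants R n).

Lemma colDE (x y : 'cV[R]_n) i : (x + y) i 0 = x i 0 + y i 0.
Proof. by rewrite mxE. Qed.

Lemma basisE (i j : 'I_n) : basis R i j 0 = (j == i)%:R.
Proof. by rewrite mxE eqxx andbT. Qed.

Lemma bracket_basisl (i : 'I_n) (y : 'cV[R]_n) k :
  bracket c (basis R i) y k 0 = \sum_j y j 0 * c i j k.
Proof.
rewrite mxE (eq_bigr (fun i' => (i' == i)%:R * \sum_j y j 0 * c i' j k)) ?sum_delta //.
by move=> i' _; rewrite mulr_sumr; apply: eq_bigr => j _; rewrite basisE mulrA.
Qed.

Lemma bracket_basisr (x : 'cV[R]_n) (j : 'I_n) k :
  bracket c x (basis R j) k 0 = \sum_i x i 0 * c i j k.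
Proof.
rewrite mxE; apply: eq_bigr => i _.
rewrite (eq_bigr (fun j' => (j' == j)%:R * (x i 0 * c i j' k))) ?sum_delta //.
by move=> j' _; rewrite basisE mulrCA mulrA.
Qed.

Lemma bracket_basis (i j k : 'I_n) : bracket c (basis R i) (basis R j) k 0 = c i j k.
Proof.
rewrite bracket_basisl (eq_bigr (fun j' => (j' == j)%:R * c i j' k)) ?sum_delta //.
by move=> j' _; rewrite basisE.
Qed.

Lemma bracketDl x x' y : bracket c (x + x') y = bracket c x y + bracket c x' y.
Proof.
apply/matrixP => k l; rewrite !mxE -big_split; apply: eq_bigr => i _ /=.
by rewrite -big_split; apply: eq_bigr => j _ /=; rewrite mxE !mulrDl.
Qed.

Lemma bracketDr x y y' : bracket c x (y + y') = bracket c x y + bracket c x y'.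
Proof.
apply/matrixP => k l; rewrite !mxE -big_split; apply: eq_bigr => i _ /=.
by rewrite -big_split; apply: eq_bigr => j _ /=; rewrite mxE mulrDr mulrDl.
Qed.

Lemma bracketZl a x y : bracket c (a *: x) y = a *: bracket c x y.
Proof.
apply/matrixP => k l; rewrite !mxE mulr_sumr; apply: eq_bigr => i _ /=.
by rewrite mulr_sumr; apply: eq_bigr => j _ /=; rewrite mxE !mulrA.
Qed.

Lemma bracketZr a x y : bracket c x (a *: y) = a *: bracket c x y.
Proof.
apply/matrixP => k l; rewrite !mxE mulr_sumr; apply: eq_bigr => i _ /=.
by rewrite mulr_sumr; apply: eq_bigr => j _ /=; rewrite mxE; ring.
Qed.

Lemma bracket_suml (I : Type) (r : seq I) (F : I -> 'cV[R]_n) y :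
  bracket c (\sum_(i <- r) F i) y = \sum_(i <- r) bracket c (F i) y.
Proof.
elim: r => [|i r IH]; last by rewrite !big_cons bracketDl IH.
by rewrite !big_nil; have := bracketZl 0 0 y; rewrite !scale0r.
Qed.

Lemma bracket_sumr (I : Type) (r : seq I) x (F : I -> 'cV[R]_n) :
  bracket c x (\sum_(i <- r) F i) = \sum_(i <- r) bracket c x (F i).
Proof.
elim: r => [|i r IH]; last by rewrite !big_cons bracketDr IH.
by rewrite !big_nil; have := bracketZr 0 x 0; rewrite !scale0r.
Qed.

Lemma mem_lower_centralS m x y :
  y \in lower_central c m -> bracket c x y \in lower_central c m.+1.
Proof.
move=> ym /=; rewrite (coord_vbasis (memvf x)) (coord_vbasis ym) bracket_suml.
apply: memv_suml => i _; rewrite bracket_sumr; apply: memv_suml => j _.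
rewrite bracketZl bracketZr !memvZ // memv_span //.
by apply: allpairs_f; apply: mem_nth; rewrite size_tuple.
Qed.

Lemma lie_anti : is_lie_algebra c -> forall i j k, c j i k = - c i j k.
Proof.
case=> alt _ i j k; have := congr1 (fun v : 'cV[R]_n => v k 0) (alt (basis R i + basis R j)).
have alt0 l : c l l k = 0 by rewrite -bracket_basis alt mxE.
rewrite bracketDl !bracketDr !colDE !bracket_basis !alt0 mxE add0r addr0 => /eqP.
by rewrite addrC addr_eq0 => /eqP.
Qed.

Lemma lie_jacobi : is_lie_algebra c -> forall x y z l,
  \sum_m (c y z m * c x m l + c z x m * c y m l + c x y m * c z m l) = 0.
Proof.
case=> _ jac x y z l.
have := congr1 (fun v : 'cV[R]_n => v l 0) (jac (basis R x) (basis R y) (basis R z)).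
rewrite !colDE !bracket_basisl [in RHS]mxE => H; rewrite -[RHS]H !big_split.
by congr (_ + _ + _); apply: eq_bigr => m _; rewrite bracket_basis.
Qed.

Lemma nice_target : is_nice_basis c -> forall i j k l, c i j k != 0 -> c i j l != 0 -> k = l.
Proof.
case=> H _ i j k l; have [k0 [a Ha]] := H i j.
by rewrite -!bracket_basis Ha !mxE !eqxx !andbT;
  case: (altP (k =P k0)) => [->|]; case: (altP (l =P k0)) => [->|]; rewrite ?mulr0 ?eqxx.
Qed.

Lemma nice_label : is_nice_basis c -> forall i j j' k, c i j k != 0 -> c i j' k != 0 -> j = j'.
Proof.
case=> _ H i j j' k; have [j0 [a Ha]] := H i k.
have E l : c i l k = - (a * (j0 == l)%:R).
  by rewrite -[LHS]opprK -bracket_basis; congr (- _); rewrite -basisE -Ha.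
rewrite !E; case: (altP (j0 =P j)) => [->|]; case: (altP (_ =P j')) => [->|] //;
  by rewrite ?mulr0 ?oppr0 ?eqxx.
Qed.

(** Niceness makes all other coordinates of the bracket vanish, so a nonzero structure constant
    already gives the vector equation in [diagram_of]. *)
Lemma diagram_ofE : is_nice_basis c -> forall i j k, ((i, j, k) \in diagram_of c) = (c i j k !=
  0).
Proof.
move=> nice i j k; rewrite inE /=; case: (altP (c i j k =P 0)) => [|nz]; rewrite ?andbF ?andbT //.
apply/eqP/matrixP => l r; rewrite ord1 bracket_basis !mxE eqxx andbT.
case: (altP (l =P k)) => [->|lk]; rewrite ?mulr1 // mulr0; apply/eqP.
by apply: contraNT lk => nz'; rewrite (nice_target nice nz' nz).
Qed.

(** The depth of [e_k] is the index of the last term of the lower central series that contains it. A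
    nonzero multiple of [e_k] of the form [[e_i, e_j]] lies one term deeper than [e_j], and by
    antisymmetry one term deeper than [e_i]. The maximum exists because the [K]-th term is zero. *)
Lemma nilpotent_depth : is_nice_lie_algebra c ->
  exists d : 'I_n -> nat, forall i j k, c i j k != 0 -> (d i < d k)%N /\ (d j < d k)%N.
Proof.
case=> lie [K nilp] nice.
have ub k m : (m <= K)%N && (basis R k \in lower_central c m) -> (m <= K)%N by case/andP.
have ex k : exists m, (m <= K)%N && (basis R k \in lower_central c m).
  by exists 0%N; rewrite /= memvf.
pose d k := ex_maxn (ex k) (ub k); exists d.
have main i j k : c i j k != 0 -> (d j < d k)%N.
  move=> nz; rewrite {2}/d; case: ex_maxnP => m _ maxm; apply: maxm.
  rewrite /d; case: ex_maxnP => m' /andP[m'K jm'] _.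
  have km : basis R k \in lower_central c m'.+1.
    have := mem_lower_centralS (basis R i) jm'.
    have /eqP -> : bracket c (basis R i) (basis R j) == c i j k *: basis R k.
      by have := diagram_ofE nice i j k; rewrite inE /= nz andbT.
    by move=> /(memvZ (c i j k)^-1); rewrite scalerA mulVf // scale1r.
  rewrite km andbT ltn_neqAle m'K andbT; apply/eqP => E.
  move: jm'; rewrite E nilp memv0 => /eqP/matrixP/(_ j 0); rewrite basisE eqxx mxE => /eqP.
  by rewrite oner_eq0.
by move=> i j k nz; split; [apply: (main j); rewrite (lie_anti lie) oppr_eq0 | apply: main nz].
Qed.

End Bracket.

(** * Coordinates of a nondiagonal solution *)

(* A nondiagonal solution in coordinates: [D] has diagonal [lam] and off-diagonal part
   [sum_(i, j) N i j e^i (x) e_j], and [x_I], [2 A^i_j tr D] are eliminated through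
   [x_I = e_i e_j e_k c_I^2] and [2 A^i_j tr D = e_i e_j (N i j)^2]. In [ns_ric] each
   unordered arrow occurs twice. *)
Record nice_soliton (R : realType) (n : nat) (c : structure_constants R n)
    (lam : 'I_n -> R) (N : 'I_n -> 'I_n -> R) (e : 'I_n -> R) : Prop := NiceSoliton {
  ns_anti : forall i j k, c j i k = - c i j k;
  ns_jacobi : forall x y z l,
    \sum_m (c y z m * c x m l + c z x m * c y m l + c x y m * c z m l) = 0;
  ns_target : forall i j k l, c i j k != 0 -> c i j l != 0 -> k = l;
  ns_label : forall i j j' k, c i j k != 0 -> c i j' k != 0 -> j = j';
  ns_depth : exists d : 'I_n -> nat, forall i j k, c i j k != 0 -> (d i < d k)%N /\ (d j < d k)%N;
  ns_sign : forall i, e i = 1 \/ e i = -1;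
  ns_diag : forall i, N i i = 0;
  ns_disjoint : forall i j i' j', N i j != 0 -> N i' j' != 0 ->
    (i = i' /\ j = j') \/ uniq [:: i; j; i'; j'];
  ns_nonzero : exists i j, N i j != 0;
  ns_noarrow : forall i j k, N i j != 0 -> c i k j = 0;
  ns_weight : forall i j k, c i j k != 0 -> lam k = lam i + lam j;
  ns_trace : forall i j, N i j != 0 -> \sum_k lam k = lam i - lam j;
  ns_trace_neq0 : \sum_k lam k != 0;
  ns_norm : \sum_k lam k ^+ 2 = \sum_k lam k;
  ns_derivation : forall x y l, \sum_m c x y m * N m l =
    \sum_m N x m * c m y l + \sum_m N y m * c x m l;
  ns_ric : forall l,
    \sum_i \sum_j \sum_k e i * e j * e k * c i j k ^+ 2
        * ((k == l)%:R - (i == l)%:R - (j == l)%:R)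
    = 2 * (2 * (\sum_k lam k) * (lam l - 1)
           + \sum_i \sum_j e i * e j * N i j ^+ 2 * ((i == l)%:R - (j == l)%:R - 1))
}.

Lemma sum_sym (R : pzSemiRingType) (n : nat) (G : 'I_n -> 'I_n -> R) :
  (forall i j, G j i = G i j) -> (forall i, G i i = 0) ->
  \sum_i \sum_j G i j = 2 * \sum_(i < n) \sum_(j < n | (i < j)%N) G i j.
Proof.
move=> Gsym G0; rewrite mulr2n mulrDl !mul1r.
rewrite [X in _ = _ + X](exchange_big_dep xpredT) //= -big_split; apply: eq_bigr => i _.
rewrite (bigID (fun j : 'I_n => (i < j)%N)) /=; congr (_ + _).
rewrite (bigD1 i) ?ltnn //= G0 add0r; apply: eq_big => j; last by rewrite Gsym.
by rewrite -leqNgt ltn_neqAle andbC.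
Qed.

(** The coefficient of [e^i (x) e_j], which sits in row [j] and column [i]: hence the
    transposition. *)
Definition off_diagonal (R : realType) (n : nat) (D : 'M[R]_n) (i j : 'I_n) : R :=
  if i == j then 0 else D j i.

Section OfSolution.
Variables (R : realType) (n : nat) (Delta : diagram n) (cA : {set 'I_n * 'I_n}).
Variables (A : 'I_n -> 'I_n -> R) (D : 'M[R]_n) (c : structure_constants R n) (eps : 'cV[R]_n).
Hypothesis triple : nondiagonal_triple Delta cA A D.
Hypothesis sol : nondiagonal_solution Delta cA A D c eps.

Local Notation lam i := (D i i).
Local Notation N := (off_diagonal D).
Local Notation e i := (eps i 0).

Let nice_c : is_nice_lie_algebra c. Proof. by case: sol. Qed.
Let lie_c : is_lie_algebra c. Proof. by case: nice_c. Qed.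
Let basis_c : is_nice_basis c. Proof. by case: nice_c. Qed.
Let anti := lie_anti lie_c.

Lemma mem_Delta i j k : ((i, j, k) \in Delta) = (c i j k != 0).
Proof. by case: sol => _ <- _ _ _; rewrite diagram_ofE. Qed.

Lemma mem_root_index i j k : ((i, j, k) \in root_index Delta) = (i < j)%N && (c i j k != 0).
Proof.
rewrite inE !mem_Delta /=; case: (ltnP i j) => ij; rewrite ?andbF //=.
by rewrite (anti i j) oppr_eq0 andbb.
Qed.

Lemma arrow_distinct i j k : c i j k != 0 -> [/\ i != j, i != k & j != k].
Proof.
case: (nilpotent_depth nice_c) => d Hd nz; have [ik jk] := Hd _ _ _ nz.
split.
- apply: contraNneq nz => ->; have /eqP := anti j j k.
  by rewrite -addr_eq0 -mulr2n mulrn_eq0.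
- by apply: contraTneq ik => ->; rewrite ltnn.
- by apply: contraTneq jk => ->; rewrite ltnn.
Qed.

Lemma off_diagonalE i j : i != j -> exists a, [/\ D j i = if (i, j) \in cA then a else 0 &
  (i, j) \in cA -> a ^+ 2 = `|2 * A i j * \tr D| /\ a != 0].
Proof.
case: triple => _ [_ [_ _ [a [HD Ha]] _]] ij; exists (a j i); split; last first.
  move=> ijA; have [H1 H2] := Ha _ _ ijA; split=> //.
  by move: H2; rewrite -H1 sqrf_eq0.
rewrite {1}HD mxE !summxE big1 ?add0r; last first.
  move=> k _; rewrite !mxE; case: (j =P k) => [<-|_]; last by rewrite andFb mulr0.
  by rewrite (negPf ij) mulr0.
case: ifP => ijA; last first.
  rewrite big1 // => -[i' j'] pA; rewrite !mxE /=.
  case: (j =P j') => [Ej|_]; case: (i =P i') => [Ei|_]; rewrite ?mulr0 //.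
  by rewrite -Ei -Ej ijA in pA.
rewrite (bigD1 (i, j)) //= !mxE !eqxx mulr1 big1 ?addr0 // => -[i' j'] /andP[_ ne].
rewrite !mxE /=; move: ne; rewrite xpair_eqE negb_and (eq_sym j) (eq_sym i).
by case: eqP => [->|]; case: eqP => [->|]; rewrite ?mulr0 ?eqxx.
Qed.

Lemma off_diagonal_neq0 i j : N i j != 0 -> (i, j) \in cA /\ i != j.
Proof.
rewrite /off_diagonal; have [_|ij] := eqVneq i j; first by rewrite eqxx.
by have [a [-> _]] := off_diagonalE ij; case: ifP => //; rewrite eqxx.
Qed.

Lemma cA_neq i j : (i, j) \in cA -> i != j.
Proof. by case: triple => _ [[H _ _] _]; apply: H. Qed.

Lemma cA_neq0 i j : (i, j) \in cA -> N i j != 0.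
Proof.
move=> ijA; have ij := cA_neq ijA; rewrite /off_diagonal (negPf ij).
by have [a [-> Ha]] := off_diagonalE ij; rewrite ijA; case: (Ha ijA).
Qed.

Lemma traceE : \tr D = \sum_k lam k.
Proof. by []. Qed.

(** The absolute value comes from (N6) and the sign from [eps_i / eps_j], which equals
    [eps_i eps_j]. *)
Lemma cA_sign i j : (i, j) \in cA -> 2 * A i j * \tr D = e i * e j * N i j ^+ 2.
Proof.
move=> ijA; have ij := cA_neq ijA; rewrite /off_diagonal (negPf ij).
have [a [-> Ha]] := off_diagonalE ij; rewrite ijA; have [-> _] := Ha ijA.
case: sol => _ _ _ He [X [_ _ _ Hs]]; have := Hs _ _ ijA.
rewrite -[2 * _ * _]mulrA normrM (ger0_norm (_ : 0 <= 2)) // => Es.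
have <- : Num.sg (A i j * \tr D) = e i * e j.
  by rewrite -Es; case: (He j) => ->; rewrite ?invr1 ?invrN1.
by rewrite [RHS]mulrCA -numEsg mulrA.
Qed.

Lemma trace_neq0 : \tr D != 0.
Proof.
case: triple => -[ne _] _; case/set0Pn: ne => -[i j] ijA.
have := cA_neq0 ijA; have ij := cA_neq ijA; rewrite /off_diagonal (negPf ij).
have [a [-> Ha]] := off_diagonalE ij; rewrite ijA; have [+ a0] := Ha ijA => + _.
apply: contra_eq_neq => ->; by rewrite mulr0 normr0 sqrf_eq0.
Qed.

Lemma weightE i j k : c i j k != 0 -> lam k = lam i + lam j.
Proof.
(* Only triples with [i < j] index the rows of the root matrix. *)
wlog ij : i j / (i < j)%N.
  move=> H nz; have [nij _ _] := arrow_distinct nz.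
  have [ij|ji] := ltnP i j; first exact: H.
  rewrite addrC; apply: H; last by rewrite anti oppr_eq0.
  by rewrite ltn_neqAle eq_sym -(inj_eq val_inj) in nij ji *; rewrite nij.
move=> nz; have [nij nik njk] := arrow_distinct nz.
have mem : (i, j, k) \in root_index Delta by rewrite mem_root_index ij.
case: triple => _ [_ [_ _ _ /matrixP/(_ (enum_rank_in mem (i, j, k)) 0)]].
rewrite mxE [RHS]mxE (bigD1 k) // (bigD1 i) //= (bigD1 j) /=; last by rewrite njk eq_sym.
rewrite big1 => [|l /andP[/andP[lk li] lj]]; rewrite !mxE enum_rankK_in //.
  rewrite !eqxx (negPf nik) (negPf njk) orbT /= => /eqP.
  by rewrite mul1r !mulN1r addr0 -opprD subr_eq0 => /eqP.
by rewrite (negPf lk) (negPf li) (negPf lj) mul0r.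
Qed.

(** The absolute value of [x_I] is [c_I ^ 2]. Its sign is [eps_i eps_j eps_k], because modulo 2 the
    row [I] of the root matrix adds the coordinates [i], [j] and [k]. *)
Lemma solutionE : exists X : 'cV[R]_#|root_index Delta|,
  (forall l, \sum_I root_mx R Delta I l * X I 0 =
     2 * \tr D * (lam l - 1) + \sum_(p in cA) e p.1 * e p.2 * N p.1 p.2 ^+ 2
        * ((p.1 == l)%:R - (p.2 == l)%:R - 1)) /\
  forall I, let: (i, j, k) := enum_val I in X I 0 = e i * e j * e k * c i j k ^+ 2.
Proof.
case: sol => _ _ _ He [X [HX Hsq Hsgn _]]; exists X; split=> [l|I].
  have t2 : 2 * \tr D != 0 by apply: mulf_neq0 trace_neq0; rewrite pnatr_eq0.
  have /matrixP/(_ l 0) := HX; rewrite !mxE summxE.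
  under eq_bigr => I _ do rewrite mxE.
  under [X in _ = _ + X + _ -> _]eq_bigr => p _ do rewrite !mxE !eqxx !andbT !(eq_sym l).
  move=> /(congr1 ( *%R (2 * \tr D))); rewrite mulrA mulfV // mul1r => ->.
  rewrite [X in _ = _ + X](eq_bigr (fun p => (2 * \tr D) * (A p.1 p.2 * ((p.1 == l)%:R - (p.2 ==
    l)%:R)
                                           - A p.1 p.2))); last first.
    by move=> [i j] pA /=; rewrite -(cA_sign pA); ring.
  by rewrite -mulr_sumr sumrB; ring.
case EI: (enum_val I) => [[i j] k].
have mem : (i, j, k) \in root_index Delta by rewrite -EI enum_valP.
have nz : c i j k != 0 by move: mem; rewrite mem_root_index => /andP[].
have [nij nik njk] := arrow_distinct nz.
have := Hsq I; rewrite /root_sc EI => Ec.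
have X0 : X I 0 != 0 by rewrite -normr_eq0 -Ec sqrf_eq0.
rewrite [LHS]numEsg -Ec; congr (_ * _).
have /matrixP/(_ I 0) := Hsgn; rewrite [LHS]mxE [RHS]mxE (bigD1 k) // (bigD1 i) //=.
rewrite (bigD1 j) /=; last by rewrite njk eq_sym.
rewrite big1 => [|l /andP[/andP[lk li] lj]]; rewrite !mxE EI; last first.
  by rewrite (negPf lk) (negPf li) (negPf lj) /= mul0r.
rewrite !eqxx (negPf nik) (negPf njk) orbT /=.
case: (ltrgt0P (X I 0)) X0 => // sX _.
all: (rewrite (gtr0_sg sX) || rewrite (ltr0_sg sX)).
all: case: (He i) => ->; case: (He j) => ->; case: (He k) => ->.
all: rewrite ?ltrN10 ?ltr10 ?mulr1 ?mulrN1 ?mul1r ?opprK //.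
all: by move/eqP.
Qed.

(** Each row of the root matrix is met twice, as [(i, j, k)] and as [(j, i, k)]. *)
Lemma sum_arrows (F : 'I_n -> 'I_n -> 'I_n -> R) :
  (forall i j k, F j i k = F i j k) -> (forall i j k, c i j k = 0 -> F i j k = 0) ->
  \sum_i \sum_j \sum_k F i j k = 2 * \sum_(t in root_index Delta) F t.1.1 t.1.2 t.2.
Proof.
move=> Fsym F0; rewrite sum_sym => [|i j|i]; last first.
- rewrite big1 // => k _; apply: F0; apply/eqP; apply: contraT => /arrow_distinct[].
  by rewrite eqxx.
- by apply: eq_bigr => k _.
congr (2 * _); rewrite pair_big_dep pair_big_dep /= [RHS]big_mkcond [LHS]big_mkcond /=.
apply: eq_bigr => -[[i j] k] _; rewrite mem_root_index andbT /=; case: ltnP => //= _.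
by case: eqP => //= /F0.
Qed.

(** By [weightE] the diagonal part of [D] is itself a derivation, so its contribution cancels. *)
Lemma derivation_off_diagonal x y l : \sum_m c x y m * N m l =
  \sum_m N x m * c m y l + \sum_m N y m * c x m l.
Proof.
have Dsplit i j : D j i = (i == j)%:R * D i i + N i j.
  by rewrite /off_diagonal; have [->|_] := eqVneq i j; rewrite ?mul1r ?addr0 ?mul0r ?add0r.
case: sol => _ _ /(_ (basis R x) (basis R y)) H _ _.
have := congr1 (fun v : 'cV[R]_n => v l 0) H.
have Dbasis i m : (D *m basis R i) m 0 = D m i.
  rewrite mxE (eq_bigr (fun j => D m j * (j == i)%:R)) ?sum_delta_r // => j _.
  by rewrite basisE.
rewrite colDE bracket_basisl bracket_basisr mxE.
under eq_bigr => m _ do rewrite bracket_basis Dsplit mulrDl -mulrA.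
under [X in _ = X + _ -> _]eq_bigr => m _ do rewrite Dbasis Dsplit mulrDl -mulrA eq_sym.
under [X in _ = _ + X -> _]eq_bigr => m _ do rewrite Dbasis Dsplit mulrDl -mulrA eq_sym.
rewrite !big_split /= !sum_delta => E.
have W : c x y l * (lam l - lam x - lam y) = 0.
  have [->|/weightE ->] := eqVneq (c x y l) 0; first by rewrite mul0r.
  by rewrite (addrC (lam x)) addrK subrr mulr0.
under eq_bigr do rewrite mulrC; lra.
Qed.

(** In (N4) for [mu = lam], condition (N5) turns every [lam_j - lam_i] into [- tr D]; the last sum
    then cancels the part of the first term that contains the sum of the [A^i_j]. *)
Lemma norm_diagonal : \sum_k lam k ^+ 2 = \sum_k lam k.
Proof.
case: triple => _ [_ [/(_ (diag_entries D)) N4 N5 _ /N4 E]].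
have diagE k : diag_entries D k 0 = lam k by rewrite mxE.
have {}N5 i j : (i, j) \in cA -> \sum_k lam k = lam i - lam j.
  by move=> pA; rewrite -!diagE -(N5 _ _ pA); apply: eq_bigr => k _; rewrite diagE.
have -> : \sum_k lam k ^+ 2 = \sum_i diag_entries D i 0 * diag_entries D i 0.
  by apply: eq_bigr => k _; rewrite diagE expr2.
rewrite E (eq_bigr (fun k => lam k)) => [|k _]; last exact: diagE.
rewrite [X in _ + X](eq_bigr (fun p => - (\sum_k lam k) * A p.1 p.2)) => [|[i j] pA /=].
  by rewrite -mulr_sumr; ring.
by rewrite (N5 _ _ pA) !diagE; ring.
Qed.

Lemma nice_soliton_of_solution : nice_soliton c (fun i => D i i) (off_diagonal D) (fun i => eps i
  0).
Proof.
split=> //.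
- exact: lie_jacobi.
- exact: nice_target.
- exact: nice_label.
- exact: nilpotent_depth.
- by case: sol.
- by move=> i; rewrite /off_diagonal eqxx.
- move=> i j i' j' /off_diagonal_neq0[pA _] /off_diagonal_neq0[qA _].
  have [[-> ->]|ne] := eqVneq (i, j) (i', j'); [by left | right].
  by case: triple => _ [[_ H _] _]; apply: H.
- case: triple => -[/set0Pn[[i j] pA] _] _; exists i, j; exact: cA_neq0.
- move=> i j k /off_diagonal_neq0[pA _]; case: triple => _ [[_ _ H] _].
  by apply/eqP; apply: contraNT (H i j k pA); rewrite mem_Delta.
- exact: weightE.
- move=> i j /off_diagonal_neq0[pA _]; case: triple => _ [_ [_ H _ _]].
  by have := H _ _ pA; under eq_bigr do rewrite mxE; rewrite !mxE.
- exact: trace_neq0.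
- exact: norm_diagonal.
- exact: derivation_off_diagonal.
move=> l; have [X [HX1 HX2]] := solutionE.
rewrite sum_arrows; last 2 first.
- move=> i j k; rewrite (anti i j) sqrrN; ring.
- by move=> i j k ->; rewrite expr0n mulr0 mul0r.
congr (2 * _); rewrite -traceE.
have -> : \sum_i \sum_j e i * e j * N i j ^+ 2 * ((i == l)%:R - (j == l)%:R - 1) =
    \sum_(p in cA) e p.1 * e p.2 * N p.1 p.2 ^+ 2 * ((p.1 == l)%:R - (p.2 == l)%:R - 1).
  rewrite pair_big /= [RHS]big_mkcond /=; apply: eq_bigr => -[i j] _ /=.
  case: ifP => // /negbT pA; have [->|/off_diagonal_neq0[]] := eqVneq (N i j) 0.
    by rewrite expr0n mulr0 mul0r.
  by rewrite (negPf pA).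
rewrite -HX1 big_enum_val /=; apply: eq_bigr => I _.
have := HX2 I; rewrite !mxE; have := enum_valP I; case: (enum_val I) => [[i j] k].
rewrite mem_root_index => /andP[_ nz] -> /=; rewrite mulrC; congr (_ * _).
have [nij nik njk] := arrow_distinct nz; rewrite !(eq_sym l).
have [lk|lk] := eqVneq k l; first by rewrite -lk (negPf nik) (negPf njk) !subr0.
have [li|li] := eqVneq i l; first by rewrite -li eq_sym (negPf nij) /= mulrN1z subr0 sub0r.
by have [lj|lj] := eqVneq j l; rewrite /= ?mulrN1z ?mulr0z ?subr0 ?sub0r.
Qed.

End OfSolution.

(** * The Ricci operator of a diagonal metric *)

(** The two expressions of the Ricci form agree only after exchanging the summation indices, not
    term by term. *)
Lemma sum_swap_eq (R : numFieldType) (n : nat) (F G : 'I_n -> 'I_n -> R) :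
  (forall i j, F i j + F j i = G i j + G j i) ->
  \sum_i \sum_j F i j = \sum_i \sum_j G i j.
Proof.
have S H : 2 * (\sum_i \sum_j H i j) = \sum_(i < n) \sum_(j < n) (H i j + H j i) :> R.
  rewrite mulr2n mulrDl !mul1r [X in _ + X]exchange_big -big_split.
  by apply: eq_bigr => i _; rewrite -big_split.
move=> E; apply: (@mulfI _ 2); first by rewrite pnatr_eq0.
by rewrite !S; apply: eq_bigr => i _; apply: eq_bigr => j _.
Qed.

Section DiagonalMetric.
Variables (R : realType) (n : nat) (c : structure_constants R n) (eps : 'cV[R]_n).
Hypothesis sign : forall i, eps i 0 = 1 \/ eps i 0 = -1.
Local Notation e i := (eps i 0).
Local Notation G := (diag_metric eps).

Lemma sign_sqr i : e i * e i = 1.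
Proof. by case: (sign i) => ->; rewrite ?mulr1 ?mulrNN ?mulr1. Qed.

Lemma diag_metricE i j : G i j = (i == j)%:R * e i.
Proof.
rewrite summxE (bigD1 i) //= !mxE eqxx big1 ?addr0 => [|k /negPf ki].
  by rewrite /= mulrC (eq_sym j).
by rewrite !mxE (eq_sym i) ki mulr0.
Qed.

Lemma diag_metric_mull m (M : 'M[R]_(n, m)) i j : (G *m M) i j = e i * M i j.
Proof.
rewrite mxE (eq_bigr (fun k => (k == i)%:R * (e i * M k j))) ?sum_delta // => k _.
by rewrite diag_metricE eq_sym mulrA.
Qed.

Lemma diag_metric_mulr m (M : 'M[R]_(m, n)) i j : (M *m G) i j = M i j * e j.
Proof.
rewrite mxE (eq_bigr (fun k => (M i k * e k) * (k == j)%:R)) ?sum_delta_r // => k _.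
by rewrite diag_metricE; ring.
Qed.

Lemma diag_metric_sqr : G *m G = 1%:M.
Proof.
apply/matrixP => i j; rewrite diag_metric_mull diag_metricE mulrCA sign_sqr mulr1 mxE.
by case: eqP.
Qed.

Lemma diag_metric_inv : invmx G = G.
Proof.
have [_ U] := mulmx1_unit diag_metric_sqr.
by rewrite -[LHS]mulmx1 -diag_metric_sqr mulmxA mulVmx // mul1mx.
Qed.

Lemma is_metric_diag : is_metric G.
Proof.
split; last by have [] := mulmx1_unit diag_metric_sqr.
by apply/matrixP => i j; rewrite mxE !diag_metricE eq_sym; case: eqP => [->|]; rewrite ?mul0r.
Qed.

Lemma adjoint_diag (M : 'M[R]_n) i j : adjoint G M i j = e i * e j * M j i.
Proof.
by rewrite /adjoint diag_metric_inv diag_metric_mulr diag_metric_mull mxE; ring.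
Qed.

(** The [e_k] component of the covariant derivative of [e_j] along [e_i], from Koszul's formula. *)
Definition christoffel (i j k : 'I_n) : R :=
  2^-1 * (c i j k - e k * e j * c i k j - e k * e i * c j k i).

Lemma colBE (u v : 'cV[R]_n) k : (u - v) k 0 = u k 0 - v k 0.
Proof. by rewrite !mxE. Qed.

Lemma levi_civitaE x y k :
  levi_civita c G x y k 0 = \sum_i \sum_j x i 0 * y j 0 * christoffel i j k.
Proof.
have -> : levi_civita c G x y k 0 = 2^-1 * (bracket c x y k 0
    - (adjoint G (ad c x) *m y) k 0 - (adjoint G (ad c y) *m x) k 0).
  by rewrite -!colBE mxE.
rewrite [(_ *m y) _ _]mxE [(_ *m x) _ _]mxE [bracket _ _ _ _ _]mxE.
have E1 j : adjoint G (ad c x) k j * y j 0 = \sum_i x i 0 * y j 0 * (e k * e j * c i k j).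
  by rewrite adjoint_diag mxE bracket_basisr mulr_sumr mulr_suml; apply: eq_bigr => i _; ring.
have E2 i : adjoint G (ad c y) k i * x i 0 = \sum_j x i 0 * y j 0 * (e k * e i * c j k i).
  by rewrite adjoint_diag mxE bracket_basisr mulr_sumr mulr_suml; apply: eq_bigr => j _; ring.
rewrite (eq_bigr _ (fun j _ => E1 j)) (eq_bigr _ (fun i _ => E2 i)) [X in _ - X - _]exchange_big
  /=.
rewrite -!sumrB mulr_sumr; apply: eq_bigr => i _.
rewrite -!sumrB mulr_sumr; apply: eq_bigr => j _; rewrite /christoffel; ring.
Qed.

Lemma levi_civita_basisl i y k :
  levi_civita c G (basis R i) y k 0 = \sum_j y j 0 * christoffel i j k.
Proof.
rewrite levi_civitaE (eq_bigr (fun i' => (i' == i)%:R * \sum_j y j 0 * christoffel i' j k)).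
  by rewrite sum_delta.
by move=> i' _; rewrite mulr_sumr; apply: eq_bigr => j _; rewrite basisE mulrA.
Qed.

Lemma levi_civita_basisr x j k :
  levi_civita c G x (basis R j) k 0 = \sum_i x i 0 * christoffel i j k.
Proof.
rewrite levi_civitaE; apply: eq_bigr => i _.
rewrite (eq_bigr (fun j' => (j' == j)%:R * (x i 0 * christoffel i j' k))) ?sum_delta //.
by move=> j' _; rewrite basisE; ring.
Qed.

Lemma levi_civita_basis i j k :
  levi_civita c G (basis R i) (basis R j) k 0 = christoffel i j k.
Proof.
rewrite levi_civita_basisl (eq_bigr (fun j' => (j' == j)%:R * christoffel i j' k)).
  by rewrite sum_delta.
by move=> j' _; rewrite basisE.
Qed.

Hypothesis anti : forall i j k, c j i k = - c i j k.
Hypothesis depth :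
  exists d : 'I_n -> nat, forall i j k, c i j k != 0 -> (d i < d k)%N /\ (d j < d k)%N.

Lemma no_loop i j : c i j i = 0 /\ c i j j = 0.
Proof.
case: depth => d Hd; split; apply/eqP; apply: contraT => /Hd[]; by rewrite ltnn.
Qed.

(** Up to sign these products are the terms of the Killing form of [e_j] and [e_l]; a nonzero one
    would make the depth increase both from [i] to [m] and from [m] to [i]. *)
Lemma no_cycle i j l m : c i l m * c j m i = 0.
Proof.
case: depth => d Hd; apply/eqP; apply: contraT; rewrite mulf_eq0 negb_or.
by case/andP => /Hd[im _] /Hd[_ mi]; have := ltn_trans im mi; rewrite ltnn.
Qed.

(** The usual formula for nilpotent metric Lie algebras: a quarter of the terms in which [e_j] and
    [e_l] are components of brackets, minus half of the products of brackets with [e_j] and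
    [e_l]. *)
Lemma ricci_form_basis j l : ricci_form c G (basis R j) (basis R l) =
  \sum_i \sum_m (4^-1 * e l * e j * e m * e i * c i m l * c i m j
                 - 2^-1 * e i * e m * c i l m * c i j m).
Proof.
have c_ii i m : c i i m = 0.
  by have /eqP := anti i i m; rewrite -addr_eq0 -mulr2n mulrn_eq0 => /eqP.
rewrite -(sum_swap_eq (F := fun i m =>
  - christoffel i l m * christoffel j m i - c i j m * christoffel m l i)) => [|i m].
  apply: eq_bigr => i _; rewrite /curvature 2!colBE 2!levi_civita_basisl levi_civita_basisr.
  rewrite -!sumrB; apply: eq_bigr => m _; rewrite !levi_civita_basis bracket_basis.
  have -> : christoffel i m i = 0.
    by rewrite /christoffel c_ii (no_loop i m).1 (no_loop m i).2; ring.
  ring.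
(* Symmetrization in [i] and [m] leaves only products that vanish for want of cycles. *)
have v1 := no_cycle i j l m; have v2 := no_cycle m j l i.
rewrite /christoffel (anti m l i) (anti i m l) (anti i l m) (anti i m j) (anti j i m) (anti j m
  i).
move: (c i l m) (c m l i) (c i m l) (c i m j) (c j m i) (c j i m) v1 v2 => a b p q r s v1 v2.
case: (sign i) (sign j) (sign l) (sign m) => [] -> [] -> [] -> [] ->; lra.
Qed.

End DiagonalMetric.

(** * The soliton equation *)

Section MetricSolution.
Variables (R : realType) (n : nat) (c : structure_constants R n) (eps : 'cV[R]_n) (D : 'M[R]_n).
Hypothesis sol : nice_soliton c (fun i => D i i) (off_diagonal D) (fun i => eps i 0).
Local Notation e i := (eps i 0).
Local Notation G := (diag_metric eps).
Local Notation lam i := (D i i).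
Local Notation N := (off_diagonal D).

Let sign := ns_sign sol.
Let ee i : e i * e i = 1 := sign_sqr sign i.
Let b i j := e i * e j * N i j ^+ 2.

Lemma off_diagonal_split i j : D i j = (i == j)%:R * lam j + N j i.
Proof.
by rewrite /off_diagonal eq_sym; have [->|_] := eqVneq j i; rewrite ?mul1r ?addr0 ?mul0r ?add0r.
Qed.

(** By (N2), nonzero coefficients at different places share no index. It follows that the
    off-diagonal part of [D] times its adjoint is diagonal, in either order. *)
Lemma off_diagonal_mul i j i' j' : ~ (i = i' /\ j = j') -> ~~ uniq [:: i; j; i'; j'] ->
  N i j * N i' j' = 0.
Proof.
move=> ne nu; have [->|nz] := eqVneq (N i j) 0; first by rewrite mul0r.
have [->|nz'] := eqVneq (N i' j') 0; first by rewrite mulr0.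
by case: (ns_disjoint sol nz nz') => // u; rewrite u in nu.
Qed.

Lemma off_diagonal_row m i j : i != j -> N m i * N m j = 0.
Proof.
move=> /eqP ij; apply: off_diagonal_mul; first by case.
by rewrite /= !inE eqxx !orbT.
Qed.

Lemma off_diagonal_col m i j : i != j -> N i m * N j m = 0.
Proof.
move=> /eqP ij; apply: off_diagonal_mul; first by case.
by rewrite /= !inE eqxx !orbT andbF.
Qed.

Lemma off_diagonal_flip i j : N i j * N j i = 0.
Proof.
have [->|ij] := eqVneq i j; first by rewrite (ns_diag sol) mul0r.
apply: off_diagonal_mul; first by case=> /eqP; rewrite (negPf ij).
by rewrite /= !inE eqxx !orbT.
Qed.

(** Off the diagonal each product needs two targets of one pair, or two labels between the same two
    nodes, and vanishes by niceness. On the diagonal the formula is a quarter of [ns_ric]. *)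
Lemma ricci_diag : ricci c G = \matrix_(i, j) ((i == j)%:R *
  (\tr D * (lam i - 1) + 2^-1 * (\sum_j b i j - \sum_j b j i - \sum_i \sum_j b i j))).
Proof.
apply/matrixP => i l; rewrite /ricci (diag_metric_inv sign) diag_metric_mull !mxE.
rewrite (ricci_form_basis sign (ns_anti sol) (ns_depth sol)).
have [<-|il] := eqVneq i l; last first.
  rewrite mul0r big1 ?mulr0 // => p _; rewrite big1 // => q _.
  rewrite -!mulrA.
  have -> : c p q i * c p q l = 0.
    have [->|nz] := eqVneq (c p q i) 0; first by rewrite mul0r.
    have [->|nz'] := eqVneq (c p q l) 0; first by rewrite mulr0.
    by rewrite (ns_target sol nz nz') eqxx in il.
  have -> : c p i q * c p l q = 0.
    have [->|nz] := eqVneq (c p i q) 0; first by rewrite mul0r.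
    have [->|nz'] := eqVneq (c p l q) 0; first by rewrite mulr0.
    by rewrite (ns_label sol nz nz') eqxx in il.
  by rewrite !mulr0 subrr.
pose x p q r := e p * e q * e r * c p q r ^+ 2.
have xC p q r : x q p r = x p q r by rewrite /x (ns_anti sol p q) sqrrN; ring.
have H := ns_ric sol i; rewrite /= in H.
have E : e i * (\sum_p \sum_q (4^-1 * e i * e i * e q * e p * c p q i * c p q i
    - 2^-1 * e p * e q * c p i q * c p i q)) =
    4^-1 * \sum_p \sum_q x p q i - 2^-1 * \sum_p \sum_q x i p q.
  rewrite !mulr_sumr -sumrB; apply: eq_bigr => p _; rewrite !mulr_sumr -sumrB.
  apply: eq_bigr => q _; rewrite -(xC i p) /x; case: (sign i) => ->; ring.
rewrite E mul1r; have := congr1 ( *%R 4^-1) H.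
have -> : \sum_p \sum_q \sum_k e p * e q * e k * c p q k ^+ 2
        * ((k == i)%:R - (p == i)%:R - (q == i)%:R) =
     \sum_p \sum_q x p q i - 2 * \sum_p \sum_q x i p q.
  under eq_bigr => p _ do under eq_bigr => q _ do
    (under eq_bigr => k _ do rewrite 2!mulrBr; rewrite 2!sumrB sum_delta_r -!mulr_suml).
  under eq_bigr => p _ do rewrite 2!sumrB sum_delta_r.
  rewrite 2!sumrB.
  have -> : \sum_p \sum_q (\sum_k x p q k) * (p == i)%:R = \sum_q \sum_k x i q k.
    by under eq_bigr => p _ do rewrite -mulr_suml; rewrite sum_delta_r.
  rewrite mulr2n mulrDl mul1r opprD addrA; congr (_ - _ - _).
  by apply: eq_bigr => p _; apply: eq_bigr => k _; rewrite xC.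
have -> : \sum_p \sum_q e p * e q * N p q ^+ 2 * ((p == i)%:R - (q == i)%:R - 1) =
    \sum_j b i j - \sum_j b j i - \sum_p \sum_j b p j.
  under eq_bigr => p _ do (under eq_bigr => q _ do rewrite 2!mulrBr mulr1;
    rewrite 2!sumrB sum_delta_r -!mulr_suml).
  by rewrite 2!sumrB sum_delta_r.
rewrite traceE => K; lra.
Qed.

Lemma adjoint_split i j : adjoint G D i j = (i == j)%:R * lam i + e i * e j * N i j.
Proof.
rewrite (adjoint_diag sign) off_diagonal_split; have [->|ij] := eqVneq i j.
  by rewrite ee !mul1r.
by rewrite !mul0r !add0r.
Qed.

Lemma metric_solution_of_soliton : is_derivation c D -> is_metric_solution c G D.
Proof.
move=> der; split=> //; first exact: is_metric_diag; last first.
  (* The trace condition: diagonal entries of [D] meet only loops, and an off-diagonal coefficient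
     from [l] to [k] meets an arrow from [l] to [k], excluded by (N3). *)
  move=> v; rewrite /mxtrace big1 // => k _; rewrite mxE big1 // => l _.
  rewrite mxE bracket_basisr mulr_suml big1 // => i _; rewrite adjoint_split -mulrA.
  have [->|lk] := eqVneq l k.
    by rewrite (no_loop (ns_depth sol) i k).2 mul0r mulr0.
  have [->|nz] := eqVneq (N l k) 0; first by rewrite mulr0 mul0r addr0 !mulr0.
  by rewrite (ns_anti sol l i) (ns_noarrow sol i nz) oppr0 mul0r mulr0.
have symE i j : sym_part G D i j = (i == j)%:R * lam i + 2^-1 * (N j i + e i * e j * N i j).
  rewrite 2!mxE adjoint_split; have [->|ij] := eqVneq i j; first by rewrite (ns_diag sol) /=; lra.
  by rewrite (off_diagonal_split i j) (negPf ij) !mul0r; lra.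
have trE : \tr (sym_part G D *m sym_part G D) = \tr D + 2^-1 * \sum_i \sum_j b i j.
  have termE i j : sym_part G D i j * sym_part G D j i =
      lam i ^+ 2 * (j == i)%:R + 4^-1 * (b i j + b j i).
    rewrite !symE /b; have F := off_diagonal_flip i j; have [<-|ij] := eqVneq i j.
      by rewrite (ns_diag sol) /=; ring.
    by case: (sign i) => ->; case: (sign j) => -> /=; lra.
  rewrite /mxtrace (eq_bigr (fun i => lam i ^+ 2 + 4^-1 * (\sum_j b i j + \sum_j b j i))).
    rewrite big_split (ns_norm sol) -mulr_sumr big_split /=; congr (_ + _).
    by rewrite [X in _ * (_ + X)]exchange_big /=; lra.
  move=> i _; rewrite mxE (eq_bigr _ (fun j _ => termE i j)) big_split /= sum_delta_r.
  by rewrite -mulr_sumr big_split.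
have rowE i l : \sum_m N m i * (e m * e l * N m l) = (i == l)%:R * \sum_m b m l.
  rewrite mulr_sumr; apply: eq_bigr => m _; rewrite /b; have [->|il] := eqVneq i l;
    first by rewrite /=; ring.
  by rewrite mul0r mulrCA off_diagonal_row // mulr0.
have colE i l : \sum_m e i * e m * N i m * N l m = (i == l)%:R * \sum_m b i m.
  rewrite mulr_sumr; apply: eq_bigr => m _; rewrite /b; have [->|il] := eqVneq i l;
    first by rewrite /=; ring.
  by rewrite mul0r -mulrA off_diagonal_col // mulr0.
have adjE := adjoint_split; rewrite ricci_diag.
move: (sym_part G D) (adjoint G D) symE trE adjE => S D' symE trE adjE.
apply/matrixP => i l; rewrite !mxE trE symE.
have -> : \sum_j D i j * D' j l = (i == l)%:R * (lam i * lam i)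
    + lam i * (e i * e l * N i l) + N l i * lam l + (i == l)%:R * \sum_m b m l.
  rewrite -rowE (eq_bigr (fun m => (m == i)%:R * (lam m * ((m == l)%:R * lam m + e m * e l * N m
    l))
      + N m i * lam m * (m == l)%:R + N m i * (e m * e l * N m l))).
    by rewrite !big_split /= sum_delta sum_delta_r; ring.
  by move=> m _; rewrite off_diagonal_split adjE (eq_sym i m); ring.
have -> : \sum_j D' i j * D j l = (i == l)%:R * (lam i * lam i)
    + lam i * N l i + e i * e l * N i l * lam l + (i == l)%:R * \sum_m b i m.
  rewrite -colE (eq_bigr (fun m => (m == i)%:R * (lam i * ((m == l)%:R * lam l + N l m))
      + e i * e m * N i m * lam l * (m == l)%:R + e i * e m * N i m * N l m)).
    rewrite !big_split /= sum_delta sum_delta_r.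
    by have [->|_] := eqVneq i l; rewrite /=; ring.
  by move=> m _; rewrite off_diagonal_split adjE (eq_sym i m); ring.
have [<-|il] := eqVneq i l; first by rewrite (ns_diag sol) mulr1n /=; ring.
(* By (N5), off the diagonal the commutator of [D] with its adjoint is balanced by [tr D] times the
   symmetric part. *)
have t1 : (\tr D - (lam i - lam l)) * N i l = 0.
  have [->|/(ns_trace sol) <-] := eqVneq (N i l) 0; first by rewrite mulr0.
  by rewrite subrr mul0r.
have t2 : (\tr D - (lam l - lam i)) * N l i = 0.
  have [->|/(ns_trace sol) <-] := eqVneq (N l i) 0; first by rewrite mulr0.
  by rewrite subrr mul0r.
rewrite mulr0n /=; case: (sign i) => ->; case: (sign l) => ->; lra.
Qed.

End MetricSolution.

Local Notation Q := QArith_base.Q.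
Local Notation Qmake := QArith_base.Qmake.
Local Notation Qnum := QArith_base.Qnum.
Local Notation Qden := QArith_base.Qden.
Local Notation Qred := Qreduction.Qred.
Local Notation Qeqb := QArith_base.Qeq_bool.
Local Notation Qopp := QArith_base.Qopp.
Local Notation Qinv := QArith_base.Qinv.
Local Notation Q0 := (Qmake Z0 xH).
Local Notation Q1 := (Qmake (Zpos xH) xH).

(** * Exact arithmetic *)

(** Reduction after every operation keeps numerators and denominators small in the computations
    below. *)
Definition Qadd (a b : Q) : Q := Qred (QArith_base.Qplus a b).
Definition Qmul (a b : Q) : Q := Qred (QArith_base.Qmult a b).
Definition Qneg (q : Q) : bool := if Qnum q is Zneg _ then true else false.
Definition Qabs (q : Q) : Q := if Qneg q then Qopp q else q.
Definition Qzero (q : Q) : bool := if Qnum q is Z0 then true else false.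

Section Values.
Variable R : realFieldType.

Definition Zval (z : Z) : R := (int_of_Z z)%:~R.
Definition Qval (q : Q) : R := Zval (Qnum q) / Zval (Zpos (Qden q)).

Lemma ZvalD a b : Zval (Z.add a b) = Zval a + Zval b.
Proof. by rewrite /Zval (rmorphD int_of_Z a b) rmorphD. Qed.

Lemma ZvalM a b : Zval (Z.mul a b) = Zval a * Zval b.
Proof. by rewrite /Zval (rmorphM int_of_Z a b) rmorphM. Qed.

Lemma ZvalN a : Zval (Z.opp a) = - Zval a.
Proof. by rewrite /Zval (rmorphN int_of_Z a) rmorphN. Qed.

Lemma Zval_inj : injective Zval.
Proof. by move=> a b /intr_inj /(can_inj int_of_ZK). Qed.

Lemma Zval_eq0 a : (Zval a == 0) = (a == Z0).
Proof. exact: (inj_eq Zval_inj a Z0). Qed.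

Lemma Zval_pos p : 0 < Zval (Zpos p).
Proof. by rewrite /Zval ltr0z /= ltz_nat; case: (Pnat.Pos2Nat.is_succ p) => n ->. Qed.

Lemma Zval_neg p : Zval (Zneg p) < 0.
Proof. by rewrite -[Zneg p]/(Z.opp (Zpos p)) ZvalN oppr_lt0 Zval_pos. Qed.

Lemma Zpos_neq0 p : Zval (Zpos p) != 0.
Proof. by rewrite gt_eqF // Zval_pos. Qed.

Lemma QvalE a b : QArith_base.Qeq a b -> Qval a = Qval b.
Proof.
rewrite /QArith_base.Qeq => /(congr1 Zval); rewrite !ZvalM => E.
by apply/eqP; rewrite /Qval eqr_div ?Zpos_neq0 // E.
Qed.

Lemma Qval_red q : Qval (Qred q) = Qval q.
Proof. exact/QvalE/Qreduction.Qred_correct. Qed.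

Lemma Qeq_boolE a b : Qeqb a b = (Qval a == Qval b).
Proof.
apply/idP/eqP => [/QArith_base.Qeq_bool_iff/QvalE // | E].
apply/QArith_base.Qeq_bool_iff/Zval_inj; rewrite !ZvalM.
by apply/eqP; rewrite -eqr_div ?Zpos_neq0 //; apply/eqP.
Qed.

Lemma QvalD a b : Qval (Qadd a b) = Qval a + Qval b.
Proof.
rewrite Qval_red /Qval /= !(ZvalD, ZvalM) Pos2Z.inj_mul ZvalM addf_div ?Zpos_neq0 //.
Qed.

Lemma QvalM a b : Qval (Qmul a b) = Qval a * Qval b.
Proof. by rewrite Qval_red /Qval /= Pos2Z.inj_mul !ZvalM invfM mulrACA. Qed.

Lemma QvalN a : Qval (Qopp a) = - Qval a.
Proof. by rewrite /Qval ZvalN mulNr. Qed.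

Lemma QvalV a : Qval (Qinv a) = (Qval a)^-1.
Proof.
rewrite /Qval /Qinv; case: (Qnum a) => [|p|p] /=.
- by rewrite /Zval /= !mul0r invr0.
- by rewrite invf_div.
- by rewrite -[Zneg p]/(Z.opp (Zpos p)) -[Zneg (Qden a)]/(Z.opp (Zpos (Qden a))) !ZvalN
    !mulNr invrN invf_div.
Qed.

Lemma Qval0 : Qval Q0 = 0. Proof. by rewrite /Qval mul0r. Qed.

Lemma Qval1 : Qval Q1 = 1. Proof. by rewrite /Qval divff // Zpos_neq0. Qed.

Lemma QnegE q : Qneg q = (Qval q < 0).
Proof.
rewrite /Qneg /Qval pmulr_llt0 ?invr_gt0 ?Zval_pos //; case: (Qnum q) => [|p|p].
- by rewrite ltxx.
- by rewrite ltNge ltW // Zval_pos.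
- by rewrite Zval_neg.
Qed.

Lemma QzeroE q : Qzero q = (Qval q == 0).
Proof.
rewrite /Qval mulf_eq0 invr_eq0 (gt_eqF (Zval_pos _)) orbF Zval_eq0 /Qzero.
by case: (Qnum q).
Qed.

Lemma Qval_abs q : Qval (Qabs q) = `|Qval q|.
Proof. by rewrite /Qabs QnegE; case: ltrP => [/ltr0_norm|/ger0_norm] ->; rewrite ?QvalN. Qed.

End Values.

Local Open Scope nat_scope.

(* Unlike [all] and [has], whose [&&] and [||] are strict under call by value, these stop
   early. *)
Fixpoint lall (T : Type) (a : T -> bool) (s : seq T) : bool :=
  if s is x :: s' then if a x then lall a s' else false else true.

Fixpoint lhas (T : Type) (a : T -> bool) (s : seq T) : bool :=
  if s is x :: s' then if a x then true else lhas a s' else false.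

Lemma lallE (T : Type) (a : T -> bool) s : lall a s = all a s.
Proof. by elim: s => //= x s ->; case: (a x). Qed.

Lemma lhasE (T : Type) (a : T -> bool) s : lhas a s = has a s.
Proof. by elim: s => //= x s ->; case: (a x). Qed.

(** * Linear systems *)

Definition entry_at (r : seq Z) (v : nat) : Z := nth Z0 r v.

Fixpoint lin (a b : Z) (r s : seq Z) : seq Z :=
  match r, s with
  | [::], _ => map (Z.mul b) s
  | _, [::] => map (Z.mul a) r
  | x :: r', y :: s' => Z.add (Z.mul a x) (Z.mul b y) :: lin a b r' s'
  end.

(** Fraction-free elimination; dividing the multipliers by their gcd limits the growth of the
    entries. *)
Definition reduce (col : nat) (piv r : seq Z) : seq Z :=
  let a := entry_at piv col in let b := entry_at r col in
  if Z.eqb b Z0 then r else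
  let g := Z.gcd a b in lin (Z.div a g) (Z.opp (Z.div b g)) r piv.

Fixpoint gauss_jordan (cols : seq nat) (rows done : seq (seq Z)) : seq (seq Z) :=
  if cols is v :: cols' then
    let h := find (fun r => ~~ Z.eqb (entry_at r v) Z0) rows in
    if drop h rows is piv :: rest then
      gauss_jordan cols' (map (reduce v piv) (take h rows ++ rest))
        (piv :: map (reduce v piv) done)
    else gauss_jordan cols' rows done
  else done.

Definition lead (r : seq Z) : nat := find (fun z => ~~ Z.eqb z Z0) r.

(* A column without pivot, or a column past the last one if there is none. *)
Definition free_col (V : nat) (rows : seq (seq Z)) : nat :=
  let leads := map lead rows in
  let f := find (fun v => v \notin leads) (iota 0 V) in if f == V then V.+1 else f.

Definition Zfrac (a b : Z) : Q := Qmul (Qmake a xH) (Qinv (Qmake b xH)).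

(* The unknown [v] as [x.1 + x.2 * tau], where [tau] is the unknown of column [f] and the
   constants are in column [V]. *)
Definition affine (V f : nat) (rows : seq (seq Z)) (v : nat) : option (Q * Q) :=
  if f == V then None else if v == f then Some (Q0, Q1) else
  let r := nth [::] rows (find (fun r => lead r == v) rows) in
  if lall (fun w => if w == v then true else if w == f then true
                    else Z.eqb (entry_at r w) Z0) (iota 0 V)
  then if Z.eqb (entry_at r v) Z0 then None else
    Some (Zfrac (Z.opp (entry_at r V)) (entry_at r v), Zfrac (Z.opp (entry_at r f)) (entry_at r
      v))
  else None.

Fixpoint opt_map (T U : Type) (f : T -> option U) (s : seq T) : option (seq U) :=
  if s is x :: s' then
    if f x is Some y then if opt_map f s' is Some t then Some (y :: t) else None else None
  else Some [::].

Section LinearSoundness.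
Variable R : realFieldType.
Local Open Scope ring_scope.
Local Notation zv := (@Zval R).
Local Notation qv := (@Qval R).

Fixpoint dot (r : seq Z) (u : seq R) : R :=
  match r, u with x :: r', y :: u' => zv x * y + dot r' u' | _, _ => 0 end.

Lemma dot_scale a r u : dot (map (Z.mul a) r) u = zv a * dot r u.
Proof. by elim: r u => [|x r IH] [|y u] /=; rewrite ?mulr0 // IH ZvalM; ring. Qed.

Lemma dot_lin a b r s u : dot (lin a b r s) u = zv a * dot r u + zv b * dot s u.
Proof.
elim: r s u => [|x r IH] [|y s] [|z u] /=; rewrite ?mulr0 ?addr0 ?add0r //.
- by rewrite dot_scale ZvalM; ring.
- by rewrite dot_scale ZvalM; ring.
by rewrite IH ZvalD !ZvalM; ring.
Qed.

Lemma dotE r u : dot r u = \sum_(v < size u) zv (entry_at r v) * u`_v.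
Proof.
elim: r u => [|x r IH] [|y u] /=; rewrite ?big_ord0 //.
  by rewrite big1 // => v _; rewrite /entry_at nth_nil /Zval /= mul0r.
by rewrite big_ord_recl /= IH.
Qed.

Lemma dot_cat r r' u u' : size r = size u -> dot (r ++ r') (u ++ u') = dot r u + dot r' u'.
Proof.
elim: r u => [|x r IH] [|y u] //=; first by rewrite add0r.
by case=> /IH ->; rewrite addrA.
Qed.

Lemma dot_map (T : Type) (f : T -> Z) (g : T -> R) s :
  dot (map f s) (map g s) = \sum_(x <- s) zv (f x) * g x.
Proof. by elim: s => [|x s IH]; rewrite ?big_nil ?big_cons //= IH. Qed.

Lemma dot_nseq0 m u : dot (nseq m Z0) u = 0.
Proof. by elim: m u => [|m IH] [|y u] //=; rewrite IH /Zval mul0r addr0. Qed.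

Variable u : seq R.

Definition vanish (rows : seq (seq Z)) : Prop := forall r, r \in rows -> dot r u = 0.

Lemma vanish_reduce v piv rows : dot piv u = 0 -> vanish rows -> vanish (map (reduce v piv) rows).
Proof.
move=> piv0 H _ /mapP[r /H r0 ->]; rewrite /reduce; case: ifP => // _.
by rewrite dot_lin piv0 r0 !mulr0 addr0.
Qed.

Lemma vanish_gauss_jordan cols rows done :
  vanish rows -> vanish done -> vanish (gauss_jordan cols rows done).
Proof.
elim: cols rows done => [|v cols IH] rows done //= H1 H2.
set h := find _ _; case E: (drop h rows) => [|piv rest]; first exact: IH.
have piv0 : dot piv u = 0 by apply: H1; apply: (@mem_drop h); rewrite E inE eqxx.
apply: IH.
  apply: vanish_reduce => // r; rewrite mem_cat => /orP[/mem_take/H1 // | rr].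
  by apply: H1; apply: (@mem_drop h); rewrite E inE rr orbT.
move=> r; rewrite inE => /orP[/eqP -> // |]; exact: vanish_reduce.
Qed.

Lemma Zfrac_val a b : qv (Zfrac a b) = zv a / zv b.
Proof.
have one : zv (Zpos xH) = 1 by [].
by rewrite QvalM QvalV /Qval /= one !divr1.
Qed.

Lemma affineP V f rows v x : size u = V.+1 -> u`_V = 1 -> vanish rows -> (v < V)%N ->
  affine V f rows v = Some x -> u`_v = qv x.1 + qv x.2 * u`_f.
Proof.
move=> sz uV H vV; rewrite /affine; case: (altP (f =P V)) => // fV.
case: (altP (v =P f)) => [-> [<-]|vf] /=; first by rewrite Qval0 Qval1 add0r mul1r.
set r := nth _ _ _; rewrite lallE; case: allP => // Z0s; case: ifP => // rv0 [<-] /=.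
(* If no row has leading column [v], then [r] is the default empty row, on which [dot] is 0 as
   well. *)
have r0 : dot r u = 0.
  rewrite /r; set k := find _ _; have [kr|] := ltnP k (size rows).
    by apply: H; apply: mem_nth.
  by move=> kr; rewrite nth_default.
have rv : zv (entry_at r v) != 0 by rewrite Zval_eq0; apply/eqP => E; rewrite E in rv0.
move: r0; rewrite dotE sz (bigD1 (Ordinal (ltnSn V))) //= uV mulr1.
rewrite (bigD1 (Ordinal (ltnW vV : (v < V.+1)%N))) /=; last by rewrite -val_eqE /= ltn_eqF.
have -> : \sum_(i < V.+1 | (i != Ordinal (ltnSn V)) && (i != Ordinal (ltnW vV : (v < V.+1)%N)))
    zv (entry_at r i) * u`_i = zv (entry_at r f) * u`_f.
  (* A column past the end stands for the absence of a free unknown: there [u] takes its default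
     value 0. *)
  have [fV'|fV'] := ltnP f V.+1; last first.
    rewrite [u`_f]nth_default ?sz // mulr0 big1 // => i /andP[]; rewrite -!val_eqE /= => iV iv.
    have iltV : (i < V)%N by rewrite ltn_neqAle iV -ltnS ltn_ord.
    have := Z0s i; rewrite mem_iota /= iltV => /(_ isT); rewrite (negPf iv).
    rewrite ltn_eqF; last exact: leq_trans iltV (ltnW fV').
    by move/BinInt.Z.eqb_eq => ->; rewrite mul0r.
  rewrite (bigD1 (Ordinal fV')) /=; last by rewrite -!val_eqE /= fV eq_sym.
  rewrite big1 ?addr0 // => i /andP[/andP[]]; rewrite -!val_eqE /= => iV iv iF.
  have iltV : (i < V)%N by rewrite ltn_neqAle iV -ltnS ltn_ord.
  have := Z0s i; rewrite mem_iota /= iltV => /(_ isT); rewrite (negPf iv) (negPf iF).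
  by move/BinInt.Z.eqb_eq => ->; rewrite mul0r.
move=> E; rewrite !Zfrac_val !ZvalN; apply: (mulfI rv).
have D y : zv (entry_at r v) * (y / zv (entry_at r v)) = y by rewrite mulrC divfK.
by rewrite mulrDr [X in _ + X]mulrA !D; lra.
Qed.

Lemma opt_mapP (T U : Type) (f : T -> option U) s t : opt_map f s = Some t ->
  size t = size s /\ forall x0 y0 i, (i < size s)%N -> f (nth x0 s i) = Some (nth y0 t i).
Proof.
elim: s t => [|x s IH] t /=; first by case=> <-.
case Ex: (f x) => [y|] //; case Es: (opt_map f s) => [t'|] // [<-].
have [sz H] := IH _ Es; split=> [|x0 y0 [|i]] //=; first by rewrite sz.
exact: H.
Qed.

End LinearSoundness.

Local Open Scope nat_scope.

(* The value of [tau] for which [x_a x_b = x_c x_d], when the quadratic terms cancel. *)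
Definition pin (pq : seq (Q * Q)) (r : nat * nat * (nat * nat)) : option Q :=
  let: ((ia, ib), (ic, id)) := r in
  let v := nth (Q0, Q0) pq in
  let a := v ia in let b := v ib in let c := v ic in let d := v id in
  let c0 := Qadd (Qmul a.1 b.1) (Qopp (Qmul c.1 d.1)) in
  let c1 := Qadd (Qadd (Qmul a.1 b.2) (Qmul a.2 b.1))
                 (Qopp (Qadd (Qmul c.1 d.2) (Qmul c.2 d.1))) in
  if [&& all (fun i => i < size pq) [:: ia; ib; ic; id],
         Qeqb (Qmul a.2 b.2) (Qmul c.2 d.2) & ~~ Qzero c1]
  then Some (Qmul (Qopp c0) (Qinv c1)) else None.

Definition solve (V : nat) (rows : seq (seq Z)) (rels : seq (nat * nat * (nat * nat))) :
    option (seq Q) :=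
  let rows := gauss_jordan (iota 0 V) rows [::] in
  if opt_map (affine V (free_col V rows) rows) (iota 0 V) is Some pq then
    if lall (fun x => Qzero x.2) pq then Some (map fst pq)
    else if ohead (pmap (pin pq) rels) is Some tau then
      Some (map (fun x => Qadd x.1 (Qmul x.2 tau)) pq) else None
  else None.

Section SolveSoundness.
Variable R : realFieldType.
Local Open Scope ring_scope.
Local Notation qv := (@Qval R).

Lemma solveP V rows rels (u : seq R) w :
  size u = V.+1 -> u`_V = 1 -> vanish u rows ->
  (forall r, r \in rels -> u`_r.1.1 * u`_r.1.2 = u`_r.2.1 * u`_r.2.2) ->
  solve V rows rels = Some w ->
  size w = V /\ forall v, (v < V)%N -> u`_v = qv (nth Q0 w v).
Proof.
move=> sz uV H rel; rewrite /solve; set gj := gauss_jordan _ _ _; set f := free_col _ _.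
have Hgj : vanish u gj by apply: vanish_gauss_jordan.
case Epq: (opt_map _ _) => [pq|] //; have [szpq Hpq] := opt_mapP Epq.
rewrite size_iota in szpq.
have val v : (v < V)%N -> u`_v = qv (nth (Q0, Q0) pq v).1 + qv (nth (Q0, Q0) pq v).2 * u`_f.
  move=> vV; apply: (affineP sz uV Hgj vV).
  by have := Hpq 0%N (Q0, Q0) v; rewrite size_iota nth_iota // => /(_ vV).
rewrite lallE; case: (all_nthP (Q0, Q0)) => [Z2 [<-]|_].
  rewrite size_map szpq; split=> // v vV; rewrite (nth_map (Q0, Q0)) ?szpq // val //.
  have := Z2 v; rewrite szpq => /(_ vV).
  by rewrite (QzeroE R) => /eqP ->; rewrite mul0r addr0.
case Et: (ohead _) => [tau|] // [<-].
have [r /rel rr pinr] : exists2 r, r \in rels & pin pq r = Some tau.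
  elim: {rel} rels Et => [|r rels IH] //=; case Er: (pin pq r) => [t|] /=.
    by case=> <-; exists r; rewrite ?inE ?eqxx.
  by move/IH => [r' r'in E]; exists r'; rewrite ?inE ?r'in ?orbT.
have tauE : u`_f = qv tau.
  case: r rr pinr => [[ia ib] [ic id]] /= rr; case: ifP => // /and3P[/and5P[ha hb hc hd _]].
  rewrite (Qeq_boolE R) (QzeroE R) !(QvalD, QvalM, QvalN) => /eqP E2 nz [<-].
  rewrite szpq in ha hb hc hd; move: rr.
  rewrite (val _ ha) (val _ hb) (val _ hc) (val _ hd) QvalM QvalV !(QvalD, QvalM, QvalN).
  move: E2 nz; move: (qv (nth _ pq ia).1) (qv (nth _ pq ia).2) (qv (nth _ pq ib).1) (qv (nth _ pq
    ib).2).
  move: (qv (nth _ pq ic).1) (qv (nth _ pq ic).2) (qv (nth _ pq id).1) (qv (nth _ pq id).2).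
  move: (u`_f) => t c c' d d' a a' b b' E2 nz E.
  apply: (mulfI nz); rewrite mulrCA mulfV // mulr1.
  (* The relation is a polynomial of degree two in [t], whose leading coefficient is zero by the
     test in [pin]. *)
  have -> : (a * b' + a' * b - (c * d' + c' * d)) * t = - (a * b - c * d)
      + ((a + a' * t) * (b + b' * t) - (c + c' * t) * (d + d' * t))
      - (a' * b' - c' * d') * t ^+ 2 by ring.
  by rewrite E E2 !subrr mul0r subr0 addr0.
rewrite size_map szpq; split=> // v vV; rewrite (nth_map (Q0, Q0)) ?szpq // val //.
by rewrite QvalD QvalM tauE.
Qed.

End SolveSoundness.

Local Notation arrow := (nat * nat * nat)%type.

Definition Zbool (b : bool) : Z := if b then Zpos xH else Z0.

(** * Configurations of arrows and pairs *)

Definition weight (a : arrow) (l : nat) : Z :=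
  if l == a.2 then Zpos xH else if (l == a.1.1) || (l == a.1.2) then Zneg xH else Z0.

(** The vector [[1] - e_i + e_j]. Its pairing with [lam] vanishes by (N5), and it is also the
    coefficient of [A^i_j] in the equation for [X], once all terms are on one side. *)
Definition pair_weight (p : nat * nat) (l : nat) : Z :=
  if l == p.1 then Z0 else if l == p.2 then Zpos (xO xH) else Zpos xH.

(* The equations of (N5), of [lam \in ker M] and of the definition of a nondiagonal solution,
   for the unknowns [lam], [A] and [X / (2 tr D)] followed by the constant 1. *)
Definition system (n : nat) (arr : seq arrow) (prs : seq (nat * nat)) : seq (seq Z) :=
  let pad := nseq (size prs + size arr).+1 Z0 in
  [seq [seq pair_weight p l | l <- iota 0 n] ++ pad | p <- prs]
  ++ [seq [seq weight a l | l <- iota 0 n] ++ pad | a <- arr]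
  ++ [seq [seq Z.opp (Zbool (i == l)) | i <- iota 0 n] ++
          [seq pair_weight p l | p <- prs] ++ [seq weight a l | a <- arr] ++ [:: Zpos xH]
     | l <- iota 0 n].

(* The coefficient of [c_a] in the structure constant [c x y z]. *)
Definition arrow_coef (a : arrow) (x y z : nat) : Z :=
  if z == a.2 then
    if (x == a.1.1) && (y == a.1.2) then Zpos xH
    else if (x == a.1.2) && (y == a.1.1) then Zneg xH else Z0
  else Z0.

(** The coefficient of [c_a c_b] in the [e_l] component of the Jacobi identity for [e_x], [e_y],
    [e_z]. *)
Definition jacobi_coef (x y z l : nat) (a b : arrow) : Z :=
  let s x y z := Z.mul (arrow_coef a y z a.2) (arrow_coef b x a.2 l) in
  Z.add (s x y z) (Z.add (s y z x) (s z x y)).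

(** The coefficient of [c_a a_p] in the [e_l] component of the derivation identity for [e_x], [e_y],
    with all terms on one side. *)
Definition derivation_coef (x y l : nat) (a : arrow) (p : nat * nat) : Z :=
  Z.add (Z.mul (Zbool (p.2 == l)) (arrow_coef a x y p.1))
    (Z.opp (Z.add (Z.mul (Zbool (p.1 == x)) (arrow_coef a p.2 y l))
                  (Z.mul (Zbool (p.1 == y)) (arrow_coef a x p.2 l)))).

Definition nonzero_terms (S T : Type) (co : S -> T -> Z) (s : seq S) (t : seq T) :=
  [seq x <- [seq (a, b, co a b) | a <- s, b <- t] | ~~ Z.eqb x.2 Z0].

Local Open Scope nat_scope.

Definition upper_pairs (n : nat) : seq (nat * nat) := [seq (i, j) | j <- iota 0 n, i <- iota 0 j].

Definition upper_arrows (n : nat) : seq arrow :=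
  [seq (p, k) | p <- upper_pairs n, k <- iota p.2.+1 (n - p.2.+1)].

Definition off_pairs (n : nat) : seq (nat * nat) :=
  [seq (i, j) | i <- iota 0 n, j <- [seq j <- iota 0 n | i != j]].

Lemma mem_upper_pairs n i j : ((i, j) \in upper_pairs n) = (i < j < n).
Proof.
apply/allpairsPdep/idP => [[y [x [+ + [-> ->]]]] | /andP[ij jn]].
  by rewrite !mem_iota /= !add0n => -> ->.
by exists j, i; rewrite !mem_iota /= !add0n.
Qed.

Lemma mem_upper_arrows n i j k : ((i, j, k) \in upper_arrows n) = [&& i < j, j < k & k < n].
Proof.
apply/allpairsPdep/idP => [[[x y] [z [+ + [-> -> ->]]]] | /and3P[ij jk kn]].
  rewrite mem_upper_pairs mem_iota /= => /andP[-> yn] /andP[-> ].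
  by rewrite subnKC.
by exists (i, j), k; rewrite mem_upper_pairs mem_iota /= ij jk (ltn_trans jk kn) subnKC //
  (ltn_trans jk kn).
Qed.

Lemma mem_off_pairs n i j : ((i, j) \in off_pairs n) = [&& i != j, i < n & j < n].
Proof.
apply/allpairsPdep/idP => [[x [y [+ + [-> ->]]]] | /and3P[ij iN jn]].
  by rewrite mem_filter !mem_iota /= !add0n => -> /andP[-> ->].
by exists i, j; rewrite mem_filter !mem_iota /= !add0n ij iN jn.
Qed.

Lemma upper_pairs_uniq n : uniq (upper_pairs n).
Proof.
apply: allpairs_uniq_dep => [|j _|]; rewrite ?iota_uniq //.
by move=> [j i] [j' i'] _ _ /= [-> ->].
Qed.

Lemma upper_arrows_uniq n : uniq (upper_arrows n).
Proof.
apply: allpairs_uniq_dep => [|p _|]; rewrite ?iota_uniq ?upper_pairs_uniq //.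
by move=> [[i j] k] [[i' j'] k'] _ _ /= [-> -> ->].
Qed.

Lemma off_pairs_uniq n : uniq (off_pairs n).
Proof.
apply: allpairs_uniq_dep => [|p _|]; rewrite ?filter_uniq ?iota_uniq //.
by move=> [i j] [i' j'] _ _ /= [-> ->].
Qed.

(** A component of the Jacobi identity with a single monomial cannot vanish, since the structure
    constants of arrows are nonzero. *)
Definition jacobi_fails (arr : seq arrow) : bool :=
  lhas (fun a => lhas (fun b : arrow =>
    lhas (fun x => size (nonzero_terms (jacobi_coef x a.1.1 a.1.2 b.2) arr arr) == 1)
      [:: b.1.1; b.1.2]) arr) arr.

Definition term_list : Type := seq (arrow * (nat * nat) * Z).

(* The components of [D [e_x, e_y] = [D e_x, e_y] + [e_x, D e_y]] to which the arrow [a] and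
   the pair [p] contribute. *)
Definition derivation_keys (a : arrow) (p : nat * nat) : seq arrow :=
  (if p.1 == a.2 then [:: (a.1.1, a.1.2, p.2)] else [::])
  ++ (if p.2 == a.1.1 then [:: (p.1, a.1.2, a.2)] else [::])
  ++ (if p.2 == a.1.2 then [:: (a.1.1, p.1, a.2)] else [::]).

Definition derivation_relations (arr : seq arrow) (prs : seq (nat * nat)) : seq term_list :=
  [seq nonzero_terms (derivation_coef k.1.1 k.1.2 k.2) arr prs |
     k <- flatten [seq derivation_keys a p | a <- arr, p <- prs]].

Fixpoint bitseqs (n : nat) : seq bitseq :=
  if n is n'.+1 then map (cons true) (bitseqs n') ++ map (cons false) (bitseqs n') else [:: [::]].

Definition bit (s : bitseq) (i : nat) : bool := nth false s i.
(** This plays two roles: the sign of [eps_i eps_j eps_k], and the sign that [c_a] acquires when the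
    basis vectors marked in [s] are negated. The same holds for [pair_bit]. *)
Definition arrow_bit (s : bitseq) (a : arrow) : bool := bit s a.1.1 (+) bit s a.1.2 (+) bit s a.2.
Definition pair_bit (s : bitseq) (p : nat * nat) : bool := bit s p.1 (+) bit s p.2.

Definition pair_col (n : nat) (prs : seq (nat * nat)) p := n + index p prs.
Definition arrow_col (n : nat) (arr : seq arrow) (prs : seq (nat * nat)) a :=
  n + size prs + index a arr.

(* A relation [x c_a a_p + y c_b a_q = 0] with [x ^ 2 = y ^ 2] gives
   [A_p X_a = A_q X_b], the signs of [eps] being the same on both sides. *)
Definition product_relation (n : nat) (arr : seq arrow) (prs : seq (nat * nat))
    (r : term_list) : option (nat * nat * (nat * nat)) :=
  if r is [:: (a, p, x); (b, q, y)] then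
    if Z.eqb (Z.mul x x) (Z.mul y y)
       && lall (fun s => arrow_bit s a (+) pair_bit s p == arrow_bit s b (+) pair_bit s q)
         (bitseqs n)
    then Some ((arrow_col n arr prs a, pair_col n prs p), (arrow_col n arr prs b, pair_col n prs
      q))
    else None
  else None.

(** The two terms of a relation [x c_a a_p + y c_b a_q = 0] must have opposite signs. *)
Definition excluded_signs (arr : seq arrow) (prs : seq (nat * nat)) (sc st : bitseq)
    (r : term_list) : bool :=
  if r is [:: (a, p, x); (b, q, y)] then
    Z.ltb x Z0 (+) bit sc (index a arr) (+) bit st (index p prs)
    == Z.ltb y Z0 (+) bit sc (index b arr) (+) bit st (index q prs)
  else false.

(** A line read over the rationals: the diagonal is kept as it is, whereas the coefficients of forms
    and tensors are replaced by their signed squares. *)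
Record qline := Qline {
  ql_dim : nat;
  ql_forms : seq (seq (Q * nat * nat));
  ql_diag : seq Q;
  ql_tensors : seq (Q * nat * nat);
  ql_signs : seq (seq nat)
}.

Definition empty_qline : qline := Qline 0 [::] [::] [::] [::].

Fixpoint lookup (s : seq (Q * nat * nat)) (i j : nat) : Q :=
  if s is t :: s' then
    if (i.+1 == t.1.2) && (j.+1 == t.2) then t.1.1 else lookup s' i j
  else Q0.

(** A term [a e^{ij}] of [d e^k] is the structure constant [- a], because of the sign in [d alpha(x,
    y) = - alpha([x, y])]. *)
Definition lookup_form (s : seq (Q * nat * nat)) (i j : nat) : Q :=
  if i < j then Qopp (lookup s i j) else if j < i then lookup s j i else Q0.

Definition forms_at (l : qline) (i j k : nat) : Q := lookup_form (nth [::] (ql_forms l) k) i j.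
Definition tensors_at (l : qline) (i j : nat) : Q := lookup (ql_tensors l) i j.

(* The injective maps [{0, ..., n - 1} -> {0, ..., n - 1}] with [ok i j] whenever i |-> j,
   as the lists of their values. *)
Fixpoint placements (n : nat) (ok : nat -> nat -> bool) (m : nat) (p : seq nat) : seq (seq nat) :=
  if m is m'.+1 then
    flatten [seq placements n ok m' (rcons p j) |
               j <- iota 0 n & if j \in p then false else ok (size p) j]
  else [:: p].

Definition place (p : seq nat) (i : nat) : nat := nth 0 p i.
Definition arrow_at (l : qline) (p : seq nat) (a : arrow) : Q :=
  forms_at l (place p a.1.1) (place p a.1.2) (place p a.2).
Definition pair_at (l : qline) (p : seq nat) (q : nat * nat) : Q :=
  tensors_at l (place p q.1) (place p q.2).

Definition support_matches (n : nat) (arr : seq arrow) (prs : seq (nat * nat)) (l : qline)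
    (p : seq nat) : bool :=
  if lall (fun ij => lall (fun k => ~~ Qzero (arrow_at l p (ij, k)) == ((ij, k) \in arr)) (iota 0
    n))
       (upper_pairs n)
  then lall (fun i => lall (fun j => ~~ Qzero (pair_at l p (i, j)) == ((i, j) \in prs)) (iota 0
    n))
         (iota 0 n)
  else false.

Definition squares_match (arr : seq arrow) (prs : seq (nat * nat)) (x b : seq Q) (l : qline)
    (p : seq nat) : bool :=
  if lall (fun a => Qeqb (Qabs (nth Q0 x (index a arr))) (Qabs (arrow_at l p a))) arr
  then lall (fun q => Qeqb (Qabs (nth Q0 b (index q prs))) (Qabs (pair_at l p q))) prs else false.

Definition candidates (tbl : seq qline) (n : nat) arr prs (lam x b : seq Q) : seq (nat * seq nat)
  :=
  [seq (k, p) |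
     k <- [seq k <- iota 0 (size tbl) | let l := nth empty_qline tbl k in
             (ql_dim l == n) && (size (ql_tensors l) == size prs)],
     p <- let l := nth empty_qline tbl k in
          [seq p <- placements n (fun i j => Qeqb (nth Q0 lam i) (nth Q0 (ql_diag l) j)) n [::] |
             if support_matches n arr prs l p then squares_match arr prs x b l p else false]].

(* The signs of the [c_a] and of the [a_p] of the images of the line [l] under [p] and the
   sign changes of the basis. *)
Definition sign_images (n : nat) arr prs (l : qline) (p : seq nat) : seq (bitseq * bitseq) :=
  let cs := [seq (Qneg (arrow_at l p a), a) | a <- arr] in
  let ts := [seq (Qneg (pair_at l p q), q) | q <- prs] in
  [seq ([seq z.1 (+) arrow_bit s z.2 | z <- cs], [seq z.1 (+) pair_bit s z.2 | z <- ts]) |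
     s <- bitseqs n].

(** The value [true] means that no solution has these arrows and pairs, or that each possible choice
    of signs of the [c_a], of the [a_p] and of [eps] is realised by some entry of the list. The
    possible [eps] are those compatible with the signs of [x] and [b], which are
    [eps_i eps_j eps_k c_a ^ 2] and [eps_i eps_j a_p ^ 2]. *)
Definition check_config (tbl : seq qline) (n : nat) arr prs : bool :=
  if size prs == 0 then true else
  if jacobi_fails arr then true else
  let rels := derivation_relations arr prs in
  if lhas (fun r => size r == 1) rels then true else
  if solve (n + size prs + size arr) (system n arr prs) (pmap (product_relation n arr prs) rels)
    is Some w then
    let lam := take n w in
    let t := foldr Qadd Q0 lam in
    let b := [seq Qmul (Qadd t t) q | q <- take (size prs) (drop n w)] in
    let x := [seq Qmul (Qadd t t) q | q <- drop (n + size prs) w] in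
    if Qzero t then true else if lhas Qzero b then true else if lhas Qzero x then true else
    let cands := [seq (kp, sign_images n arr prs (nth empty_qline tbl kp.1) kp.2) |
                    kp <- candidates tbl n arr prs lam x b] in
    let epss := [seq s <- bitseqs n | if [seq arrow_bit s a | a <- arr] == map Qneg x then
                                        [seq pair_bit s p | p <- prs] == map Qneg b else false] in
    lall (fun sc => lall (fun st =>
      if lhas (excluded_signs arr prs sc st) rels then true else
      let good := [seq kp.1 | kp <- cands & (sc, st) \in kp.2] in
      lall (fun s => lhas (fun kp : nat * seq nat =>
          lhas (fun S => [seq (place kp.2 i).+1 \in S | i <- iota 0 n] == s)
            (ql_signs (nth empty_qline tbl kp.1))) good) epss)
      (bitseqs (size prs))) (bitseqs (size arr))
  else false.

(** By niceness each pair of nodes has at most one target, and two arrows with the same target share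
    no source; the other choices are pruned. *)
Fixpoint all_arrows (n : nat) (ps : seq (nat * nat)) (acc : seq arrow) (P : seq arrow -> bool) :
  bool :=
  if ps is ij :: ps' then
    if all_arrows n ps' acc P then
      lall (fun k =>
        if lhas (fun a : arrow => if a.2 == k then
             if a.1.1 \in [:: ij.1; ij.2] then true else a.1.2 \in [:: ij.1; ij.2] else false) acc
        then true else all_arrows n ps' (rcons acc (ij, k)) P) (iota ij.2.+1 (n - ij.2.+1))
    else false
  else P acc.

(** The pruned choices violate (N2). *)
Fixpoint all_pairs (ps acc : seq (nat * nat)) (P : seq (nat * nat) -> bool) : bool :=
  if ps is ij :: ps' then
    if all_pairs ps' acc P then
      if lhas (fun q : nat * nat =>
           if q.1 \in [:: ij.1; ij.2] then true else q.2 \in [:: ij.1; ij.2]) acc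
      then true else all_pairs ps' (rcons acc ij) P
    else false
  else P acc.

(** Condition (N3), where either source of an arrow can serve as its starting node. *)
Definition compatible (arr : seq arrow) (q : nat * nat) : bool :=
  lall (fun a : arrow => if a.2 == q.2 then (a.1.1 != q.1) && (a.1.2 != q.1) else true) arr.

Definition check_dim (tbl : seq qline) (n : nat) : bool :=
  all_arrows n (upper_pairs n) [::] (fun arr =>
    all_pairs [seq q <- off_pairs n | compatible arr q] [::] (check_config tbl n arr)).

Definition placement (n : nat) (ok : nat -> nat -> bool) (p : seq nat) : bool :=
  [&& uniq p, all (fun j => j < n) p & all (fun i => ok i (place p i)) (iota 0 (size p))].

Lemma placement_rcons n ok p j : placement n ok (rcons p j) =
  [&& placement n ok p, j < n, j \notin p & ok (size p) j].
Proof.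
rewrite /placement rcons_uniq all_rcons size_rcons -[(size p).+1]addn1 iotaD all_cat /= andbT.
rewrite /place nth_rcons ltnn eqxx add0n.
have -> : all (fun i => ok i (nth 0 (rcons p j) i)) (iota 0 (size p)) =
          all (fun i => ok i (nth 0 p i)) (iota 0 (size p)).
  by apply: eq_in_all => i; rewrite mem_iota nth_rcons => /andP[_ ->].
by case: (uniq p); case: (j \in p); case: (j < n); case: (ok _ j); case: (all _ p);
  rewrite ?andbT ?andbF.
Qed.

Lemma placementsP n ok m p q : placement n ok p ->
  (q \in placements n ok m p) =
  [&& size q == size p + m, take (size p) q == p & placement n ok q].
Proof.
elim: m p => [|m IH] p okp /=.
  rewrite inE addn0; apply/eqP/and3P => [->|[/eqP sq /eqP <- _]].
    by rewrite take_size !eqxx.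
  by rewrite -sq take_size.
apply/flatten_mapP/and3P => [[j]|[/eqP sq /eqP tq okq]].
  rewrite mem_filter mem_iota add0n /= => /andP[okj jn] qin.
  have okpj : placement n ok (rcons p j).
    by rewrite placement_rcons okp jn; move: okj; case: (j \in p).
  move: qin; rewrite (IH _ okpj) size_rcons addSnnS => /and3P[-> /eqP tq okq].
  split=> //; rewrite -(take_takel q (leqnSn (size p))) tq -cats1.
  by rewrite take_size_cat.
have szp : size p < size q by rewrite sq -[X in X < _]addn0 ltn_add2l.
have tq' : take (size p).+1 q = rcons p (nth 0 q (size p)) by rewrite (take_nth 0) // tq.
have okpj : placement n ok (rcons p (nth 0 q (size p))).
  case/and3P: okq => uq bq oq; rewrite -tq' /placement take_uniq //=.
  apply/andP; split; first by apply/allP => j /mem_take/(allP bq).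
  apply/allP => i; rewrite mem_iota size_takel // => /andP[_ ilt].
  by rewrite /place nth_take //; apply: (allP oq); rewrite mem_iota (leq_trans ilt szp).
exists (nth 0 q (size p)).
  move: okpj; rewrite placement_rcons => /and4P[_ jn jp okj].
  by rewrite mem_filter mem_iota jn (negPf jp) okj.
by rewrite (IH _ okpj) size_rcons sq addSnnS eqxx tq' eqxx.
Qed.

(** * Soundness of the enumeration *)

Section Sorted.
Local Open Scope ring_scope.
Variables (R : realType) (n : nat).
Local Notation I := 'I_n.+1.
Variables (c : structure_constants R n.+1) (lam : I -> R) (N : I -> I -> R) (e : I -> R).
Hypothesis sol : nice_soliton c lam N e.
Hypothesis sorted_c : forall i j k, c i j k != 0 -> (j < k)%N.
Local Notation zv := (@Zval R).
Local Notation qv := (@Qval R).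

(** The computation handles nodes as natural numbers; [inord] turns them back into ordinals, which
    is why the dimension is written [n.+1]. *)
Definition arrow_val (a : arrow) : R := c (inord a.1.1) (inord a.1.2) (inord a.2).
Definition pair_val (p : nat * nat) : R := N (inord p.1) (inord p.2).
Definition arrows : seq arrow := [seq a <- upper_arrows n.+1 | arrow_val a != 0].
Definition pairs : seq (nat * nat) := [seq p <- off_pairs n.+1 | pair_val p != 0].

Lemma mem_arrows (i j k : I) :
  ((i : nat, j : nat, k : nat) \in arrows) = (i < j)%N && (c i j k != 0).
Proof.
rewrite mem_filter mem_upper_arrows /arrow_val /= !inord_val ltn_ord andbT andbC.
by case: ltnP => //= _; have [|/sorted_c ->] := eqVneq (c i j k) 0%R; rewrite ?andbF.
Qed.

Lemma mem_pairs (i j : I) : ((i : nat, j : nat) \in pairs) = (N i j != 0).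
Proof.
rewrite mem_filter mem_off_pairs /pair_val /= !inord_val !ltn_ord !andbT.
have [ij|] := eqVneq i j; last by rewrite -val_eqE /= => ->; rewrite andbT.
by rewrite ij (ns_diag sol) eqxx.
Qed.

Lemma arrowsP a : a \in arrows -> exists i j k : I,
  [/\ a = (i : nat, j : nat, k : nat), (i < j)%N, c i j k != 0 & arrow_val a = c i j k].
Proof.
case: a => [[i j] k]; rewrite mem_filter mem_upper_arrows /arrow_val /= => /andP[nz /and3P[ij jk
  kn]].
exists (inord i), (inord j), (inord k); have jn := ltn_trans jk kn.
by rewrite !inordK // (ltn_trans ij).
Qed.

Lemma pairsP p : p \in pairs -> exists i j : I,
  [/\ p = (i : nat, j : nat), N i j != 0 & pair_val p = N i j].
Proof.
case: p => [i j]; rewrite mem_filter mem_off_pairs /pair_val /= => /andP[nz /and3P[_ iN jn]].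
by exists (inord i), (inord j); rewrite !inordK.
Qed.

Lemma arrows_uniq : uniq arrows. Proof. by rewrite filter_uniq // upper_arrows_uniq. Qed.

Lemma pairs_uniq : uniq pairs. Proof. by rewrite filter_uniq // off_pairs_uniq. Qed.

Lemma sum_over_arrows (f : arrow -> R) : \sum_(a <- arrows) f a =
  \sum_(t : I * I * I | (t.1.1 < t.1.2)%N && (c t.1.1 t.1.2 t.2 != 0))
     f (t.1.1 : nat, t.1.2 : nat, t.2 : nat).
Proof.
pose v (t : I * I * I) : arrow := (t.1.1 : nat, t.1.2 : nat, t.2 : nat).
have inj_v : injective v by move=> [[i j] k] [[i' j'] k'] [/ord_inj-> /ord_inj-> /ord_inj->].
rewrite -[RHS]big_filter -[RHS](big_map v xpredT f).
apply: perm_big; apply: uniq_perm; rewrite ?arrows_uniq ?(map_inj_uniq inj_v) ?filter_uniq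
  ?index_enum_uniq //.
move=> a; apply/idP/mapP => [/arrowsP[i [j [k [-> ij nz _]]]] | [[[i j] k]]].
  by exists (i, j, k); rewrite // mem_filter mem_index_enum andbT /= ij nz.
by rewrite mem_filter /= => /andP[H _] ->; rewrite /v mem_arrows.
Qed.

Lemma sum_over_pairs (f : nat * nat -> R) : \sum_(p <- pairs) f p =
  \sum_(t : I * I | N t.1 t.2 != 0) f (t.1 : nat, t.2 : nat).
Proof.
pose v (t : I * I) : nat * nat := (t.1 : nat, t.2 : nat).
have inj_v : injective v by move=> [i j] [i' j'] [/ord_inj-> /ord_inj->].
rewrite -[RHS]big_filter -[RHS](big_map v xpredT f).
apply: perm_big; apply: uniq_perm; rewrite ?pairs_uniq ?(map_inj_uniq inj_v) ?filter_uniq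
  ?index_enum_uniq //.
move=> a; apply/idP/mapP => [/pairsP[i [j [-> nz _]]] | [[i j]]].
  by exists (i, j); rewrite // mem_filter mem_index_enum andbT /= nz.
by rewrite mem_filter /= => /andP[H _] ->; rewrite /v mem_pairs.
Qed.

Lemma ZboolE b : zv (Zbool b) = b%:R.
Proof. by case: b. Qed.

Lemma sum_supp (T : finType) (P : pred T) (F : T -> R) :
  (forall t, ~~ P t -> F t = 0) -> \sum_(t | P t) F t = \sum_t F t.
Proof.
move=> H; rewrite [LHS]big_mkcond; apply: eq_bigr => t _.
by case: ifP => // /negbT/H.
Qed.

Lemma pairs_sum_row (x : I) (f : nat -> R) :
  \sum_m N x m * f m = \sum_(p <- pairs) zv (Zbool (p.1 == x)) * pair_val p * f p.2.
Proof.
rewrite sum_over_pairs [RHS]sum_supp => [|[i j] /=]; last first.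
  by rewrite negbK /pair_val /= !inord_val => /eqP ->; rewrite mulr0 mul0r.
rewrite -(pair_big xpredT xpredT (fun i j : I =>
  zv (Zbool (i == x :> nat)) * pair_val (i : nat, j : nat) * f j)) /=.
rewrite [RHS](eq_bigr (fun i => (i == x)%:R * \sum_m N i m * f m)) ?sum_delta // => i _.
rewrite mulr_sumr; apply: eq_bigr => j _.
by rewrite ZboolE /pair_val /= !inord_val mulrA.
Qed.

Lemma pairs_sum_col (l : I) (f : nat -> R) :
  \sum_(m : I) f m * N m l = \sum_(p <- pairs) zv (Zbool (p.2 == l)) * pair_val p * f p.1.
Proof.
rewrite sum_over_pairs [RHS]sum_supp => [|[i j] /=]; last first.
  by rewrite negbK /pair_val /= !inord_val => /eqP ->; rewrite mulr0 mul0r.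
rewrite -(pair_big xpredT xpredT (fun i j : I =>
  zv (Zbool (j == l :> nat)) * pair_val (i : nat, j : nat) * f i)) /=.
apply: eq_bigr => i _.
rewrite (eq_bigr (fun j => (j == l)%:R * (N i j * f i))) ?sum_delta ?(mulrC (f i)) // => j _.
by rewrite ZboolE /pair_val /= !inord_val mulrA.
Qed.

Lemma arrow_coefE (i j k x y z : I) : i != j -> zv (arrow_coef (i : nat, j : nat, k : nat) x y z)
  =
  (k == z)%:R * ((i == x)%:R * (j == y)%:R - (i == y)%:R * (j == x)%:R).
Proof.
move=> ij; rewrite /arrow_coef /= !(inj_eq val_inj) (eq_sym z) (eq_sym x i) (eq_sym y j) (eq_sym
  x j) (eq_sym y i).
have m1 : zv (Zneg xH) = -1 by [].
have nb : ~~ ((i == x) && (j == x)) by apply: contraNN ij => /andP[/eqP-> /eqP->].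
case: (k == z); rewrite ?mul0r // mul1r; move: nb.
by case: (i == x); case: (j == y); case: (i == y); case: (j == x) => //= _;
  rewrite ?m1 ?mulr1 ?mulr0 ?subr0 ?sub0r.
Qed.

(** This leads from sums over nodes to the lists on which the computation runs. For [x < y] only the
    arrow [(x, y, z)] can contribute; the other order follows by antisymmetry. *)
Lemma arrow_sum (x y z : I) : c x y z = \sum_(a <- arrows) zv (arrow_coef a x y z) * arrow_val a.
Proof.
rewrite sum_over_arrows (eq_bigr (fun t : I * I * I => zv (arrow_coef (t.1.1 : nat, t.1.2 : nat,
  t.2 : nat) x y z) * c t.1.1 t.1.2 t.2)); last first.
  by move=> t _; rewrite /arrow_val !inord_val.
have [xy|nxy] := eqVneq x y.
  rewrite -xy big1 => [|[[i j] k] /= /andP[ij _]].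
    by have /eqP := ns_anti sol x x z; rewrite -addr_eq0 -mulr2n mulrn_eq0 => /eqP.
  rewrite arrow_coefE; last by rewrite -val_eqE /= ltn_eqF.
  by rewrite mulrC subrr !mulr0.
wlog xltx : x y nxy / (x < y)%N.
  move=> H; have [xy|yx] := ltnP x y; first exact: H.
  have yx' : (y < x)%N by rewrite ltn_neqAle yx andbT eq_sym.
  rewrite (ns_anti sol y x) (H y x) 1?eq_sym // -sumrN;
    apply: eq_bigr => -[[i j] k] /= /andP[ij _].
  have nij : i != j by rewrite -val_eqE /= ltn_eqF.
  by rewrite !arrow_coefE //; ring.
have E (i j k : I) : (i < j)%N -> zv (arrow_coef (i : nat, j : nat, k : nat) x y z) = ((i, j, k)
  == (x, y, z))%:R.
  move=> ij; have nij : i != j by rewrite -val_eqE /= ltn_eqF.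
  rewrite arrow_coefE // !xpair_eqE.
  case: (i =P y) => [iy|_]; last by case: (k == z); case: (i == x); case: (j == y);
    rewrite ?mul1r ?mul0r ?mulr0 ?subr0.
  have -> : (j == x) = false by rewrite -val_eqE /=; apply/gtn_eqF;
    rewrite (ltn_trans xltx) // -iy.
  by case: (k == z); case: (i == x); case: (j == y); rewrite ?mul1r ?mul0r ?mulr0 ?subr0.
rewrite (eq_bigr (fun t : I * I * I => (t == (x, y, z))%:R * c t.1.1 t.1.2 t.2)) => [|[[i j] k]
  /andP[ij _]]; last by rewrite E.
rewrite sum_supp ?sum_delta // => -[[i j] k] /=; rewrite negb_and negbK.
have [[-> -> ->]|_] := eqVneq (i, j, k) (x, y, z); last by rewrite mul0r.
by rewrite xltx /= => /eqP ->; rewrite mulr0.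
Qed.

Lemma arrows_sum_target (x y : I) (f : nat -> R) :
  \sum_m c x y m * f m = \sum_(a <- arrows) zv (arrow_coef a x y a.2) * arrow_val a * f a.2.
Proof.
rewrite (eq_bigr (fun m : I => \sum_(a <- arrows) (zv (arrow_coef a x y m) * arrow_val a * f m))).
  rewrite exchange_big /=; apply: eq_big_seq => a /arrowsP[i [j [k [-> ij nz _]]]] /=.
  have nij : i != j by rewrite -val_eqE /= ltn_eqF.
  rewrite (bigD1 k) //= big1 ?addr0 // => m mk.
  by rewrite arrow_coefE // eq_sym (negPf mk) !mul0r.
by move=> m _; rewrite arrow_sum mulr_suml.
Qed.

Lemma nonzero_terms_sum (S T : eqType) (co : S -> T -> Z) s t (f : S -> R) (g : T -> R) :
  \sum_(x <- nonzero_terms co s t) zv x.2 * f x.1.1 * g x.1.2 =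
  \sum_(a <- s) \sum_(b <- t) zv (co a b) * f a * g b.
Proof.
rewrite big_filter big_mkcond big_allpairs_dep /=; apply: eq_bigr => a _; apply: eq_bigr => b _.
by case: BinInt.Z.eqb_spec => //= ->; rewrite !mul0r.
Qed.

Lemma nonzero_termsP (S T : eqType) (co : S -> T -> Z) s t x :
  x \in nonzero_terms co s t -> [/\ x.1.1 \in s, x.1.2 \in t & zv x.2 != 0].
Proof.
rewrite mem_filter => /andP[nz /allpairsP[[a b] [/= ain bin E]]]; rewrite E /= in nz *.
by split=> //; rewrite Zval_eq0; apply/eqP => z; rewrite z in nz.
Qed.

Lemma derivation_sum (x y l : I) :
  \sum_(t <- nonzero_terms (derivation_coef x y l) arrows pairs)
     zv t.2 * arrow_val t.1.1 * pair_val t.1.2 = 0.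
Proof.
rewrite nonzero_terms_sum.
have D1 : \sum_m c x y m * N m l = \sum_(a <- arrows) \sum_(p <- pairs)
    zv (Z.mul (Zbool (p.2 == l)) (arrow_coef a x y p.1)) * arrow_val a * pair_val p.
  rewrite (eq_bigr (fun m : I => c x y (inord m) * N m l)) => [|m _]; last by rewrite inord_val.
  rewrite (pairs_sum_col l (fun m => c x y (inord m))) exchange_big; apply: eq_big_seq.
  move=> p /pairsP[i [j [-> _ _]]]; rewrite inord_val arrow_sum mulr_sumr /=.
  by apply: eq_bigr => a _; rewrite ZvalM; ring.
have D2 : \sum_m N x m * c m y l = \sum_(a <- arrows) \sum_(p <- pairs)
    zv (Z.mul (Zbool (p.1 == x)) (arrow_coef a p.2 y l)) * arrow_val a * pair_val p.
  rewrite (eq_bigr (fun m : I => N x m * c (inord m) y l)) => [|m _]; last by rewrite inord_val.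
  rewrite (pairs_sum_row x (fun m => c (inord m) y l)) exchange_big; apply: eq_big_seq.
  move=> p /pairsP[i [j [-> _ _]]]; rewrite inord_val arrow_sum mulr_sumr /=.
  by apply: eq_bigr => a _; rewrite ZvalM; ring.
have D3 : \sum_m N y m * c x m l = \sum_(a <- arrows) \sum_(p <- pairs)
    zv (Z.mul (Zbool (p.1 == y)) (arrow_coef a x p.2 l)) * arrow_val a * pair_val p.
  rewrite (eq_bigr (fun m : I => N y m * c x (inord m) l)) => [|m _]; last by rewrite inord_val.
  rewrite (pairs_sum_row y (fun m => c x (inord m) l)) exchange_big; apply: eq_big_seq.
  move=> p /pairsP[i [j [-> _ _]]]; rewrite inord_val arrow_sum mulr_sumr /=.
  by apply: eq_bigr => a _; rewrite ZvalM; ring.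
have := ns_derivation sol x y l; rewrite D1 D2 D3 => /eqP; rewrite -subr_eq0 => /eqP E.
rewrite -[RHS]E -big_split -sumrB; apply: eq_bigr => a _ /=.
rewrite -big_split -sumrB; apply: eq_bigr => p _ /=.
by rewrite /derivation_coef ZvalD ZvalN ZvalD; ring.
Qed.

Lemma jacobi_sum (x y z l : I) :
  \sum_(t <- nonzero_terms (jacobi_coef x y z l) arrows arrows)
     zv t.2 * arrow_val t.1.1 * arrow_val t.1.2 = 0.
Proof.
have J (u v w : I) : \sum_m c v w m * c u m l = \sum_(a <- arrows) \sum_(b <- arrows)
    zv (Z.mul (arrow_coef a v w a.2) (arrow_coef b u a.2 l)) * arrow_val a * arrow_val b.
  rewrite (eq_bigr (fun m : I => c v w m * c u (inord m) l)) => [|m _]; last by rewrite inord_val.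
  rewrite (arrows_sum_target v w (fun m => c u (inord m) l)); apply: eq_big_seq.
  move=> a /arrowsP[i [j [k [-> _ _ _]]]]; rewrite inord_val arrow_sum mulr_sumr /=.
  by apply: eq_bigr => b _; rewrite ZvalM; ring.
rewrite nonzero_terms_sum; have := ns_jacobi sol x y z l; rewrite 2!big_split /= !J => E.
rewrite -[RHS]E -!big_split; apply: eq_bigr => a _ /=.
rewrite -!big_split; apply: eq_bigr => b _ /=.
by rewrite /jacobi_coef !ZvalD; ring.
Qed.

Lemma arrow_val_neq0 a : a \in arrows -> arrow_val a != 0.
Proof. by rewrite mem_filter => /andP[]. Qed.

Lemma pair_val_neq0 p : p \in pairs -> pair_val p != 0.
Proof. by rewrite mem_filter => /andP[]. Qed.

Lemma jacobi_holds : ~~ jacobi_fails arrows.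
Proof.
rewrite /jacobi_fails lhasE; apply/hasPn => a ain; rewrite lhasE; apply/hasPn => b bin.
rewrite lhasE; have [i [j [k [-> _ _ _]]]] := arrowsP ain.
have [i' [j' [k' [-> _ _ _]]]] := arrowsP bin.
apply/hasPn => x xin; have [x' -> {xin}] : exists x' : I, x = x'.
  by move: xin; rewrite !inE => /orP[/eqP-> | /eqP->]; [exists i' | exists j'].
apply/negP => /= s1; have := jacobi_sum x' i j k'.
case: (nonzero_terms _ _ _) s1 (@nonzero_termsP _ _ (jacobi_coef x' i j k') arrows arrows)
  => [|t [|t' s]] // _ H.
rewrite big_seq1; have [tin tin' tnz] := H t (mem_head _ _) => /eqP.
by rewrite !mulf_eq0 (negPf tnz) (negPf (arrow_val_neq0 tin)) (negPf (arrow_val_neq0 tin')).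
Qed.

Lemma derivation_relationsP r : r \in derivation_relations arrows pairs ->
  \sum_(t <- r) zv t.2 * arrow_val t.1.1 * pair_val t.1.2 = 0 /\
  forall t, t \in r -> [/\ t.1.1 \in arrows, t.1.2 \in pairs & zv t.2 != 0].
Proof.
case/mapP => k /flattenP[_ /allpairsP[[a p] [/= ain pin ->]] kin] ->.
split=> [|t]; last exact: nonzero_termsP.
have [i [j [z [Ea _ _ _]]]] := arrowsP ain; have [i' [j' [Ep _ _]]] := pairsP pin.
have [x [y [l ->]]] : exists x y l : I, k = (x : nat, y : nat, l : nat);
  last exact: derivation_sum.
move: kin; rewrite Ea Ep /derivation_keys /= !mem_cat.
case/or3P; case: ifP => // _; rewrite inE => /eqP ->.
- by exists i, j, j'.
- by exists i', j, z.
- by exists i, i', z.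
Qed.

Lemma derivation_relation_size r : r \in derivation_relations arrows pairs -> size r != 1%N.
Proof.
case/derivation_relationsP; case: r => [|t [|t' s]] //; rewrite big_seq1 => E H.
have [tin tin' tnz] := H t (mem_head _ _); move/eqP: E.
by rewrite !mulf_eq0 (negPf tnz) (negPf (arrow_val_neq0 tin)) (negPf (pair_val_neq0 tin')).
Qed.

Definition eps_bits : bitseq := [seq e (inord i) == -1 | i <- iota 0 n.+1].
Definition arrow_signs : bitseq := [seq arrow_val a < 0 | a <- arrows].
Definition pair_signs : bitseq := [seq pair_val p < 0 | p <- pairs].

Lemma bitseqsP m s : (s \in bitseqs m) = (size s == m).
Proof.
elim: m s => [|m IH] [|b s] //=; rewrite mem_cat ?eqSS -?IH.
  by apply/negP => /orP[] /mapP[].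
apply/orP/idP => [[] /mapP[t tin [_ ->]] // | sin].
by case: b; [left | right]; apply: map_f.
Qed.

Lemma eps_bitsE (i : I) : e i = (-1) ^+ bit eps_bits i.
Proof.
rewrite /bit (nth_map 0%N) ?size_iota // nth_iota // add0n inord_val.
case: (ns_sign sol i) => ->; rewrite ?eqxx ?expr1 //.
by rewrite eq_sym eqNr oner_eq0.
Qed.

Lemma arrow_signsE a : a \in arrows -> bit arrow_signs (index a arrows) = (arrow_val a < 0).
Proof. by move=> ain; rewrite /bit (nth_map a) ?index_mem // nth_index. Qed.

Lemma pair_signsE p : p \in pairs -> bit pair_signs (index p pairs) = (pair_val p < 0).
Proof. by move=> pin; rewrite /bit (nth_map p) ?index_mem // nth_index. Qed.

Lemma not_excluded r : r \in derivation_relations arrows pairs ->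
  ~~ excluded_signs arrows pairs arrow_signs pair_signs r.
Proof.
case/derivation_relationsP; case: r => [|[[a p] x] [|[[b q] y] [|]]] //= E H.
have [/= ain pin xnz] := H _ (mem_head _ _).
have /H[/= bin qin ynz] : (b, q, y) \in [:: (a, p, x); (b, q, y)] by rewrite !inE eqxx orbT.
move: E; rewrite big_cons big_seq1 /= arrow_signsE // arrow_signsE // pair_signsE // pair_signsE
  //.
have lt0 z : Z.ltb z Z0 = (zv z < 0).
  by case: z => [|z|z] /=; rewrite ?ltxx // ?Zval_neg // ltNge ltW // Zval_pos.
have sgn0 (z v w : R) : z != 0 -> v != 0 -> w != 0 ->
    Num.sg (z * v * w) = (-1) ^+ ((z < 0) (+) (v < 0) (+) (w < 0)).
  by move=> z0 v0 w0; rewrite !sgrM -!neqr0_sign // !signr_addb.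
have a0 := arrow_val_neq0 ain; have b0 := arrow_val_neq0 bin.
have p0 := pair_val_neq0 pin; have q0 := pair_val_neq0 qin.
rewrite !lt0 => /eqP; rewrite addr_eq0 => /eqP E; apply/eqP => B.
have := congr1 Num.sg E; rewrite sgrN !sgn0 // B => /eqP.
by rewrite -addr_eq0 -mulr2n mulrn_eq0 signr_eq0.
Qed.

(** * The linear system of a solution *)

Local Notation t := (\sum_k lam k).

(** The number [x_I]; likewise [pair_square] is [2 A^i_j tr D]. Divided by [2 tr D] they become the
    unknowns of the system. *)
Definition arrow_square (a : arrow) : R :=
  e (inord a.1.1) * e (inord a.1.2) * e (inord a.2) * arrow_val a ^+ 2.
Definition pair_square (p : nat * nat) : R := e (inord p.1) * e (inord p.2) * pair_val p ^+ 2.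

Lemma pair_weightE (i j l : I) : i != j ->
  zv (pair_weight (i : nat, j : nat) l) = 1 - (l == i)%:R + (l == j)%:R.
Proof.
move=> ij; have z2 : zv (Zpos (xO xH)) = 2 by [].
rewrite /pair_weight /= !(inj_eq val_inj); have [->|_] := eqVneq l i.
  by rewrite (negPf ij) subrr addr0.
by case: eqP => _; rewrite ?z2 ?subr0 ?addr0.
Qed.

Lemma arrow_weightE (i j k l : I) : i != j -> i != k -> j != k ->
  zv (weight (i : nat, j : nat, k : nat) l) = (l == k)%:R - (l == i)%:R - (l == j)%:R.
Proof.
move=> ij ik jk; rewrite /weight /= !(inj_eq val_inj); have [->|_] := eqVneq l k.
  by rewrite eq_sym (negPf ik) eq_sym (negPf jk) !subr0.
have [->|_] := eqVneq l i; first by rewrite (negPf ij) subr0 sub0r.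
by case: eqP => _; rewrite /= ?subr0 ?sub0r.
Qed.

Lemma arrows_distinct a : a \in arrows -> exists i j k : I,
  [/\ a = (i : nat, j : nat, k : nat), c i j k != 0 & [/\ i != j, i != k & j != k]].
Proof.
case/arrowsP => i [j [k [-> ij nz _]]]; exists i, j, k; split=> //.
have jk := sorted_c nz; by rewrite -!val_eqE /= !ltn_eqF // (ltn_trans ij).
Qed.

Lemma pairs_distinct p : p \in pairs -> exists i j : I,
  [/\ p = (i : nat, j : nat), N i j != 0 & i != j].
Proof.
case/pairsP => i [j [-> nz _]]; exists i, j; split=> //.
by apply: contraNneq nz => ->; rewrite (ns_diag sol).
Qed.

Lemma ric_arrows (l : I) : \sum_(a <- arrows) zv (weight a l) * arrow_square a =
  2 * t * (lam l - 1) - \sum_(p <- pairs) zv (pair_weight p l) * pair_square p.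
Proof.
pose x i j k := e i * e j * e k * c i j k ^+ 2 * ((k == l)%:R - (i == l)%:R - (j == l)%:R).
have c_ii i k : c i i k = 0.
  by have /eqP := ns_anti sol i i k; rewrite -addr_eq0 -mulr2n mulrn_eq0 => /eqP.
have EL : \sum_i \sum_j \sum_k x i j k = 2 * \sum_(a <- arrows) zv (weight a l) * arrow_square a.
  rewrite sum_sym => [|i j|i]; last first.
  - by rewrite big1 // => k _; rewrite /x c_ii expr0n mulr0 mul0r.
  - by apply: eq_bigr => k _; rewrite /x (ns_anti sol i j) sqrrN; ring.
  congr (2 * _); rewrite pair_big_dep pair_big_dep /= sum_over_arrows.
  rewrite [RHS]big_mkcond [LHS]big_mkcond /=; apply: eq_bigr => -[[i j] k] _ /=.
  rewrite andbT /x; case: ifP => ij //=; have [->|nz] := eqVneq (c i j k) 0.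
    by rewrite /= expr0n mulr0 mul0r.
  rewrite arrow_weightE /arrow_square /arrow_val /= ?inord_val; last 3 first.
  - by rewrite -val_eqE /= ltn_eqF.
  - by rewrite -val_eqE /= ltn_eqF // (ltn_trans ij) // (sorted_c nz).
  - by rewrite -val_eqE /= ltn_eqF // (sorted_c nz).
  by rewrite mulrC !(eq_sym l).
have ER : \sum_i \sum_j e i * e j * N i j ^+ 2 * ((i == l)%:R - (j == l)%:R - 1) =
    - \sum_(p <- pairs) zv (pair_weight p l) * pair_square p.
  rewrite pair_big /= sum_over_pairs [in RHS]big_mkcond -sumrN; apply: eq_bigr => -[i j] _ /=.
  have [->|nz] := eqVneq (N i j) 0; first by rewrite expr0n mulr0 mul0r oppr0.
  have ij : i != j by apply: contraNneq nz => ->; rewrite (ns_diag sol).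
  by rewrite pair_weightE // /pair_square /pair_val /= !inord_val !(eq_sym l); ring.
have := ns_ric sol l; rewrite EL ER => E.
by apply: (@mulfI _ 2); rewrite ?pnatr_eq0 // E; ring.
Qed.

Definition unknowns : seq R :=
  [seq lam (inord i) | i <- iota 0 n.+1] ++ [seq pair_square p / (2 * t) | p <- pairs]
  ++ [seq arrow_square a / (2 * t) | a <- arrows] ++ [:: 1].

Lemma sum_iota (F : nat -> R) : \sum_(i <- iota 0 n.+1) F i = \sum_(i : I) F i.
Proof. by rewrite -[iota 0 n.+1]/(index_iota 0 n.+1) big_mkord. Qed.

Lemma system_vanish : vanish unknowns (system n.+1 arrows pairs).
Proof.
have ts : 2 * t != 0 by rewrite mulf_neq0 ?pnatr_eq0 // (ns_trace_neq0 sol).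
move=> r; rewrite /system !mem_cat => /or3P[] /mapP[].
- move=> p /pairs_distinct[i [j [-> nz ij]]] ->.
  rewrite dot_cat ?size_map // dot_map dot_nseq0 addr0 sum_iota.
  rewrite (eq_bigr (fun l => lam l - (l == i)%:R * lam l + (l == j)%:R * lam l)).
    by rewrite big_split sumrB /= !sum_delta (ns_trace sol nz); ring.
  by move=> l _; rewrite pair_weightE // inord_val; ring.
- move=> a /arrows_distinct[i [j [k [-> nz [ij ik jk]]]]] ->.
  rewrite dot_cat ?size_map // dot_map dot_nseq0 addr0 sum_iota.
  rewrite (eq_bigr (fun l => (l == k)%:R * lam l - (l == i)%:R * lam l - (l == j)%:R * lam l)).
    by rewrite !sumrB !sum_delta (ns_weight sol nz); ring.
  by move=> l _; rewrite arrow_weightE // inord_val; ring.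
move=> l; rewrite mem_iota add0n => /andP[_ ln] ->.
rewrite !dot_cat ?size_map // !dot_map sum_iota /=.
have -> : l = Ordinal ln by []; set l' := Ordinal ln.
rewrite (eq_bigr (fun i => - ((i == l')%:R * lam i))) => [|i _]; last first.
  by rewrite ZvalN ZboolE inord_val mulNr.
rewrite sumrN sum_delta.
have divE (T : Type) (s : seq T) (F G : T -> R) :
    \sum_(x <- s) F x * (G x / (2 * t)) = (\sum_(x <- s) F x * G x) / (2 * t).
  by rewrite mulr_suml; apply: eq_bigr => x _; rewrite mulrA.
rewrite !divE ric_arrows.
have -> : zv (Zpos xH) = 1 by [].
by field; rewrite (ns_trace_neq0 sol).
Qed.

Lemma unknowns_size : size unknowns = (n.+1 + size pairs + size arrows).+1.
Proof. by rewrite /unknowns !size_cat !size_map size_iota /= addn1 !addnS !addnA. Qed.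

Lemma unknowns_const : unknowns`_(n.+1 + size pairs + size arrows) = 1.
Proof.
rewrite /unknowns nth_cat size_map size_iota -addnA ltnNge leq_addr /= addKn.
by rewrite nth_cat size_map ltnNge leq_addr /= addKn nth_cat size_map ltnn subnn.
Qed.

Lemma unknowns_lam (i : I) : unknowns`_i = lam i.
Proof.
by rewrite /unknowns nth_cat size_map size_iota ltn_ord (nth_map 0%N) ?size_iota // nth_iota //
  inord_val.
Qed.

Lemma unknowns_pair p : p \in pairs -> unknowns`_(pair_col n.+1 pairs p) = pair_square p / (2 *
  t).
Proof.
move=> pin; rewrite /unknowns /pair_col nth_cat size_map size_iota ltnNge leq_addr /= addKn.
by rewrite nth_cat size_map index_mem pin (nth_map p) ?index_mem // nth_index.
Qed.

Lemma unknowns_arrow a : a \in arrows ->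
  unknowns`_(arrow_col n.+1 arrows pairs a) = arrow_square a / (2 * t).
Proof.
move=> ain; rewrite /unknowns /arrow_col nth_cat size_map size_iota -addnA ltnNge leq_addr /=
  addKn.
rewrite nth_cat size_map ltnNge leq_addr /= addKn.
by rewrite nth_cat size_map index_mem ain (nth_map a) ?index_mem // nth_index.
Qed.

Lemma arrow_squareE a : a \in arrows ->
  arrow_square a = (-1) ^+ arrow_bit eps_bits a * arrow_val a ^+ 2.
Proof.
case/arrowsP => i [j [k [-> _ _ _]]]; rewrite /arrow_square /arrow_bit /= !inord_val.
by rewrite !eps_bitsE !signr_addb.
Qed.

Lemma pair_squareE p : p \in pairs ->
  pair_square p = (-1) ^+ pair_bit eps_bits p * pair_val p ^+ 2.
Proof.
case/pairsP => i [j [-> _ _]]; rewrite /pair_square /pair_bit /= !inord_val.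
by rewrite !eps_bitsE !signr_addb.
Qed.

Lemma eps_bits_in : eps_bits \in bitseqs n.+1.
Proof. by rewrite bitseqsP size_map size_iota. Qed.

Lemma product_relationP x :
  x \in pmap (product_relation n.+1 arrows pairs) (derivation_relations arrows pairs) ->
  unknowns`_x.1.1 * unknowns`_x.1.2 = unknowns`_x.2.1 * unknowns`_x.2.2.
Proof.
rewrite mem_pmap => /mapP[r /derivation_relationsP[E H]] /esym.
case: r E H => [|[[a p] y] [|[[b q] z] [|? ?]]] E H //; rewrite /product_relation.
case: ifP => // /andP[yz]; rewrite lallE => /allP/(_ _ eps_bits_in)/eqP B [<-].
have [/= ain pin ynz] := H _ (mem_head _ _).
have /H[/= bin qin znz] : (b, q, z) \in [:: (a, p, y); (b, q, z)] by rewrite !inE eqxx orbT.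
change (unknowns`_(arrow_col n.+1 arrows pairs a) * unknowns`_(pair_col n.+1 pairs p) =
        unknowns`_(arrow_col n.+1 arrows pairs b) * unknowns`_(pair_col n.+1 pairs q)).
rewrite !unknowns_pair // !unknowns_arrow // [LHS]mulrACA [RHS]mulrACA; congr (_ * _).
rewrite !arrow_squareE // !pair_squareE // [LHS]mulrACA [RHS]mulrACA -!signr_addb B;
  congr (_ * _).
move: E; rewrite big_cons big_seq1 /= => /eqP; rewrite addr_eq0 => /eqP E.
have yz2 : zv y ^+ 2 = zv z ^+ 2.
  by rewrite !expr2 -!ZvalM; congr (zv _); apply/BinInt.Z.eqb_eq.
have y2 : zv y ^+ 2 != 0 by rewrite sqrf_eq0.
apply: (mulfI y2); rewrite -!exprMn !mulrA [in RHS]exprMn [in RHS]exprMn yz2 E sqrrN !exprMn.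
by [].
Qed.

(** The trace is recovered as the sum of the computed diagonal; multiplication by [2 tr D] then
    undoes the normalisation of the unknowns. *)
Lemma solution_exact w :
  solve (n.+1 + size pairs + size arrows) (system n.+1 arrows pairs)
    (pmap (product_relation n.+1 arrows pairs) (derivation_relations arrows pairs)) = Some w ->
  let tq := foldr Qadd Q0 (take n.+1 w) in
  let b := [seq Qmul (Qadd tq tq) q | q <- take (size pairs) (drop n.+1 w)] in
  let x := [seq Qmul (Qadd tq tq) q | q <- drop (n.+1 + size pairs) w] in
  [/\ size b = size pairs, size x = size arrows, qv tq = t,
      forall i : I, qv (nth Q0 (take n.+1 w) i) = lam i &
      (forall p, p \in pairs -> qv (nth Q0 b (index p pairs)) = pair_square p) /\
      (forall a, a \in arrows -> qv (nth Q0 x (index a arrows)) = arrow_square a)].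
Proof.
move/(solveP unknowns_size unknowns_const system_vanish product_relationP) => [szw H] tq b x.
have szb : size b = size pairs.
  by rewrite size_map size_takel // size_drop szw -addnA addKn leq_addr.
have szx : size x = size arrows by rewrite size_map size_drop szw addKn.
have lamE (i : I) : qv (nth Q0 (take n.+1 w) i) = lam i.
  by rewrite nth_take // -H ?unknowns_lam // -addnA ltn_addr.
have tE : qv tq = t.
  rewrite /tq; have sz : size (take n.+1 w) = n.+1 by rewrite size_takel // szw -addnA leq_addr.
  have -> : qv (foldr Qadd Q0 (take n.+1 w)) = \sum_(q <- take n.+1 w) qv q.
    by elim: (take _ _) => [|q s IH] /=; rewrite ?big_nil ?Qval0 // big_cons QvalD IH.
  by rewrite (big_nth Q0) sz big_mkord; apply: eq_bigr => i _; rewrite lamE.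
have ts : 2 * t != 0 by rewrite mulf_neq0 ?pnatr_eq0 // (ns_trace_neq0 sol).
have t2E : qv (Qadd tq tq) = 2 * t by rewrite QvalD tE mulr2n mulrDl mul1r.
split=> //; split=> [p pin | a ain].
  have ip : (index p pairs < size pairs)%N by rewrite index_mem.
  rewrite (nth_map Q0); last by move: ip; rewrite -[in X in X -> _]szb size_map.
  rewrite QvalM t2E nth_take // nth_drop -H; last by rewrite ltn_addr // ltn_add2l.
  by rewrite (unknowns_pair pin) mulrC divfK.
have ia : (index a arrows < size arrows)%N by rewrite index_mem.
rewrite (nth_map Q0) ?size_drop ?szw ?addKn //.
rewrite QvalM t2E nth_drop -H; last by rewrite ltn_add2l.
by rewrite (unknowns_arrow ain) mulrC divfK.
Qed.

(** The map sending [e_i] to [e_(p i)], up to the sign recorded in [s], carries the solution to the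
    entry [(l, S)]; structure constants and off-diagonal coefficients are compared through their
    signed squares. *)
Record line_match (l : qline) (S p : seq nat) (s : bitseq) : Prop := LineMatch {
  lm_dim : ql_dim l = n.+1;
  lm_size : size p = n.+1;
  lm_uniq : uniq p;
  lm_bound : all (fun j => j < n.+1)%N p;
  lm_signs : S \in ql_signs l;
  lm_diag : forall i : I, lam i = qv (nth Q0 (ql_diag l) (place p i));
  lm_eps : forall i : I, e i = (-1) ^+ ((place p i).+1 \in S);
  lm_forms : forall i j k : I, c i j k * `|c i j k| =
    (-1) ^+ (bit s i (+) bit s j (+) bit s k) * qv (forms_at l (place p i) (place p j) (place p
      k));
  lm_tensors : forall i j : I, N i j * `|N i j| =
    (-1) ^+ (bit s i (+) bit s j) * qv (tensors_at l (place p i) (place p j))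
}.

Lemma signed_square (x : R) (q : Q) (b : bool) :
  x != 0 -> x ^+ 2 = qv (Qabs q) -> (x < 0) = Qneg q (+) b ->
  x * `|x| = (-1) ^+ b * qv q.
Proof.
move=> x0; rewrite Qval_abs (QnegE R) => E B.
rewrite {1}[x]numEsg -mulrA -normrM -expr2 E normr_id.
rewrite -neqr0_sign // B signr_addb -mulrA mulrCA; congr (_ * _).
have q0 : qv q != 0 by rewrite -normr_eq0 -E sqrf_eq0.
by rewrite neqr0_sign // -numEsg.
Qed.

Lemma lookup_form_anti s i j : qv (lookup_form s j i) = - qv (lookup_form s i j).
Proof. by rewrite /lookup_form; case: ltngtP => _; rewrite ?QvalN ?opprK ?Qval0 ?oppr0. Qed.

Lemma pairs_size_neq0 : size pairs != 0%N.
Proof.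
have [i [j nz]] := ns_nonzero sol; rewrite -lt0n -has_predT.
by apply/hasP; exists (i : nat, j : nat); rewrite // mem_pairs.
Qed.

(** The branches that discard the configuration contradict the existence of the solution, so the
    test must have reached the comparison with the list. *)
Lemma check_configP tbl : check_config tbl n.+1 arrows pairs ->
  exists k S p s, (k < size tbl)%N /\ line_match (nth empty_qline tbl k) S p s.
Proof.
rewrite /check_config (negPf pairs_size_neq0) (negPf jacobi_holds) lhasE.
have -> : has (fun r => size r == 1%N) (derivation_relations arrows pairs) = false.
  by apply/negbTE/hasPn => r /derivation_relation_size.
case Ew: (solve _ _ _) => [w|] //; move: (solution_exact Ew).
set lq := take _ w; set tq := foldr _ _ _ => /=.
set b := [seq _ | _ <- take _ _]; set x := [seq _ | _ <- drop _ _].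
move=> [szb szx tE lamE [bE xE]].
rewrite (QzeroE R) tE (negPf (ns_trace_neq0 sol)) !lhasE.
have sq_sign (s : bool) (r : R) : r != 0 -> (((-1) ^+ s * r ^+ 2 < 0) = s) * (`|(-1) ^+ s * r ^+
  2| = r ^+ 2).
  move=> r0; rewrite normrMsign ger0_norm ?sqr_ge0 //; split=> //.
  have r2 : 0 < r ^+ 2 by rewrite lt0r sqrf_eq0 r0 sqr_ge0.
  by case: s; rewrite ?expr1 ?expr0 ?mulN1r ?mul1r ?oppr_lt0 // ltNge ltW.
have bneg p : p \in pairs -> Qneg (nth Q0 b (index p pairs)) = pair_bit eps_bits p.
  by move=> pin; rewrite (QnegE R) bE // pair_squareE // sq_sign // pair_val_neq0.
have xneg a : a \in arrows -> Qneg (nth Q0 x (index a arrows)) = arrow_bit eps_bits a.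
  by move=> ain; rewrite (QnegE R) xE // arrow_squareE // sq_sign // arrow_val_neq0.
have babs p : p \in pairs -> qv (Qabs (nth Q0 b (index p pairs))) = pair_val p ^+ 2.
  by move=> pin; rewrite Qval_abs bE // pair_squareE // sq_sign // pair_val_neq0.
have xabs a : a \in arrows -> qv (Qabs (nth Q0 x (index a arrows))) = arrow_val a ^+ 2.
  by move=> ain; rewrite Qval_abs xE // arrow_squareE // sq_sign // arrow_val_neq0.
have -> : has Qzero b = false.
  apply/negbTE/(has_nthP Q0) => -[i ib]; rewrite szb in ib.
  have pin := mem_nth (0, 0)%N ib; have := babs _ pin.
  rewrite index_uniq ?pairs_uniq // Qval_abs (QzeroE R) => E /eqP Z; move/eqP: E.
  by rewrite Z normr0 eq_sym sqrf_eq0 (negPf (pair_val_neq0 pin)).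
have -> : has Qzero x = false.
  apply/negbTE/(has_nthP Q0) => -[i ib]; rewrite szx in ib.
  have ain := mem_nth (0, 0, 0)%N ib; have := xabs _ ain.
  rewrite index_uniq ?arrows_uniq // Qval_abs (QzeroE R) => E /eqP Z; move/eqP: E.
  by rewrite Z normr0 eq_sym sqrf_eq0 (negPf (arrow_val_neq0 ain)).
(* The quantifiers over sign vectors are instantiated at the signs of the solution at hand. *)
rewrite lallE => /allP/(_ arrow_signs); rewrite bitseqsP size_map eqxx => /(_ isT).
rewrite lallE => /allP/(_ pair_signs); rewrite bitseqsP size_map eqxx => /(_ isT).
rewrite lhasE; have -> : has (excluded_signs arrows pairs arrow_signs pair_signs)
    (derivation_relations arrows pairs) = false.
  by apply/negbTE/hasPn => r /not_excluded.
rewrite lallE => /allP/(_ eps_bits); rewrite mem_filter eps_bits_in.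
have -> : [seq arrow_bit eps_bits a | a <- arrows] = [seq Qneg i | i <- x].
  apply: (@eq_from_nth _ false); rewrite !(size_map _ arrows) ?(size_map Qneg) ?szx // => i ib.
  by rewrite (nth_map (0, 0, 0)%N) // (nth_map Q0) ?szx // -xneg ?mem_nth // index_uniq
    ?arrows_uniq.
have -> : [seq pair_bit eps_bits p | p <- pairs] = [seq Qneg i | i <- b].
  apply: (@eq_from_nth _ false); rewrite !(size_map _ pairs) ?(size_map Qneg) ?szb // => i ib.
  by rewrite (nth_map (0, 0)%N) // (nth_map Q0) ?szb // -bneg ?mem_nth // index_uniq ?pairs_uniq.
rewrite !eqxx => /(_ isT).
rewrite lhasE => /hasP[_ /mapP[z + ->]]; rewrite mem_filter => /andP[img /mapP[kp cand Ez]].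
rewrite {}Ez in img *; rewrite lhasE => /hasP[S Sin /eqP Seps].
case/allpairsPdep: cand => k0 [p0 [k0in p0in Ekp]]; rewrite {}Ekp in img Sin Seps.
move: p0in k0in; rewrite !mem_filter mem_iota add0n.
set l := nth empty_qline tbl k0 in img Sin Seps *.
case: ifP => // supp; rewrite placementsP // => /and4P[sq /eqP szp _ okp].
move=> /andP[/andP[/eqP dl _] ksz].
case/mapP: img => s sin [Esc Est].
exists k0, S, p0, s; split=> //; have /and3P[up bp okd] := okp.
have aP a : a \in arrows -> arrow_val a * `|arrow_val a| = (-1) ^+ arrow_bit s a * qv (arrow_at l
  p0 a).
  move=> ain; apply: signed_square; first exact: arrow_val_neq0.
    move: sq; rewrite /squares_match lallE; case: allP => // H _.
    by have := H a ain; rewrite (Qeq_boolE R) xabs // => /eqP.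
  rewrite -arrow_signsE // Esc /bit (nth_map (false, a)) ?size_map ?index_mem //.
  by rewrite (nth_map a) ?index_mem // nth_index.
have pP q : q \in pairs -> pair_val q * `|pair_val q| = (-1) ^+ pair_bit s q * qv (pair_at l p0
  q).
  move=> qin; apply: signed_square; first exact: pair_val_neq0.
    move: sq; rewrite /squares_match lallE; case: allP => // _; rewrite lallE => /allP H.
    by have := H q qin; rewrite (Qeq_boolE R) babs // => /eqP.
  rewrite -pair_signsE // Est /bit (nth_map (false, q)) ?size_map ?index_mem //.
  by rewrite (nth_map q) ?index_mem // nth_index.
move: supp; rewrite /support_matches lallE; case: allP => // supA; rewrite lallE => /allP supP.
have formU (i j k1 : I) : (i < j)%N -> c i j k1 * `|c i j k1| =
    (-1) ^+ (bit s i (+) bit s j (+) bit s k1) * qv (forms_at l (place p0 i) (place p0 j) (place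
      p0 k1)).
  move=> ij; have := supA (i : nat, j : nat); rewrite mem_upper_pairs ij ltn_ord => /(_ isT).
  rewrite lallE => /allP/(_ (k1 : nat)); rewrite mem_iota /= ltn_ord => /(_ isT).
  rewrite mem_arrows ij /= (QzeroE R) => /eqP E.
  have [c0|nz] := eqVneq (c i j k1) 0.
    rewrite c0 mul0r; move: E; rewrite c0 eqxx => /negbFE/eqP; rewrite /arrow_at /= => ->.
    by rewrite mulr0.
  have ain : (i : nat, j : nat, k1 : nat) \in arrows by rewrite mem_arrows ij nz.
  by have := aP _ ain; rewrite /arrow_val /= !inord_val.
split=> //.
- move=> i; rewrite -lamE; apply/eqP; rewrite -(Qeq_boolE R); apply: (allP okd).
  by rewrite mem_iota szp add0n ltn_ord.
- move=> i; rewrite eps_bitsE /bit; congr ((-1) ^+ _).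
  have <- : [seq (place p0 i).+1 \in S | i <- iota 0 n.+1] = eps_bits by exact: Seps.
  by rewrite (nth_map 0%N) ?size_iota // nth_iota.
- move=> i j k1; have [ij|ji|/ord_inj ij] := ltngtP i j; first exact: formU.
    rewrite (ns_anti sol j i) normrN mulNr formU // /forms_at lookup_form_anti.
    by rewrite [bit s j (+) _]addbC mulrN opprK.
  have -> : c i j k1 = 0.
    by have /eqP := ns_anti sol i j k1; rewrite ij -addr_eq0 -mulr2n mulrn_eq0 => /eqP.
  by rewrite ij mul0r /forms_at /lookup_form ltnn Qval0 mulr0.
move=> i j; have := supP i; rewrite mem_iota ltn_ord => /(_ isT).
rewrite lallE => /allP/(_ (j : nat)); rewrite mem_iota ltn_ord => /(_ isT).
rewrite mem_pairs (QzeroE R) => /eqP E.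
have [n0|nz] := eqVneq (N i j) 0.
  rewrite n0 mul0r; move: E; rewrite n0 eqxx => /negbFE/eqP; rewrite /pair_at /= => ->.
  by rewrite mulr0.
have pin : (i : nat, j : nat) \in pairs by rewrite mem_pairs.
by have := pP _ pin; rewrite /pair_val /= !inord_val.
Qed.

(** The accumulator holds arrows whose pair of sources has already been treated. It remains to see
    that the branch followed by the actual arrows is never pruned. *)
Lemma all_arrowsP ps acc P : all_arrows n.+1 ps acc P -> uniq ps ->
  (forall p, p \in ps -> p \in upper_pairs n.+1) ->
  (forall a, a \in acc -> a \in arrows /\ a.1 \notin ps) ->
  P (acc ++ [seq a <- [seq (p, k) | p <- ps, k <- iota p.2.+1 (n.+1 - p.2.+1)] | arrow_val a !=
    0]).
Proof.
elim: ps acc => [|p ps IH] acc /=; first by rewrite cats0.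
case: ifP => // H1; rewrite lallE => /allP H2 /andP[pps ups] up Hacc.
have upps q : q \in ps -> q \in upper_pairs n.+1 by move=> qin; apply: up; rewrite inE qin orbT.
rewrite filter_cat filter_map.
case EK: [seq k <- _ | _] => [|k K] /=.
  apply: IH => // a /Hacc[ain]; rewrite inE negb_or => /andP[_ ->]; split=> //.
have kK (k' : nat) : k' \in k :: K -> (p, k') \in arrows /\ k' \in iota p.2.+1 (n.+1 - p.2.+1).
  rewrite -EK mem_filter => /andP[/= nz kin]; split=> //; rewrite mem_filter nz /=.
  apply/allpairsPdep; exists p, k'; split=> //; apply: up; exact: mem_head.
have [kin kiota] := kK k (mem_head _ _).
(* The pair [p] has at most one target. *)
have {EK kK} -> : K = [::].
  have : uniq (k :: K) by rewrite -EK filter_uniq // iota_uniq.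
  case: K kK {EK} => // k' K kK; rewrite /= inE negb_or => /andP[/andP[/eqP kk' _] _].
  have [k'in _] : (p, k') \in arrows /\ _ := kK k' (mem_behead (mem_head _ _ : k' \in behead [::
    k, k' & K])).
  have [i [j [l [E1 _ nz _]]]] := arrowsP kin; have [i' [j' [l' [E2 _ nz' _]]]] := arrowsP k'in.
  case: E1 E2 => -> El [/ord_inj Ei /ord_inj Ej El']; case: kk'; rewrite El El'; congr val.
  by rewrite -Ei -Ej in nz'; apply: (ns_target sol nz nz').
have := H2 k kiota; rewrite lhasE; case: hasP => [[a ain shares] _ | _ H3].
  have [aarr anot] := Hacc a ain; move: anot; rewrite inE negb_or => /andP[/eqP ap _].
  have [i [j [l [Ea ij nz _]]]] := arrowsP aarr;
    have [i' [j' [l' [Ep ij' nz' _]]]] := arrowsP kin.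
  case: Ep shares ap => -> ->; rewrite Ea /= !inE !(inj_eq val_inj); case: eqP => // El.
  rewrite {}El in nz; have antiN x y z : c x y z != 0 -> c y x z != 0.
    by rewrite (ns_anti sol x y) oppr_eq0.
  (* A common source and a common target force the same label. In the parallel cases the two arrows
     have the same pair of sources; in the crossed cases the order of the sources is
     contradicted. *)
  move=> shares; case; move: shares; case: ifP => [/orP[]/eqP E _|_ /orP[]/eqP E].
  - by rewrite E in nz *; rewrite (ns_label sol nz nz').
  - by rewrite E in nz ij; move: ij; rewrite (ns_label sol nz (antiN _ _ _ nz')) => /(ltn_trans
    ij'); rewrite ltnn.
  - rewrite E in nz ij; move: ij'.
    rewrite -(ns_label sol (antiN _ _ _ nz) nz') => /(ltn_trans ij); by rewrite ltnn.
  - by rewrite E in nz *; rewrite (ns_label sol (antiN _ _ _ nz) (antiN _ _ _ nz')).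
rewrite -cat_rcons; apply: IH => // a; rewrite mem_rcons inE => /orP[/eqP-> // | /Hacc[ain]].
by rewrite inE negb_or => /andP[_ ->].
Qed.

Lemma all_pairsP ps acc P : all_pairs ps acc P -> uniq ps ->
  (forall p, p \in ps -> p \in off_pairs n.+1) ->
  (forall q, q \in acc -> q \in pairs /\ q \notin ps) ->
  P (acc ++ [seq p <- ps | pair_val p != 0]).
Proof.
elim: ps acc => [|p ps IH] acc /=; first by rewrite cats0.
case: ifP => // H1 H2 /andP[pps ups] off Hacc.
have offps q : q \in ps -> q \in off_pairs n.+1 by move=> qin; apply: off; rewrite inE qin orbT.
have Hacc' q : q \in acc -> q \in pairs /\ q \notin ps.
  by move=> /Hacc[qin]; rewrite inE negb_or => /andP[_ ->].
case: ifP => nz; last exact: IH.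
have pin : p \in pairs by rewrite mem_filter nz off // mem_head.
move: H2; rewrite lhasE; case: hasP => [[q qin shares] _ | _ H3].
  have [qpairs qnot] := Hacc q qin; move: qnot; rewrite inE negb_or => /andP[/eqP qp _].
  have [i [j [Eq nzq _]]] := pairsP qpairs; have [i' [j' [Ep nzp _]]] := pairsP pin.
  case: (ns_disjoint sol nzq nzp) => [[E1 E2]|]; first by case: qp; rewrite Eq Ep E1 E2.
  move: shares; rewrite Eq Ep /= !inE !(inj_eq val_inj).
  by case: (i == i'); case: (i == j'); case: (j == i'); case: (j == j'); rewrite ?orbT ?andbF.
rewrite -cat_rcons; apply: IH => // q; rewrite mem_rcons inE => /orP[/eqP-> // | /Hacc' //].
Qed.

Lemma check_dimP tbl : check_dim tbl n.+1 ->
  exists k S p s, (k < size tbl)%N /\ line_match (nth empty_qline tbl k) S p s.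
Proof.
move=> H; apply: check_configP.
have := all_arrowsP H (upper_pairs_uniq _) (fun p pin => pin) (fun a ain => match notF ain with
  end).
rewrite cat0s -/(upper_arrows _) -/arrows => H'.
have compat p : pair_val p != 0 -> p \in off_pairs n.+1 -> compatible arrows p.
  move=> nz poff; have pin : p \in pairs by rewrite mem_filter nz.
  have [i [j [-> nzp _]]] := pairsP pin; rewrite /compatible lallE; apply/allP => a ain.
  have [x [y [z [-> _ nzc _]]]] := arrowsP ain; rewrite /= !(inj_eq val_inj).
  case: eqP => // zj; rewrite {}zj in nzc; apply/andP; split; apply: contraNneq nzc => E.
    by rewrite E (ns_noarrow sol y nzp).
  by rewrite E (ns_anti sol i x) (ns_noarrow sol x nzp) oppr0.
have U : uniq [seq p <- off_pairs n.+1 | compatible arrows p] by rewrite filter_uniq //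
  off_pairs_uniq.
have off p : p \in [seq p <- off_pairs n.+1 | compatible arrows p] -> p \in off_pairs n.+1.
  by rewrite mem_filter => /andP[].
have := all_pairsP H' U off (fun q qin => match notF qin with end).
rewrite cat0s -filter_predI (eq_in_filter (a2 := fun p => pair_val p != 0)) // => p poff /=.
by case: (altP (pair_val p =P 0)) => // nz; rewrite compat.
Qed.

End Sorted.

Local Open Scope nat_scope.

(** * The list *)

(* The coefficients of the list: [Frac s a b] is [a / b] and [FracSqrt s a b k] is
   [a / b * sqrt k], with a minus sign on the first numerator if [s], and [SqrtFrac s a b c d]
   is [sqrt (a * b / (c * d))], with a minus sign in front if [s]. *)
Inductive coef :=
  | Int of nat
  | Frac of bool & nat & nat
  | FracSqrt of bool & nat & nat & nat
  | SqrtFrac of bool & nat & nat & nat & nat.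

(** The coding provides decidable equality, so that an entry has an [index] in the list. *)
Definition coef_code (x : coef) : bool * seq nat :=
  match x with
  | Int n => (false, [:: n])
  | Frac s a b => (s, [:: a; b])
  | FracSqrt s a b k => (s, [:: a; b; k])
  | SqrtFrac s a b c d => (s, [:: a; b; c; d])
  end.

Definition coef_decode (z : bool * seq nat) : coef :=
  match z with
  | (s, [:: a; b]) => Frac s a b
  | (s, [:: a; b; k]) => FracSqrt s a b k
  | (s, [:: a; b; c; d]) => SqrtFrac s a b c d
  | (_, r) => Int (head 0 r)
  end.

Lemma coef_codeK : cancel coef_code coef_decode. Proof. by case. Qed.

HB.instance Definition _ := Equality.copy coef (can_type coef_codeK).

Record line_syntax := Line_syntax {
  ls_dim : nat;
  ls_forms : seq (seq (coef * nat * nat));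
  ls_diag : seq coef;
  ls_tensors : seq (coef * nat * nat);
  ls_signs : seq (seq nat)
}.

Definition line_code (l : line_syntax) :=
  (ls_dim l, ls_forms l, ls_diag l, ls_tensors l, ls_signs l).

Definition line_decode (z : nat * seq (seq (coef * nat * nat)) * seq coef
    * seq (coef * nat * nat) * seq (seq nat)) : line_syntax :=
  let: (n, f, d, t, s) := z in Line_syntax n f d t s.

Lemma line_codeK : cancel line_code line_decode. Proof. by case. Qed.

HB.instance Definition _ := Equality.copy line_syntax (can_type line_codeK).

(** The list as syntax, which has both a real and a rational reading; [linesE] checks by conversion
    that the real reading is the list itself. *)
Definition lines_syntax : seq line_syntax := [::
  Line_syntax 3 [:: [::]; [::]; [:: (Frac false 4 7, 1, 2)]]
    [:: Frac false 6 7; Frac true 2 7; Frac false 4 7]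
    [:: (Frac false 8 7, 1, 2)]
    [:: [:: 1; 3]; [:: 2; 3]];
  Line_syntax 3 [:: [::]; [::]; [::]]
    [:: Int 1; Frac true 1 5; Frac false 2 5]
    [:: (Frac false 6 5, 1, 2)]
    [:: [:: 1]; [:: 1; 3]; [:: 2]; [:: 2; 3]];
  Line_syntax 4 [:: [::]; [::]; [:: (FracSqrt false 14 51 3, 1, 2)];
    [:: (FracSqrt false 7 51 34, 1, 3)]]
    [:: Frac false 28 51; Frac true 7 17; Frac false 7 51; Frac false 35 51]
    [:: (FracSqrt false 7 51 66, 1, 2)]
    [:: [:: 1; 3]; [:: 2; 3; 4]];
  Line_syntax 4 [:: [::]; [::]; [::]; [:: (FracSqrt false 2 17 22, 1, 2)]]
    [:: Frac false 15 17; Frac true 7 17; Frac false 6 17; Frac false 8 17]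
    [:: (Frac false 22 17, 1, 2)]
    [:: [:: 1; 3; 4]; [:: 1; 4]; [:: 2; 3; 4]; [:: 2; 4]];
  Line_syntax 4 [:: [::]; [::]; [::]; [:: (FracSqrt false 1 3 6, 1, 2)]]
    [:: Int 0; Int 0; Int 1; Int 0]
    [:: (FracSqrt false 2 3 3, 3, 4)]
    [:: [:: 1; 2; 3]; [:: 1; 4]; [:: 3]];
  Line_syntax 4 [:: [::]; [::]; [::]; [:: (FracSqrt false 1 3 6, 1, 2)]]
    [:: Frac false 2 3; Int 0; Frac true 1 3; Frac false 2 3]
    [:: (FracSqrt false 2 3 3, 1, 3)]
    [:: [:: 1; 2]; [:: 1; 4]; [:: 2; 3; 4]; [:: 3]];
  Line_syntax 4 [:: [::]; [::]; [::]; [:: (FracSqrt false 2 9 6, 1, 2)]]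
    [:: Frac false 1 3; Frac true 1 3; Frac false 2 3; Int 0]
    [:: (Frac false 2 3, 1, 2); (FracSqrt false 4 9 3, 3, 4)]
    [:: [:: 1; 4]; [:: 2; 4]];
  Line_syntax 4 [:: [::]; [::]; [::]; [::]]
    [:: Int 1; Frac true 1 3; Frac false 1 3; Frac false 1 3]
    [:: (Frac false 4 3, 1, 2)]
    [:: [:: 1]; [:: 1; 3]; [:: 1; 3; 4]; [:: 2]; [:: 2; 3]; [:: 2; 3; 4]];
  Line_syntax 4 [:: [::]; [::]; [::]; [::]]
    [:: Frac false 3 5; Frac false 3 5; Frac true 1 5; Frac true 1 5]
    [:: (Frac false 4 5, 1, 3); (Frac false 4 5, 2, 4)]
    [:: [:: 1; 2]; [:: 1; 4]; [:: 3; 4]];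
  Line_syntax 5 [:: [::]; [::]; [:: (FracSqrt false 3 10 5, 1, 2)];
    [:: (FracSqrt false 3 10 2, 1, 3)]; [:: (FracSqrt false 3 10 5, 1, 4)]]
    [:: Frac true 3 10; Frac false 3 4; Frac false 9 20; Frac false 3 20; Frac true 3 20]
    [:: (FracSqrt false 3 10 14, 2, 5)]
    [:: [:: 1; 2; 4]; [:: 1; 3; 5]];
  Line_syntax 5 [:: [::]; [::]; [:: (FracSqrt false 11 159 6, 1, 2)];
    [:: (FracSqrt false 11 159 106, 1, 3)]; [:: (FracSqrt false 22 53 3, 1, 4)]]
    [:: Frac false 55 159; Frac true 22 53; Frac true 11 159; Frac false 44 159; Frac false 33 53]
    [:: (FracSqrt false 22 159 57, 1, 2)]
    [:: [:: 1; 4]; [:: 2]];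
  Line_syntax 5 [:: [::]; [::]; [:: (Frac false 10 31, 1, 2)];
    [:: (FracSqrt false 5 31 3, 1, 3)]; [:: (FracSqrt false 5 31 3, 2, 3)]]
    [:: Frac false 15 31; Frac true 10 31; Frac false 5 31; Frac false 20 31; Frac true 5 31]
    [:: (Frac false 25 31, 1, 2); (Frac false 25 31, 4, 5)]
    [:: [:: 1; 3; 5]; [:: 2; 3; 4]];
  Line_syntax 5 [:: [::]; [::]; [::]; [:: (FracSqrt false 4 15 10, 1, 2)];
    [:: (FracSqrt false 4 15 3, 1, 4)]]
    [:: Frac true 2 15; Frac false 2 3; Frac true 2 5; Frac false 8 15; Frac false 2 5]
    [:: (FracSqrt false 4 15 21, 2, 3)]
    [:: [:: 1; 2; 5]; [:: 1; 3; 4]; [:: 2; 4; 5]; [:: 3]];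
  Line_syntax 5 [:: [::]; [::]; [::]; [:: (FracSqrt false 5 51 6, 1, 2)];
    [:: (FracSqrt false 5 51 34, 1, 4)]]
    [:: Frac false 10 51; Frac true 5 17; Frac false 10 17; Frac true 5 51; Frac false 5 51]
    [:: (FracSqrt false 5 51 42, 1, 2); (FracSqrt false 5 51 42, 3, 5)]
    [:: [:: 1; 3; 4]; [:: 2; 4; 5]];
  Line_syntax 5 [:: [::]; [::]; [::]; [:: (FracSqrt false 4 15 3, 1, 2)];
    [:: (FracSqrt false 4 15 10, 1, 4)]]
    [:: Frac true 2 15; Frac false 1 5; Int 1; Frac false 1 15; Frac true 1 15]
    [:: (FracSqrt false 4 15 21, 3, 5)]
    [:: [:: 1; 2; 5]; [:: 1; 3; 4]; [:: 2; 4; 5]; [:: 3]];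
  Line_syntax 5 [:: [::]; [::]; [::]; [:: (FracSqrt false 4 21 14, 1, 2)];
    [:: (FracSqrt false 4 21 14, 1, 4)]]
    [:: Frac false 1 3; Frac true 1 21; Frac true 3 7; Frac false 2 7; Frac false 13 21]
    [:: (FracSqrt false 4 21 30, 1, 3)]
    [:: [:: 1; 2; 5]; [:: 1; 4]; [:: 2; 3; 4; 5]; [:: 3]];
  Line_syntax 5 [:: [::]; [::]; [::]; [:: (FracSqrt false 4 15 3, 1, 2)];
    [:: (FracSqrt false 4 15 10, 1, 4)]]
    [:: Frac false 17 30; Frac true 1 2; Frac false 3 10; Frac false 1 15; Frac false 19 30]
    [:: (FracSqrt false 4 15 21, 1, 2)]
    [:: [:: 1; 3; 4]; [:: 1; 4]; [:: 2; 3; 4; 5]; [:: 2; 4; 5]];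
  Line_syntax 5 [:: [::]; [::]; [::]; [:: (FracSqrt false 6 17 6, 1, 2)];
    [:: (Frac false 6 17, 1, 3); (FracSqrt false 6 17 2, 2, 4)]]
    [:: Frac false 12 17; Frac true 3 17; Frac true 6 17; Frac false 9 17; Frac false 6 17]
    [:: (FracSqrt false 12 17 3, 1, 3)]
    [:: [:: 2; 3; 4]; [:: 3]];
  Line_syntax 5 [:: [::]; [::]; [::]; [:: (FracSqrt false 36 115 3, 1, 2)];
    [:: (FracSqrt false 9 506 110, 1, 3); (FracSqrt false 9 2530 2090, 2, 4)]]
    [:: Frac true 9 23; Frac false 36 115; Frac false 72 115; Frac true 9 115; Frac false 27 115]
    [:: (SqrtFrac false 243 589 550 529, 2, 1); (SqrtFrac true 243 31 22 529, 3, 4)]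
    [:: [:: 1; 4; 5]; [:: 2; 4]];
  Line_syntax 5 [:: [::]; [::]; [::]; [:: (FracSqrt false 1 19 102, 1, 2)];
    [:: (Frac false 6 19, 1, 3)]]
    [:: Frac false 3 19; Frac false 6 19; Frac true 6 19; Frac false 9 19; Frac true 3 19]
    [:: (FracSqrt false 2 19 33, 1, 3); (FracSqrt false 5 19 6, 2, 5)]
    [:: [:: 1; 4; 5]; [:: 3; 5]];
  Line_syntax 5 [:: [::]; [::]; [::]; [:: (Frac false 3 11, 1, 2)]; [:: (Frac false 3 11, 1, 3)]]
    [:: Frac false 1 11; Frac false 6 11; Frac true 3 11; Frac false 7 11; Frac true 2 11]
    [:: (Frac false 9 11, 2, 3); (Frac false 9 11, 4, 5)]
    [:: [:: 1; 2; 5]; [:: 1; 3; 4]; [:: 2; 4]; [:: 3; 5]];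
  Line_syntax 5 [:: [::]; [::]; [::]; [:: (FracSqrt false 1 6 6, 1, 2)];
    [:: (FracSqrt false 1 6 6, 1, 3)]]
    [:: Frac true 1 3; Frac false 1 3; Frac false 1 3; Int 0; Int 0]
    [:: (FracSqrt false 1 6 10, 2, 5); (FracSqrt true 1 6 10, 3, 4)]
    [:: [:: 1; 2; 3]; [:: 1; 4; 5]; [:: 2; 4]];
  Line_syntax 5 [:: [::]; [::]; [::]; [:: (FracSqrt false 1 6 6, 1, 2)];
    [:: (FracSqrt false 1 6 6, 1, 3)]]
    [:: Frac true 1 3; Frac false 1 3; Frac false 1 3; Int 0; Int 0]
    [:: (FracSqrt false 1 6 10, 2, 5); (FracSqrt false 1 6 10, 3, 4)]
    [:: [:: 1; 2; 3]; [:: 1; 4; 5]; [:: 2; 4]];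
  Line_syntax 5 [:: [::]; [::]; [::]; [:: (FracSqrt false 1 14 91, 1, 2)];
    [:: (FracSqrt false 1 14 91, 1, 3)]]
    [:: Frac true 3 14; Frac false 3 4; Frac false 1 28; Frac false 15 28; Frac true 5 28]
    [:: (FracSqrt false 1 7 65, 2, 5)]
    [:: [:: 1; 2; 3]; [:: 1; 4; 5]; [:: 2; 4]; [:: 3; 5]];
  Line_syntax 5 [:: [::]; [::]; [::]; [:: (FracSqrt false 2 53 29, 1, 2)];
    [:: (FracSqrt false 6 53 58, 1, 3)]]
    [:: Frac false 36 53; Frac true 22 53; Frac true 3 53; Frac false 14 53; Frac false 33 53]
    [:: (FracSqrt false 2 53 1102, 1, 2)]
    [:: [:: 1; 3]; [:: 1; 5]; [:: 2]; [:: 2; 3; 5]];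
  Line_syntax 5 [:: [::]; [::]; [::]; [::]; [:: (FracSqrt false 1 3 3, 1, 2)]]
    [:: Frac false 1 4; Frac false 1 4; Frac true 1 4; Frac true 1 4; Frac false 1 2]
    [:: (FracSqrt false 1 6 15, 1, 3); (FracSqrt false 1 6 15, 2, 4)]
    [:: [:: 1; 2]; [:: 1; 4; 5]; [:: 3; 4]];
  Line_syntax 5 [:: [::]; [::]; [::]; [::]; [:: (FracSqrt false 1 5 7, 1, 2)]]
    [:: Frac false 9 10; Frac true 1 2; Frac false 3 10; Frac false 3 10; Frac false 2 5]
    [:: (Frac false 7 5, 1, 2)]
    [:: [:: 1; 3; 4; 5]; [:: 1; 3; 5]; [:: 1; 5]; [:: 2; 3; 4; 5]; [:: 2; 3; 5]; [:: 2; 5]];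
  Line_syntax 5 [:: [::]; [::]; [::]; [::]; [:: (FracSqrt false 1 5 7, 1, 2)]]
    [:: Frac false 1 5; Frac false 1 5; Int 1; Frac true 2 5; Frac false 2 5]
    [:: (Frac false 7 5, 3, 4)]
    [:: [:: 1; 2; 3]; [:: 1; 2; 4]; [:: 1; 3; 5]; [:: 1; 4; 5]; [:: 3]; [:: 4]];
  Line_syntax 5 [:: [::]; [::]; [::]; [::]; [:: (FracSqrt false 1 21 322, 1, 2)]]
    [:: Frac false 2 3; Frac true 1 21; Frac true 3 7; Frac false 2 7; Frac false 13 21]
    [:: (FracSqrt false 1 21 690, 1, 3)]
    [:: [:: 1; 2]; [:: 1; 2; 4]; [:: 1; 4; 5]; [:: 1; 5]; [:: 2; 3; 4; 5]; [:: 2; 3; 5]; [:: 3];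
      [:: 3; 4]];
  Line_syntax 5 [:: [::]; [::]; [::]; [::]; [:: (FracSqrt false 1 21 322, 1, 2)]]
    [:: Frac true 1 21; Frac true 1 21; Int 1; Frac false 2 7; Frac true 2 21]
    [:: (FracSqrt false 1 21 690, 3, 5)]
    [:: [:: 1; 2; 3]; [:: 1; 2; 3; 4]; [:: 1; 4; 5]; [:: 1; 5]; [:: 3]; [:: 3; 4]];
  Line_syntax 5 [:: [::]; [::]; [::]; [::]; [:: (FracSqrt false 2 65 322, 1, 2)]]
    [:: Frac false 21 65; Frac true 5 13; Frac false 42 65; Frac false 12 65; Frac true 4 65]
    [:: (FracSqrt false 2 65 690, 3, 5); (Frac false 46 65, 1, 2)]
    [:: [:: 1; 4; 5]; [:: 1; 5]; [:: 2; 4; 5]; [:: 2; 5]];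
  Line_syntax 5 [:: [::]; [::]; [::]; [::]; [:: (FracSqrt false 1 3 3, 1, 2)]]
    [:: Frac false 1 4; Frac true 1 6; Frac false 7 12; Frac true 1 4; Frac false 1 12]
    [:: (FracSqrt false 1 6 15, 1, 4); (FracSqrt false 1 6 15, 3, 5)]
    [:: [:: 1; 2; 3]; [:: 1; 5]; [:: 2; 4; 5]; [:: 3; 4]];
  Line_syntax 5 [:: [::]; [::]; [::]; [::]; [:: (FracSqrt false 2 17 7, 1, 2)]]
    [:: Frac false 9 17; Frac true 5 17; Frac false 10 17; Frac true 4 17; Frac false 4 17]
    [:: (Frac false 14 17, 1, 2); (Frac false 14 17, 3, 4)]
    [:: [:: 1; 3; 5]; [:: 1; 4; 5]; [:: 2; 3; 5]; [:: 2; 4; 5]];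
  Line_syntax 5 [:: [::]; [::]; [::]; [::]; [:: (Frac false 3 11, 1, 2); (Frac false 3 11, 3, 4)]]
    [:: Frac false 6 11; Frac true 3 11; Frac false 6 11; Frac true 3 11; Frac false 3 11]
    [:: (Frac false 9 11, 1, 2); (Frac false 9 11, 3, 4)]
    [:: [:: 1; 3; 5]; [:: 1; 4; 5]; [:: 2; 4; 5]];
  Line_syntax 5 [:: [::]; [::]; [::]; [::]; [:: (Frac false 3 11, 1, 2); (Frac false 3 11, 3, 4)]]
    [:: Frac false 6 11; Frac true 3 11; Frac false 6 11; Frac true 3 11; Frac false 3 11]
    [:: (Frac false 9 11, 1, 2); (Frac true 9 11, 3, 4)]
    [:: [:: 1; 3; 5]; [:: 1; 4; 5]; [:: 2; 4; 5]];
  Line_syntax 5 [:: [::]; [::]; [::]; [::]; [:: (Frac false 3 11, 1, 2); (Frac false 3 11, 3, 4)]]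
    [:: Frac false 6 11; Frac true 3 11; Frac false 6 11; Frac true 3 11; Frac false 3 11]
    [:: (Frac false 9 11, 1, 4); (Frac false 9 11, 3, 2)]
    [:: [:: 1; 2]; [:: 1; 3; 5]; [:: 2; 4; 5]];
  Line_syntax 5 [:: [::]; [::]; [::]; [::]; [:: (Frac false 6 13, 1, 2); (Frac false 6 13, 3, 4)]]
    [:: Frac false 12 13; Frac true 6 13; Frac false 3 13; Frac false 3 13; Frac false 6 13]
    [:: (Frac false 18 13, 1, 2)]
    [:: [:: 1; 3; 5]; [:: 2; 3; 5]];
  Line_syntax 5 [:: [::]; [::]; [::]; [::]; [::]]
    [:: Frac false 7 12; Frac false 7 12; Frac true 1 4; Frac true 1 4; Frac false 1 6]
    [:: (Frac false 5 6, 1, 3); (Frac false 5 6, 2, 4)]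
    [:: [:: 1; 2]; [:: 1; 2; 5]; [:: 1; 4]; [:: 1; 4; 5]; [:: 3; 4]; [:: 3; 4; 5]];
  Line_syntax 5 [:: [::]; [::]; [::]; [::]; [::]]
    [:: Int 1; Frac true 3 7; Frac false 2 7; Frac false 2 7; Frac false 2 7]
    [:: (Frac false 10 7, 1, 2)]
    [:: [:: 1]; [:: 1; 3]; [:: 1; 3; 4]; [:: 1; 3; 4; 5]; [:: 2]; [:: 2; 3]; [:: 2; 3; 4];
      [:: 2; 3; 4; 5]]
]%N.

Definition Qfrac (a b : nat) : Q := Qred (Qmake (Z.of_nat a) (BinPos.Pos.of_nat b)).
Definition Qsign (s : bool) (q : Q) : Q := if s then Qopp q else q.

(** Meant for diagonal entries: [line_ok] checks that these contain no square root, so the default 0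
    is not reached there. *)
Definition coef_value (x : coef) : Q :=
  match x with Int n => Qfrac n 1 | Frac s a b => Qsign s (Qfrac a b) | _ => Q0 end.

(* The signed square [x * |x|]: the map [x |-> x * |x|] is odd and injective, and it takes
   rational values on the list. *)
Definition coef_square (x : coef) : Q :=
  match x with
  | Int n => Qmul (Qfrac n 1) (Qfrac n 1)
  | Frac s a b => Qsign s (Qmul (Qfrac a b) (Qfrac a b))
  | FracSqrt s a b k => Qsign s (Qmul (Qmul (Qfrac a b) (Qfrac a b)) (Qfrac k 1))
  | SqrtFrac s a b c d => Qsign s (Qmul (Qfrac a c) (Qfrac b d))
  end.

Definition coef_ok (x : coef) : bool :=
  match x with
  | Int _ => true | Frac _ _ b | FracSqrt _ _ b _ => 0 < b
  | SqrtFrac _ _ _ c d => (0 < c) && (0 < d)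
  end.

Definition is_rational (x : coef) : bool :=
  match x with Int _ | Frac _ _ _ => true | _ => false end.

Definition qline_of (l : line_syntax) : qline :=
  let q t := (coef_square t.1.1, t.1.2, t.2) in
  Qline (ls_dim l) (map (map q) (ls_forms l)) (map coef_value (ls_diag l)) (map q (ls_tensors l))
    (ls_signs l).

Definition qlines : seq qline := Eval vm_compute in map qline_of lines_syntax.

(** A necessary condition for the equivalence of two entries: a signed permutation of the basis that
    matches [eps], the diagonals, and the signed squares of the coefficients on increasing arrows
    and on off-diagonal pairs. *)
Definition related_lines (l l' : qline) (S S' : seq nat) : bool :=
  let n := ql_dim l in
  if n == ql_dim l' then
    lhas (fun p => lhas (fun s =>
        if lall (fun a => Qeqb (forms_at l a.1.1 a.1.2 a.2) (Qsign (arrow_bit s a) (arrow_at l' p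
          a)))
             (upper_arrows n)
        then lall (fun q => Qeqb (tensors_at l q.1 q.2) (Qsign (pair_bit s q) (pair_at l' p q)))
               (off_pairs n)
        else false) (bitseqs n))
      (placements n (fun i j => if (i.+1 \in S) == (j.+1 \in S') then
         Qeqb (nth Q0 (ql_diag l) i) (nth Q0 (ql_diag l') j) else false) n [::])
  else false.

Definition qentries (tbl : seq qline) : seq (qline * seq nat) :=
  [seq (l, sg) | l <- tbl, sg <- ql_signs l].

Definition check_distinct (tbl : seq qline) : bool :=
  pairwise (fun x y => ~~ related_lines x.1 y.1 x.2 y.2) (qentries tbl).

(** Each position occurs once, so that [lookup], which stops at the first match, agrees with the
    sums defining an entry; form terms have increasing indices. *)
Definition line_ok (l : line_syntax) : bool :=
  [&& size (ls_diag l) == ls_dim l,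
      all (fun x => coef_ok x && is_rational x) (ls_diag l),
      all (fun f => all (fun t => coef_ok t.1.1 && (t.1.2 < t.2)) f
                    && uniq [seq (t.1.2, t.2) | t <- f]) (ls_forms l),
      all (fun t => coef_ok t.1.1 && (t.1.2 != t.2)) (ls_tensors l)
    & uniq [seq (t.1.2, t.2) | t <- ls_tensors l]].

Lemma qlinesE : qlines = map qline_of lines_syntax.
Proof. by vm_compute. Qed.

Lemma lines_ok : all line_ok lines_syntax.
Proof. by vm_compute. Qed.

(** The classification itself, by computation. The value 2 is absent because the list has no line of
    that dimension. *)
Lemma check_dims : all (check_dim qlines) [:: 1; 3; 4; 5].
Proof. by vm_compute. Qed.

Lemma entries_distinct : check_distinct qlines.
Proof. by vm_compute. Qed.

Section Table.
Local Open Scope ring_scope.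
Variable R : realType.
Local Notation qv := (@Qval R).

(** The sign sits on the numerator because [- 2 / 7] parses as [(- 2) / 7]; this makes [linesE] a
    conversion. *)
Definition coef_real (x : coef) : R :=
  match x with
  | Int n => n%:R
  | Frac s a b => (if s then - a%:R else a%:R) / b%:R
  | FracSqrt s a b k => (if s then - a%:R else a%:R) / b%:R * Num.sqrt k%:R
  | SqrtFrac s a b c d =>
      let r := Num.sqrt (a%:R * b%:R / (c%:R * d%:R)) in if s then - r else r
  end.

Definition line_of (l : line_syntax) : line R :=
  let r t := term (coef_real t.1.1) t.1.2 t.2 in
  Line (ls_dim l) (map (map r) (ls_forms l)) (map coef_real (ls_diag l)) (map r (ls_tensors l))
    (ls_signs l).

Lemma linesE : lines R = map line_of lines_syntax.
Proof. by []. Qed.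

Lemma Qfrac_val a b : (0 < b)%N -> qv (Qfrac a b) = a%:R / b%:R.
Proof.
have nat_val m : Zval R (Z.of_nat m) = m%:R.
  by rewrite /Zval; case: m => //= m; rewrite Pnat.SuccNat2Pos.id_succ.
move=> b0; rewrite /Qfrac Qval_red /Qval nat_val; congr (_ / _); rewrite -nat_val.
by congr Zval; case: b b0 => // b _; rewrite /Z.of_nat BinPos.Pos.of_nat_succ.
Qed.

Lemma Qsign_val s q : qv (Qsign s q) = (-1) ^+ s * qv q.
Proof. by case: s; rewrite /= ?QvalN ?mulN1r ?mul1r. Qed.

Lemma coef_value_real x : coef_ok x -> is_rational x -> coef_real x = qv (coef_value x).
Proof.
case: x => [n|s a b|//|//] /= b0 _; first by rewrite Qfrac_val // divr1.
by rewrite Qsign_val Qfrac_val //; case: s; rewrite ?mulN1r ?mul1r ?mulNr.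
Qed.

Lemma coef_square_real x : coef_ok x -> coef_real x * `|coef_real x| = qv (coef_square x).
Proof.
have sgn (s : bool) (r : R) : 0 <= r -> (-1) ^+ s * r * `|(-1) ^+ s * r| = (-1) ^+ s * (r * r).
  by move=> r0; rewrite normrMsign ger0_norm // mulrA.
have opp (s : bool) (r r' : R) : (if s then - r else r) * r' = (-1) ^+ s * (r * r').
  by case: s; rewrite ?mulN1r ?mul1r ?mulNr.
case: x => [n|s a b|s a b k|s a b c d] /= ok; rewrite ?Qsign_val.
- by rewrite QvalM Qfrac_val // divr1 normr_nat.
- by rewrite QvalM Qfrac_val // opp sgn ?divr_ge0.
- rewrite !QvalM !Qfrac_val // divr1 -[_ / _ * _]mulrA opp sgn ?mulr_ge0 ?invr_ge0 ?sqrtr_ge0 //.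
  by congr (_ * _); rewrite -[in RHS](sqr_sqrtr (ler0n R k)); ring.
case/andP: ok => c0 d0; rewrite QvalM !Qfrac_val // -[X in X * `|_|]mulr1 -[X in `|X|]mulr1 opp
  mulr1.
rewrite sgn ?sqrtr_ge0 //; congr (_ * _).
by rewrite -expr2 sqr_sqrtr ?mulr_ge0 ?invr_ge0 ?mulr_ge0 // invfM mulrACA.
Qed.

End Table.

Local Open Scope ring_scope.

Section Entries.
Variable R : realType.
Local Notation qv := (@Qval R).
Local Notation real := (@coef_real R).

(** Positions are distinct, so at most one term of the sum is nonzero, namely the one that [lookup]
    finds. *)
Lemma lookup_sum (f : seq (coef * nat * nat)) i j :
  all (fun t => coef_ok t.1.1) f -> uniq [seq (t.1.2, t.2) | t <- f] ->
  let v := \sum_(t <- f) real t.1.1 * ((i.+1 == t.1.2) && (j.+1 == t.2))%:R in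
  v * `|v| = qv (lookup [seq (coef_square t.1.1, t.1.2, t.2) | t <- f] i j).
Proof.
elim: f => [|[[x p] q] f IH] /=; first by rewrite big_nil mul0r Qval0.
move=> /andP[okx okf] /andP[notin uf]; rewrite big_cons /=;
  case: ifP => [/andP[/eqP ip /eqP jq]|_].
  rewrite big_seq big1 => [|[[y p'] q'] tin /=]; first by rewrite mulr1 addr0 coef_square_real.
  rewrite ip jq; case: andP => [[/eqP E1 /eqP E2]|_]; last by rewrite mulr0.
  by move: notin; rewrite E1 E2 => /negP[]; apply/mapP; exists (y, p', q').
by rewrite mulr0 add0r IH.
Qed.

Variables (l : line_syntax) (S : seq nat).
Hypothesis ok : line_ok l.
Local Notation entry := (line_of R l, S).

Lemma entry_scE (i j k : 'I_(ls_dim l)) :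
  entry_sc entry i j k * `|entry_sc entry i j k| = qv (forms_at (qline_of l) i j k).
Proof.
case/and5P: ok => _ _ /allP okf _ _; rewrite /entry_sc /forms_at /=.
have nth_map_nil (T T' : Type) (g : T -> T') (s : seq (seq T)) m :
    nth [::] (map (map g) s) m = map g (nth [::] s m).
  have [lt|ge] := ltnP m (size s); first by rewrite (nth_map [::]).
  by rewrite !nth_default ?size_map.
rewrite !nth_map_nil big_map /=; set f := nth [::] (ls_forms l) k.
have [okc uf] : all (fun t => coef_ok t.1.1 && (t.1.2 < t.2)%N) f /\ uniq [seq (t.1.2, t.2) | t
  <- f].
  have [lt|ge] := ltnP k (size (ls_forms l)); last by rewrite /f nth_default.
  by apply/andP; apply: okf; apply: mem_nth.
have ltf t : t \in f -> (t.1.2 < t.2)%N by move/(allP okc)/andP => [].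
have okf' : all (fun t => coef_ok t.1.1) f by apply/allP => t /(allP okc)/andP[].
(* As form terms have increasing indices, the transposed half of the antisymmetrised term never
   matches when [m <= r]. *)
have vE m r : (m <= r)%N -> \sum_(t <- f) real t.1.1 * (((m.+1 == t.1.2) && (r.+1 == t.2))%:R
      - ((r.+1 == t.1.2) && (m.+1 == t.2))%:R)
    = \sum_(t <- f) real t.1.1 * ((m.+1 == t.1.2) && (r.+1 == t.2))%:R.
  move=> mr; apply: eq_big_seq => t /ltf lt; congr (_ * _).
  have [/andP[/eqP E1 /eqP E2]|_] := boolP ((r.+1 == t.1.2) && (m.+1 == t.2));
    last by rewrite subr0.
  by move: lt; rewrite -E1 -E2 ltnS ltnNge mr.
rewrite /lookup_form; case: ltngtP => [ij|ji|ij].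
- by rewrite vE ?(ltnW ij) // normrN mulNr lookup_sum // QvalN.
- rewrite -lookup_sum // -(vE _ _ (ltnW ji)) -sumrN.
  by under eq_bigr do rewrite -mulrN opprB.
rewrite ij vE // Qval0 big_seq big1 ?oppr0 ?mul0r // => t /ltf lt.
case: andP => [[/eqP E1 /eqP E2]|_]; last by rewrite mulr0.
by move: lt; rewrite -E1 -E2 ltnn.
Qed.

Lemma entry_derivationE (i j : 'I_(ls_dim l)) : entry_derivation entry j i =
  (i == j)%:R * qv (nth Q0 (ql_diag (qline_of l)) i)
  + \sum_(t <- ls_tensors l) real t.1.1 * ((i.+1 == t.1.2) && (j.+1 == t.2))%:R.
Proof.
case/and5P: ok => /eqP sz /allP okd _ _ _; rewrite /entry_derivation mxE /=; congr (_ + _).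
  rewrite summxE (bigD1 i) //= big1 => [|k ki]; rewrite !mxE; last first.
    by rewrite (eq_sym i) (negPf ki) andbF mulr0.
  rewrite eqxx andbT addr0 mulrC (eq_sym j); congr (_ * _).
  rewrite (nth_map (Int 0)) ?sz // (nth_map (Int 0)) ?sz //.
  have /okd/andP[ok1 ok2] : nth (Int 0) (ls_diag l) i \in ls_diag l by apply: mem_nth; rewrite sz.
  exact: coef_value_real.
rewrite big_map summxE; apply: eq_bigr => t _; rewrite mxE /=; congr (_ * _).
pose b (x y : 'I_(ls_dim l)) : R := ((x.+1 == t.1.2) && (y.+1 == t.2))%:R.
rewrite summxE (eq_bigr (fun x => (x == i)%:R * b x j)) ?sum_delta // => x _.
rewrite summxE (eq_bigr (fun y => (y == j)%:R * ((x == i)%:R * b x y))) ?sum_delta // => y _.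
rewrite !mxE (eq_sym j) (eq_sym i).
by case: (y == j); case: (x == i); rewrite /= ?mulr1 ?mul1r ?mulr0 ?mul0r.
Qed.

Lemma entry_diag (i : 'I_(ls_dim l)) :
  entry_derivation entry i i = qv (nth Q0 (ql_diag (qline_of l)) i).
Proof.
rewrite entry_derivationE eqxx mul1r big_seq big1 ?addr0 // => t tin.
case/and5P: ok => _ _ _ /allP/(_ _ tin)/andP[_ ne] _.
by case: andP => [[/eqP E1 /eqP E2]|_]; rewrite ?mulr0 // -E1 -E2 eqxx in ne *.
Qed.

Lemma entry_off_diagonal (i j : 'I_(ls_dim l)) :
  off_diagonal (entry_derivation entry) i j * `|off_diagonal (entry_derivation entry) i j| =
  qv (tensors_at (qline_of l) i j).
Proof.
case/and5P: ok => _ _ _ /allP okt ut.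
have okc : all (fun t => coef_ok t.1.1) (ls_tensors l) by apply/allP => t /okt/andP[].
rewrite /tensors_at -lookup_sum // /off_diagonal; have [->|ij] := eqVneq i j; last first.
  by rewrite entry_derivationE (negPf ij) mul0r add0r.
rewrite big_seq big1 // => t /okt/andP[_ ne].
by case: andP => [[/eqP E1 /eqP E2]|_]; rewrite ?mulr0 // -E1 -E2 eqxx in ne *.
Qed.

Lemma entry_epsE (i : 'I_(ls_dim l)) : entry_eps entry i 0 = (-1) ^+ (i.+1 \in S).
Proof. by rewrite mxE /=; case: (_ \in _). Qed.

End Entries.

Local Open Scope ring_scope.

(** * Equivalences *)

(** The coordinate form of an equivalence that maps [e_i] to [s_i e_(p i)]. *)
Record relabels (R : realType) (n n' : nat)
    (c : structure_constants R n) (eps : 'cV[R]_n) (D : 'M[R]_n)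
    (c' : structure_constants R n') (eps' : 'cV[R]_n') (D' : 'M[R]_n')
    (p : 'I_n -> 'I_n') (s : 'I_n -> R) : Prop := Relabels {
  rl_bij : bijective p;
  rl_sign : forall i, s i = 1 \/ s i = -1;
  rl_eps : forall i, eps i 0 = eps' (p i) 0;
  rl_bracket : forall i j k, s k * c i j k = s i * s j * c' (p i) (p j) (p k);
  rl_derivation : forall i j, s j * D j i = s i * D' (p j) (p i)
}.

Section Relabel.
Variables (R : realType) (n n' : nat).
Variables (c : structure_constants R n) (eps : 'cV[R]_n) (D : 'M[R]_n).
Variables (c' : structure_constants R n') (eps' : 'cV[R]_n') (D' : 'M[R]_n').

Lemma inner_diag m (e x y : 'cV[R]_m) : inner (diag_metric e) x y = \sum_i e i 0 * x i 0 * y i 0.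
Proof.
rewrite /inner -mulmxA mxE; apply: eq_bigr => i _.
by rewrite diag_metric_mull mxE; ring.
Qed.

Lemma mulmx_basis m m' (M : 'M[R]_(m', m)) i k : (M *m basis R i) k 0 = M k i.
Proof.
rewrite mxE (eq_bigr (fun j => M k j * (j == i)%:R)) ?sum_delta_r // => j _.
by rewrite basisE.
Qed.

Lemma col_basisE m (x : 'cV[R]_m) : x = \sum_i x i 0 *: basis R i.
Proof.
apply/matrixP => k l; rewrite ord1 summxE (eq_bigr (fun i => (i == k)%:R * x i 0)) ?sum_delta //.
by move=> i _; rewrite !mxE eqxx andbT mulrC eq_sym.
Qed.

Lemma equivalent_of_relabels p s : relabels c eps D c' eps' D' p s ->
  equivalent c (diag_metric eps) D c' (diag_metric eps') D'.
Proof.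
case=> bij_p Hs He Hc HD; have inj_p := bij_inj bij_p.
pose P : 'M[R]_(n', n) := \matrix_(k, i) ((k == p i)%:R * s i).
have PE (x : 'cV[R]_n) k : (P *m x) (p k) 0 = s k * x k 0.
  rewrite mxE (eq_bigr (fun i => (i == k)%:R * (s i * x i 0))) ?sum_delta // => i _.
  by rewrite mxE (inj_eq inj_p) eq_sym mulrA.
have ext (x y : 'cV[R]_n') : (forall k, x (p k) 0 = y (p k) 0) -> x = y.
  case: bij_p => q _ qK E; apply/matrixP => k l; rewrite ord1 -(qK k); exact: E.
have sumP (F : 'I_n' -> R) : \sum_k F k = \sum_i F (p i).
  by rewrite (reindex p) //=; apply: onW_bij.
have ss i : s i * s i = 1 by case: (Hs i) => ->; rewrite ?mulrNN mulr1.
exists (mulmx P); split.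
- exists (fun y : 'cV[R]_n' => \col_i (s i * y (p i) 0)) => x.
    by apply/matrixP => i j; rewrite ord1 mxE PE mulrA ss mul1r.
  by apply: ext => k; rewrite PE mxE mulrA ss mul1r.
- move=> x y; apply: ext => k; rewrite PE !mxE sumP mulr_sumr; apply: eq_bigr => i _.
  rewrite sumP mulr_sumr; apply: eq_bigr => j _; rewrite !PE.
  by rewrite mulrCA Hc; ring.
- move=> i; exists (p i), (s i); apply: ext => k.
  rewrite PE !mxE !andbT (inj_eq inj_p).
  by case: (altP (k =P i)) => [->|]; rewrite ?mulr1 ?mulr0.
- move=> x y; rewrite !inner_diag sumP; apply: eq_bigr => i _.
  by rewrite !PE He; case: (Hs i) => ->; ring.
move=> x; apply: ext => k; rewrite PE !mxE sumP mulr_sumr; apply: eq_bigr => i _.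
by rewrite PE mulrA HD; ring.
Qed.

Hypothesis sign : forall i, eps i 0 = 1 \/ eps i 0 = -1.
Hypothesis sign' : forall i, eps' i 0 = 1 \/ eps' i 0 = -1.

(** Comparing the squared lengths of [e_i] and [f e_i] gives [eps_i = s_i ^ 2 eps'_(p i)]; both
    signs being 1 or -1, so is [s_i]. *)
Lemma relabels_of_equivalent :
  equivalent c (diag_metric eps) D c' (diag_metric eps') D' ->
  exists p s, relabels c eps D c' eps' D' p s.
Proof.
case=> f [bij_f Hc Hbasis He HD].
have [p /fin_all_exists[s Ep]] := fin_all_exists Hbasis.
have fE x k : f x k 0 = \sum_i x i 0 * s i * (k == p i)%:R.
  rewrite {1}[x]col_basisE linear_sum summxE; apply: eq_bigr => i _.
  by rewrite linearZ_LR Ep !mxE eqxx andbT mulrA.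
have inner_basis m (e : 'cV[R]_m) i : inner (diag_metric e) (basis R i) (basis R i) = e i 0.
  rewrite inner_diag (eq_bigr (fun j => (j == i)%:R * (e j 0 * (j == i)%:R))) ?sum_delta ?eqxx
    ?mulr1 //.
  by move=> j _; rewrite !basisE; ring.
have sq i : eps i 0 = s i ^+ 2 * eps' (p i) 0.
  rewrite -inner_basis He Ep inner_diag -[eps' _ _]inner_basis inner_diag mulr_sumr.
  by apply: eq_bigr => j _; rewrite !mxE; ring.
have sgn i : eps i 0 = eps' (p i) 0 /\ (s i = 1 \/ s i = -1).
  have s0 : 0 <= s i ^+ 2 := sqr_ge0 _.
  have [s1 ->] : s i ^+ 2 = 1 /\ eps i 0 = eps' (p i) 0.
    by have := sq i; case: (sign i) => ->; case: (sign' (p i)) => -> E; split=> //; lra.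
  by split=> //; move/eqP: s1; rewrite sqrf_eq1 => /orP[] /eqP; [left | right].
have s0 i : s i != 0 by case: (sgn i) => _ [] ->; rewrite ?oppr_eq0 oner_eq0.
have inj_p : injective p.
  (* If [p i = p j], then [s_j e_i] and [s_i e_j] have the same image under the bijection [f]. *)
  move=> i j E; have : f (s j *: basis R i) = f (s i *: basis R j).
    by rewrite !linearZ_LR !Ep E !scalerA mulrC.
  move/(bij_inj bij_f)/matrixP/(_ i 0); rewrite !mxE !eqxx /= mulr1.
  by case: eqP => // _ /eqP; rewrite mulr0 (negPf (s0 j)).
have fEp x k : f x (p k) 0 = s k * x k 0.
  rewrite fE (eq_bigr (fun i => (i == k)%:R * (x i 0 * s i))) ?sum_delta ?(mulrC (s k)) //.
  by move=> i _; rewrite (inj_eq inj_p) eq_sym mulrC.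
have surj_p k : exists i, p i = k.
  case: bij_f => g _ gK; have := fE (g (basis R k)) k; rewrite gK basisE eqxx => E.
  have /existsP[i /eqP ->] : [exists i, k == p i]; last by exists i.
  apply: contraT => /existsPn H; move/eqP: E; rewrite big1 ?oner_eq0 // => i _.
  by rewrite (negPf (H i)) mulr0.
have [q qK] := fin_all_exists surj_p.
exists p, s; split=> [|i|i|i j k|i j].
- by exists q => i //; apply: inj_p.
- by have [] := sgn i.
- by have [] := sgn i.
- rewrite -[c i j k]bracket_basis -fEp Hc !Ep bracketZl bracketZr !mxE.
  by rewrite -[c' _ _ _]bracket_basis mxE mulrA.
by rewrite -[D j i]mulmx_basis -fEp HD Ep -scalemxAr mxE mulmx_basis.
Qed.

End Relabel.

(** Two entries reached from the same solution are related by the composite of one signed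
    permutation with the inverse of the other. *)
Lemma relabels_trans (R : realType) (n1 n2 n3 : nat)
    (c1 : structure_constants R n1) eps1 D1 (c2 : structure_constants R n2) eps2 D2
    (c3 : structure_constants R n3) eps3 D3 p s q r :
  relabels c1 eps1 D1 c2 eps2 D2 p s -> relabels c1 eps1 D1 c3 eps3 D3 q r ->
  exists p' s', relabels c2 eps2 D2 c3 eps3 D3 p' s'.
Proof.
case=> [[p' pK p'K]] Hs He Hc HD [bij_q Hr He' Hc' HD'].
have ss i : s i * s i = 1 by case: (Hs i) => ->; rewrite ?mulrNN mulr1.
have rr i : r i * r i = 1 by case: (Hr i) => ->; rewrite ?mulrNN mulr1.
exists (q \o p'), (fun i => r (p' i) * s (p' i)); split=> /=.
- by apply: bij_comp => //; exists p.
- by move=> i; case: (Hr (p' i)) => ->; case: (Hs (p' i)) => ->;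
    rewrite ?mulrNN ?mulr1 ?mul1r; [left | right | right | left].
- by move=> i; rewrite -He' He p'K.
- move=> i j k; have := Hc (p' i) (p' j) (p' k); have := Hc' (p' i) (p' j) (p' k).
  rewrite !p'K; move: (c1 _ _ _) (c2 _ _ _) (c3 _ _ _) => x y z.
  case: (Hr (p' i)) (Hr (p' j)) (Hr (p' k)) => [] -> [] -> [] ->;
  case: (Hs (p' i)) (Hs (p' j)) (Hs (p' k)) => [] -> [] -> [] ->; lra.
move=> i j; have := HD (p' i) (p' j); have := HD' (p' i) (p' j).
rewrite !p'K; move: (D1 _ _) (D2 _ _) (D3 _ _) => x y z.
case: (Hr (p' i)) (Hr (p' j)) => [] -> [] ->;
case: (Hs (p' i)) (Hs (p' j)) => [] -> [] ->; lra.
Qed.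

(** * Sorting the nodes and finding an entry *)

Local Open Scope ring_scope.

(** All conditions are invariant under permutations of the nodes; this brings a solution into the
    sorted form on which the enumeration works. *)
Lemma nice_soliton_relabel (R : realType) (n : nat) (c : structure_constants R n) lam N e
    (s : 'I_n -> 'I_n) : injective s -> nice_soliton c lam N e ->
  nice_soliton (fun i j k => c (s i) (s j) (s k)) (fun i => lam (s i))
    (fun i j => N (s i) (s j)) (fun i => e (s i)).
Proof.
move=> inj sol; have sumE (F : 'I_n -> R) : \sum_i F (s i) = \sum_i F i.
  by rewrite [RHS](reindex_inj inj).
have deltaE i j : (s i == s j) = (i == j) by rewrite (inj_eq inj).
case: sol => anti jac tgt lab [d dP] sgn dg dis [i0 [j0 nz0]] noa wei tra tra0 nor der ric.
split=> //.
- by move=> x y z l; rewrite -[RHS](jac (s x) (s y) (s z) (s l)) -[RHS]sumE.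
- by move=> i j k l h1 h2; apply: inj; apply: tgt h1 h2.
- by move=> i j j' k h1 h2; apply: inj; apply: lab h1 h2.
- by exists (d \o s) => i j k; apply: dP.
- move=> i j i' j' h1 h2; case: (dis _ _ _ _ h1 h2) => [[/inj -> /inj ->]|]; first by left.
  by rewrite -[[:: s i; _; _; _]]/(map s [:: i; j; i'; j']) map_inj_uniq; first by right.
- have [s' _ s'K] := injF_bij inj; exists (s' i0), (s' j0); by rewrite !s'K.
- by move=> i j k; apply: noa.
- by move=> i j k; apply: wei.
- by move=> i j h; rewrite sumE; apply: tra.
- by rewrite sumE.
- by rewrite (sumE (fun i => lam i ^+ 2)) sumE.
- move=> x y l; have := der (s x) (s y) (s l).
  by rewrite -sumE -[X in _ = X + _]sumE -[X in _ = _ + X]sumE.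
move=> l; rewrite sumE.
have sum2 (F : 'I_n -> 'I_n -> R) : \sum_i \sum_j F (s i) (s j) = \sum_i \sum_j F i j.
  by rewrite -[RHS]sumE; apply: eq_bigr => i _; rewrite -[RHS]sumE.
have sum3 (F : 'I_n -> 'I_n -> 'I_n -> R) :
    \sum_i \sum_j \sum_k F (s i) (s j) (s k) = \sum_i \sum_j \sum_k F i j k.
  by rewrite -[RHS]sum2; apply: eq_bigr => i _; apply: eq_bigr => j _; rewrite -[RHS]sumE.
have := ric (s l); rewrite -sum3 -[X in _ + X]sum2 => E.
transitivity (2 * (2 * (\sum_k lam k) * (lam (s l) - 1)
    + \sum_i \sum_j e (s i) * e (s j) * N (s i) (s j) ^+ 2
        * ((s i == s l)%:R - (s j == s l)%:R - 1))).
  rewrite -E; apply: eq_bigr => i _; apply: eq_bigr => j _; apply: eq_bigr => k _.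
  by rewrite !deltaE.
congr (2 * (_ + _)); apply: eq_bigr => i _; apply: eq_bigr => j _.
by rewrite !deltaE.
Qed.

Lemma sort_by_depth (n : nat) (d : 'I_n -> nat) :
  exists2 s : 'I_n -> 'I_n, injective s & forall i j, (d (s i) < d (s j))%N -> (i < j)%N.
Proof.
pose le i j := (d i <= d j)%N; pose t := sort le (enum 'I_n).
have sz : size t = n by rewrite size_sort size_enum_ord.
have tot : total le by move=> i j; apply: leq_total.
have tr : transitive le by move=> i j k; apply: leq_trans.
exists (fun i => nth i t i) => [i j E|i j].
  apply: val_inj; apply/eqP; rewrite -(nth_uniq i _ _ (_ : uniq t)) ?sz ?ltn_ord //.
    by rewrite [X in _ == X](set_nth_default j) ?sz ?ltn_ord // E.
  by rewrite sort_uniq enum_uniq.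
rewrite [nth j t j](set_nth_default i) ?sz ?ltn_ord // ltnNge; apply: contraNT;
  rewrite -leqNgt => ji.
by apply: (sorted_leq_nth tr _ _ (sort_sorted tot _)); rewrite ?inE ?sz ?ltn_ord //; move=> x;
  apply: leqnn.
Qed.

(** Passing to signed squares loses nothing: absolute value and sign can both be read off
    [x * |x|]. *)
Lemma mul_norm_inj (R : realDomainType) (x y : R) (b : bool) :
  x * `|x| = (-1) ^+ b * (y * `|y|) -> x = (-1) ^+ b * y.
Proof.
have sgE (z : R) : Num.sg (z * `|z|) = Num.sg z.
  by rewrite sgrM; have [->|z0] := eqVneq z 0; rewrite ?sgr0 ?mul0r // sgr_norm z0 mulr1.
move=> E; have En : `|x| = `|y|.
  have := congr1 (fun z : R => `|z|) E; rewrite normrMsign !normrM !normr_id -!expr2 => /eqP.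
  by rewrite eqrXn2 // => /eqP.
have := congr1 Num.sg E; rewrite [RHS]sgrM !sgE => Es.
rewrite [x]numEsg [y]numEsg -En Es mulrA; congr (_ * _ * _).
by case: b {E Es} => /=; rewrite ?sgrN1 ?sgr1.
Qed.

Section Existence.
Variables (R : realType) (n : nat) (c : structure_constants R n) (eps : 'cV[R]_n) (D : 'M[R]_n).
Hypothesis sol : nice_soliton c (fun i => D i i) (off_diagonal D) (fun i => eps i 0).

Definition entries_syntax : seq (line_syntax * seq nat) :=
  [seq (l, sg) | l <- lines_syntax, sg <- ls_signs l].

Definition entry_of (x : line_syntax * seq nat) : entry R := (line_of R x.1, x.2).

Lemma entriesE : entries R = map entry_of entries_syntax.
Proof.
by rewrite /entries linesE.
Qed.

Lemma exists_entry : check_dim qlines n -> exists2 x, x \in entries_syntax &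
  exists p s, relabels c eps D (entry_sc (entry_of x)) (entry_eps (entry_of x))
    (entry_derivation (entry_of x)) p s.
Proof.
case: n c eps D sol => [|m] c' eps' D' sol'.
  by case: (ns_nonzero sol') => -[].
have [d dP] := ns_depth sol'; have [s inj_s sP] := sort_by_depth d.
have sol2 := nice_soliton_relabel inj_s sol'.
have srt i j k : c' (s i) (s j) (s k) != 0 -> (j < k)%N by move=> /dP[_ /sP].
move=> chk; have [k [sg [p [b [klt lm]]]]] := check_dimP sol2 srt chk.
rewrite qlinesE size_map in klt.
pose l0 := Line_syntax 0 [::] [::] [::] [::].
pose l := nth l0 lines_syntax k.
have lE : nth empty_qline qlines k = qline_of l by rewrite qlinesE (nth_map l0).
rewrite {}lE in lm; have [dl szp up bp sgin lmd lme lmf lmt] := lm.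
have lin : l \in lines_syntax by apply: mem_nth.
have okl : line_ok l by apply: (allP lines_ok).
exists (l, sg); first by apply/allpairsPdep; exists l, sg.
have [s' sK s'K] := injF_bij inj_s.
have plt i : (place p i < ls_dim l)%N.
  rewrite (_ : ls_dim l = m.+1) //; have [ip|ip] := ltnP i (size p).
    by apply: (allP bp); apply: mem_nth.
  by rewrite /place nth_default.
(* The inverse [s'] undoes the sorting before the placement found by the check is applied. *)
pose q (i : 'I_m.+1) : 'I_(ls_dim l) := Ordinal (plt (s' i)).
exists q, (fun i => (-1) ^+ bit b (s' i)); split.
- apply: inj_card_bij; last by rewrite !card_ord (_ : entry_dim _ = m.+1).
  move=> i j /(congr1 val) /= /eqP; rewrite nth_uniq ?szp ?ltn_ord // => /eqP/ord_inj.
  exact: (can_inj s'K).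
- by move=> i; case: (bit b _); [right | left].
- by move=> i; rewrite (entry_epsE R sg (q i)) -[X in eps' X 0]s'K lme.
- move=> i j k0; have := lmf (s' i) (s' j) (s' k0); rewrite !s'K.
  have := entry_scE R sg okl (q i) (q j) (q k0); rewrite /= => <- /mul_norm_inj ->.
  rewrite !signr_addb; case: (bit b (s' i)); case: (bit b (s' j)); case: (bit b (s' k0));
    rewrite /=; ring.
move=> i j; have [<-|ij] := eqVneq i j.
  congr (_ * _); have := lmd (s' i); rewrite s'K => ->.
  by rewrite (entry_diag R sg okl (q i)).
have qij : q i != q j.
  apply: contraNneq ij => /(congr1 val) /= /eqP.
  by rewrite nth_uniq ?szp ?ltn_ord // => /eqP/ord_inj/(can_inj s'K) ->.
have := lmt (s' i) (s' j); rewrite !s'K.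
have := entry_off_diagonal R sg okl (q i) (q j); rewrite /= => <- /mul_norm_inj.
rewrite /off_diagonal (negPf ij) (negPf qij) => ->.
rewrite signr_addb; case: (bit b (s' i)); case: (bit b (s' j)); rewrite /=; ring.
Qed.

End Existence.

(** * Uniqueness of the entry *)

Local Open Scope ring_scope.

(** The search in [related_lines] succeeds at the list of values of [p] and the signs of [s]. *)
Lemma related_of_relabels (R : realType) (x y : line_syntax * seq nat) p s :
  line_ok x.1 -> line_ok y.1 ->
  relabels (entry_sc (entry_of R x)) (entry_eps (entry_of R x)) (entry_derivation (entry_of R x))
    (entry_sc (entry_of R y)) (entry_eps (entry_of R y)) (entry_derivation (entry_of R y)) p s ->
  related_lines (qline_of x.1) (qline_of y.1) x.2 y.2.
Proof.
case: x y p s => [l sg] [l' sg'] p s ok ok' [bij_p Hs He Hc HD]; rewrite /related_lines /=.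
set n := ls_dim l in p s bij_p Hs He Hc HD *.
have inj_p := bij_inj bij_p.
have nn : n = ls_dim l' by have := bij_eq_card bij_p; rewrite !card_ord.
rewrite nn eqxx -nn lhasE.
pose pl := [seq val (p i) | i <- enum 'I_n]; pose sb : bitseq := [seq s i == -1 | i <- enum 'I_n].
have plE (i : 'I_n) : place pl i = p i.
  by rewrite /place (nth_map i) ?size_enum_ord // nth_ord_enum.
have sbE (i : 'I_n) : s i = (-1) ^+ bit sb i.
  rewrite /bit (nth_map i) ?size_enum_ord // nth_ord_enum.
  by case: (Hs i) => ->; rewrite ?eqxx // eq_sym eqNr oner_eq0.
apply/hasP; exists pl.
  rewrite placementsP //= take0 size_map size_enum_ord !eqxx /=; apply/and3P; split.
  - by rewrite map_inj_uniq; [exact: enum_uniq | move=> i j /val_inj/inj_p].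
  - by apply/allP => _ /mapP[i _ ->]; move: (ltn_ord (p i));
    rewrite [X in (_ < X)%N -> _]/entry_dim /= -nn.
  apply/allP => i; rewrite size_map size_enum_ord mem_iota add0n => /andP[_ iN].
  rewrite -[i]/(val (Ordinal iN)) plE; move: (Ordinal iN) => {iN} i'.
  have := He i'; rewrite !entry_epsE => /signr_inj ->; rewrite eqxx.
  have := HD i' i'; rewrite (Qeq_boolE R) -(entry_diag R sg ok) -(entry_diag R sg' ok').
  by case: (Hs i') => ->; rewrite ?mul1r ?mulN1r; first [move=> /oppr_inj -> | move=> ->].
rewrite lhasE; apply/hasP; exists sb; first by rewrite bitseqsP size_map size_enum_ord.
have norm (x y : R) (b : bool) : x = (-1) ^+ b * y -> x * `|x| = (-1) ^+ b * (y * `|y|).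
  by move=> ->; rewrite normrMsign mulrA.
rewrite lallE; case: allP => [_|[]]; last first.
  move=> [[i j] k]; rewrite mem_upper_arrows => /and3P[ij jk kn] /=.
  have jn := ltn_trans jk kn; have iN := ltn_trans ij jn.
  rewrite -[i]/(val (Ordinal iN)) -[j]/(val (Ordinal jn)) -[k]/(val (Ordinal kn)).
  move: (Ordinal iN) (Ordinal jn) (Ordinal kn) => {ij jk kn iN jn} i' j' k'.
  rewrite (Qeq_boolE R) Qsign_val /arrow_at /= !plE -(entry_scE R sg ok) -(entry_scE R sg' ok').
  apply/eqP/norm; have := Hc i' j' k'; rewrite !sbE /arrow_bit /=.
  by case: (bit sb i'); case: (bit sb j'); case: (bit sb k') => /=; lra.
rewrite lallE; apply/allP => -[i j]; rewrite mem_off_pairs => /and3P[ij iN jn] /=.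
rewrite -[i]/(val (Ordinal iN)) -[j]/(val (Ordinal jn)).
have : Ordinal iN != Ordinal jn by [].
move: (Ordinal iN) (Ordinal jn) => {ij iN jn} i' j' ij'.
rewrite (Qeq_boolE R) Qsign_val /pair_at /= !plE.
rewrite -(entry_off_diagonal R sg ok) -(entry_off_diagonal R sg' ok').
apply/eqP/norm; have := HD i' j'; rewrite !sbE /pair_bit /= /off_diagonal.
rewrite (inj_eq inj_p) (negPf ij').
by case: (bit sb i'); case: (bit sb j') => /=; lra.
Qed.

Lemma qentriesE : qentries qlines = [seq (qline_of x.1, x.2) | x <- entries_syntax].
Proof. by rewrite qlinesE. Qed.

Theorem theorem3p2 (R : realType) (n : nat) (Delta : diagram n)
    (cA : {set 'I_n * 'I_n}) (A : 'I_n -> 'I_n -> R) (D : 'M[R]_n)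
    (c : structure_constants R n) (eps : 'cV[R]_n) :
  (n <= 5)%N -> n <> 2%N ->
  is_nice_diagram R Delta ->
  nondiagonal_triple Delta cA A D ->
  nondiagonal_solution Delta cA A D c eps ->
  is_metric_solution c (diag_metric eps) D /\
  exists! k : 'I_(size (entries R)),
    equivalent_to_entry c (diag_metric eps) D (tnth (in_tuple (entries R)) k).
Proof.
move=> n5 n2 _ triple sol; have nice := nice_soliton_of_solution triple sol.
split; first by apply: metric_solution_of_soliton => //; case: sol.
have chk : check_dim qlines n.
  have chk1 m : m \in [:: 1; 3; 4; 5]%N -> check_dim qlines m := allP check_dims m.
  (* In dimension 0 there are no pairs, and the check evaluates to [true] by conversion. *)
  have [->|n0] := eqVneq n 0%N; first by [].
  apply: chk1; move: n5 n2 n0; rewrite !inE; case: (n) => [|[|[|[|[|[|m]]]]]] //= _ n2 _.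
have [x xin [p [s rel]]] := exists_entry nice chk.
pose x0 : line_syntax * seq nat := (Line_syntax 0 [::] [::] [::] [::], [::]).
have szE : size (entries R) = size entries_syntax by rewrite entriesE size_map.
have klt : (index x entries_syntax < size (entries R))%N by rewrite szE index_mem.
have tnthE (k : 'I_(size (entries R))) :
    tnth (in_tuple (entries R)) k = entry_of R (nth x0 entries_syntax k).
  rewrite (tnth_nth (entry_of R x0)) /= entriesE (nth_map x0) // -szE; exact: ltn_ord.
exists (Ordinal klt); split=> [|k].
  by rewrite tnthE nth_index //; apply: equivalent_of_relabels rel.
rewrite tnthE => equiv; apply: val_inj => /=.
set y := nth x0 entries_syntax k in equiv.
have yin : y \in entries_syntax by apply: mem_nth; rewrite -szE.
have okP z : z \in entries_syntax -> line_ok z.1.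
  by case/allpairsPdep => l [sg [lin _ ->]]; apply: (allP lines_ok).
have [p' [s' rel']] : exists p' s', relabels c eps D (entry_sc (entry_of R y))
    (entry_eps (entry_of R y)) (entry_derivation (entry_of R y)) p' s'.
  apply: relabels_of_equivalent equiv; first exact: (ns_sign nice).
  by move=> i; rewrite mxE; case: ifP; [right | left].
(* Both directions are prepared because [check_distinct] compares an entry only with later ones. *)
have relxy : related_lines (qline_of x.1) (qline_of y.1) x.2 y.2.
  have [q [r rel2]] := relabels_trans rel rel'.
  exact: related_of_relabels (okP x xin) (okP y yin) rel2.
have relyx : related_lines (qline_of y.1) (qline_of x.1) y.2 x.2.
  have [q [r rel2]] := relabels_trans rel' rel.
  exact: related_of_relabels (okP y yin) (okP x xin) rel2.
have := entries_distinct; rewrite /check_distinct qentriesE.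
move/(pairwiseP (empty_qline, [::])); rewrite size_map => distinct.
have kin : (k < size entries_syntax)%N by rewrite -szE.
have xidx : (index x entries_syntax < size entries_syntax)%N by rewrite index_mem.
have [lt|gt|//] := ltngtP (index x entries_syntax) k.
  have := distinct _ _ xidx kin lt.
  by rewrite !(nth_map x0) // nth_index // relxy.
have := distinct _ _ kin xidx gt.
by rewrite !(nth_map x0) // nth_index // relyx.
Qed.
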